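(* Suppose that $T$ is a computable real with $0<T\le1$. Let $V$ and $W$ be optimal prefix-free machines, and let $f\colon\mathbb{N}\to\mathbb{N}$ be an order function. Then the following two conditions are equivalent: (i) There exists $c\in\mathbb{N}$ such that $\operatorname{dom}W$ is reducible to $\mathrm{Pf}(Z_V(T))$ in query size $f(n)+c$ (that is, in query size given by the function $n\mapsto f(n)+c$). (ii) There exists $c\in\mathbb{N}$ such that $n/T\le f(n)+c$ for all $n\in\mathbb{N}$.
   Context: $\{0,1\}^*$ is the set of finite binary strings and $|x|$ is the length of $x$. A prefix-free machine is a partial recursive function $F\colon\{0,1\}^*\to\{0,1\}^*$ whose domain $\operatorname{dom}F$ is prefix-free. A prefix-free machine $V$ is optimal if for each prefix-free machine $F$ there exists $d\in\mathbb{N}$ such that for every $p\in\operatorname{dom}F$ there is $q\in\operatorname{dom}V$ with $V(q)=F(p)$ and $|q|\le|p|+d$. For a real $T$ with $0<T\le1$, $Z_V(T)=\sum_{p\in\operatorname{dom}V}2^{-|p|/T}$, which converges with $0<Z_V(T)<1$. A real $\alpha$ is computable if there is a computable sequence $\{a_n\}_{n\in\mathbb{N}}$ of rationals with $|\alpha-a_n|<2^{-n}$ for all $n\in\mathbb{N}$. For a real $\alpha$ and $n\in\mathbb{N}$, $\alpha\!\upharpoonright_n\in\{0,1\}^*$ denotes the first $n$ bits of the base-two expansion of $\alpha-\lfloor\alpha\rfloor$ with infinitely many zeros, and $\mathrm{Pf}(\alpha)=\{\alpha\!\upharpoonright_n\mid n\in\mathbb{N}\}\subset\{0,1\}^*$.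 For $f\colon\mathbb{N}\to\mathbb{N}$ and $A,B\subset\{0,1\}^*$, $A$ is reducible to $B$ in query size $f$ if there exists an oracle deterministic Turing machine $M$ such that $A$ is Turing reducible to $B$ via $M$ and, on every input $x\in\{0,1\}^*$, $M$ only queries strings of length at most $f(|x|)$. An order function is a non-decreasing total recursive function $f\colon\mathbb{N}\to\mathbb{N}$ with $\lim_{n\to\infty}f(n)=\infty$. *)

(* Defs.v *)
From HB Require Import structures.
From mathcomp Require Import all_boot all_order all_algebra.
From mathcomp Require Import all_classical all_reals all_analysis.

Set Implicit Arguments.
Unset Strict Implicit.
Unset Printing Implicit Defensive.

Import Order.TTheory GRing.Theory Num.Theory.
Import numFieldNormedType.Exports.

Local Open Scope classical_set_scope.
Local Open Scope ring_scope.

Notation string := (seq bool).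

(** * Partial recursive functions *)

(* Kleene's schemes for n-ary partial recursive functions on nat. *)
Inductive rec_scheme : nat -> Type :=
| RZero : rec_scheme 0
| RSucc : rec_scheme 1
| RProj n of 'I_n : rec_scheme n
| RComp m n of rec_scheme m & ('I_m -> rec_scheme n) : rec_scheme n
| RPrim n of rec_scheme n & rec_scheme n.+2 : rec_scheme n.+1
| RMu n of rec_scheme n.+1 : rec_scheme n.

(* [rec_eval e v y]: the function described by [e] is defined at [v], with
   value [y].  Primitive recursion is on the first argument; [s] is the
   sequence of its successive values.  [RMu g] is unbounded minimisation: [g]
   must be defined, and nonzero, at every value below the one returned. *)
Fixpoint rec_eval n (e : rec_scheme n) : n.-tuple nat -> nat -> Prop :=
  match e in rec_scheme n return n.-tuple nat -> nat -> Prop with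
  | RZero => fun _ y => y = 0%N
  | RSucc => fun v y => y = (thead v).+1
  | RProj n i => fun v y => y = tnth v i
  | RComp m n g h => fun v y =>
      exists w : m.-tuple nat,
        (forall i, rec_eval (h i) v (tnth w i)) /\ rec_eval g w y
  | RPrim n g h => fun v y =>
      exists s : nat -> nat,
        [/\ rec_eval g (behead_tuple v) (s 0%N),
            forall k, (k < thead v)%N ->
              rec_eval h [tuple of k :: s k :: behead_tuple v] (s k.+1)
          & y = s (thead v)]
  | RMu n g => fun v y =>
      rec_eval g [tuple of y :: v] 0%N /\
      forall z, (z < y)%N -> exists u, rec_eval g [tuple of z :: v] u.+1
  end.

Definition total_recursive (f : nat -> nat) : Prop :=
  exists e : rec_scheme 1, forall n y, rec_eval e [tuple n] y <-> y = f n.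

(* The bijection from strings to nat given by the length-lexicographic order:
   x is sent to (the number with binary notation 1x) - 1. *)
Definition string_code (x : string) : nat :=
  (foldl (fun n (b : bool) => n.*2 + b)%N 1%N x).-1.

(* A partial function is a map to an option type, [None] meaning undefined. *)
Definition partial_recursive (F : string -> option string) : Prop :=
  exists e : rec_scheme 1, forall x n,
    rec_eval e [tuple string_code x] n <->
    exists2 y, F x = Some y & n = string_code y.

(** * Prefix-free machines *)

Definition dom (F : string -> option string) : set string := [set p | F p].

Definition prefix_free (A : set string) : Prop :=
  forall p q, A p -> A q -> prefix p q -> p = q.

Definition prefix_free_machine (F : string -> option string) : Prop :=
  partial_recursive F /\ prefix_free (dom F).

Definition optimal_prefix_free_machine (V : string -> option string) : Prop :=
  prefix_free_machine V /\
  forall F, prefix_free_machine F ->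
    exists d : nat, forall p, dom F p ->
      exists q, [/\ dom V q, V q = F p & (size q <= size p + d)%N].

Definition halting_sum (R : realType) (V : string -> option string) (T : R) : R :=
  fine (\esum_(p in dom V) (2 `^ (- (size p)%:R / T))%:E).

(** * Computable reals, binary expansions *)

Definition computable_rat_seq (a : nat -> rat) : Prop :=
  exists s p q : nat -> nat,
    [/\ total_recursive s, total_recursive p, total_recursive q &
        forall n, q n != 0%N /\ a n = (-1) ^+ s n * ((p n)%:R / (q n)%:R)].

Definition computable_real (R : realType) (x : R) : Prop :=
  exists2 a : nat -> rat, computable_rat_seq a &
    forall n, `|x - ratr (a n)| < 2 ^- n.

(* [b] is the base-two expansion of the fractional part of [x] that has
   infinitely many zeros; it exists and is unique. *)
Definition binary_expansion (R : realType) (x : R) (b : nat -> bool) : Prop :=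
  series (fun i => (b i)%:R / 2 ^+ i.+1) @ \oo --> x - (Num.floor x)%:~R /\
  forall n, exists2 m, (n <= m)%N & b m = false.

Definition Pf (R : realType) (x : R) : set string :=
  [set w | exists2 b, binary_expansion x b & exists n, w = mkseq b n].

(** * Oracle Turing machines *)

Inductive direction := Left | Stay | Right.

(* Tape symbols: the blank [None], the two bits, and auxiliary symbols. *)
Definition symbol (G : finType) : Type := option (bool + G).

(* A deterministic oracle machine with [ntapes.+1] two-way infinite work tapes
   (tape 0 holds the input) and a write-only query tape: each ordinary move may
   append one bit to the query tape.  Entering [otm_query] asks whether the
   string on the query tape is in the oracle, moves to [otm_yes] or [otm_no]
   accordingly and erases the query tape. *)
Record oracle_tm := OracleTM {
  otm_state : finType;
  otm_aux : finType;
  otm_ntapes : nat;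
  otm_start : otm_state;
  otm_accept : otm_state;
  otm_reject : otm_state;
  otm_query : otm_state;
  otm_yes : otm_state;
  otm_no : otm_state;
  otm_distinct :
    uniq [:: otm_accept; otm_reject; otm_query; otm_yes; otm_no];
  otm_delta : otm_state -> otm_ntapes.+1.-tuple (symbol otm_aux) ->
    otm_state * otm_ntapes.+1.-tuple (symbol otm_aux * direction) * option bool
}.

(* [tape_left] is read away from the head, [tape_right] starts with the scanned
   cell; all cells beyond either list are blank. *)
Record tape (G : finType) := Tape {
  tape_left : seq (symbol G);
  tape_right : seq (symbol G)
}.

Definition tape_read (G : finType) (t : tape G) : symbol G :=
  head None (tape_right t).

Definition tape_act (G : finType) (t : tape G) (a : symbol G * direction) :
    tape G :=
  let: Tape l r := t in
  let: (s, d) := a in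
  match d with
  | Left => Tape (behead l) (head None l :: s :: behead r)
  | Stay => Tape l (s :: behead r)
  | Right => Tape (s :: l) (behead r)
  end.

Record config (M : oracle_tm) := Config {
  cfg_state : otm_state M;
  cfg_tapes : (otm_ntapes M).+1.-tuple (tape (otm_aux M));
  cfg_query : string
}.

Definition initial_config (M : oracle_tm) (x : string) : config M :=
  Config (otm_start M)
    [tuple of Tape [::] [seq Some (inl b) | b <- x] ::
              nseq_tuple (otm_ntapes M) (Tape [::] [::])]
    [::].

(* Halted configurations are fixed points. *)
Definition otm_step (M : oracle_tm) (B : set string) (c : config M) :
    config M :=
  let: Config q ts w := c in
  if q \in [:: otm_accept M; otm_reject M] then c
  else if q == otm_query M then
    Config (if w \in B then otm_yes M else otm_no M) ts [::]
  else
    let: (q', acts, o) := otm_delta q (map_tuple (@tape_read _) ts) in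
    Config q' [tuple tape_act (tnth ts i) (tnth acts i) | i < (otm_ntapes M).+1]
      (if o is Some b then rcons w b else w).

Definition otm_run (M : oracle_tm) (B : set string) (x : string) (t : nat) :
    config M :=
  iter t (otm_step B) (initial_config M x).

Definition turing_reducible_via (M : oracle_tm) (A B : set string) : Prop :=
  forall x, exists t,
    cfg_state (otm_run M B x t) =
      if x \in A then otm_accept M else otm_reject M.

Definition query_bounded (M : oracle_tm) (B : set string) (f : nat -> nat) :
    Prop :=
  forall x t, cfg_state (otm_run M B x t) = otm_query M ->
    (size (cfg_query (otm_run M B x t)) <= f (size x))%N.

Definition reducible_in_query_size (f : nat -> nat) (A B : set string) : Prop :=
  exists M : oracle_tm, turing_reducible_via M A B /\ query_bounded M B f.

Definition order_function (f : nat -> nat) : Prop :=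
  [/\ total_recursive f, {homo f : m n / (m <= n)%N} & f @ \oo --> \oo].

(* Main.v *)
Require Import Defs.
From mathcomp Require Import all_boot all_order all_algebra.
From mathcomp Require Import all_classical all_reals all_analysis.
From mathcomp Require Import zify ring lra.

Set Implicit Arguments.
Unset Strict Implicit.
Unset Printing Implicit Defensive.

Import Order.TTheory GRing.Theory Num.Theory.
Import numFieldNormedType.Exports.

(** The real [Z = halting_sum V T] is approximated from below by the stages of an
    enumeration of [dom V], and both directions compare the first [m] digits of
    [Z] with the strings that are still missing at a stage.  A missing string of
    length [l] adds [2 ^ (- l / T)] to [Z].

    A bound on [n / T] gives a reduction.  Let [m] be a little above [n / T] and
    ask the oracle for the first [m] digits of [Z].  At a stage whose sum agrees
    with these digits up to [2 / 2 ^ m], no string of length at most about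
    [T * m], hence none of length at most [n + d], is missing.  The constant [d]
    comes from the optimality of [V]: the machine mapping [p] in [dom W] to the
    time at which [p] is enumerated into [dom W] is simulated by [V], so these
    times, for [p] of length at most [n], are among the outputs of [V] found so
    far.  It remains to wait for the largest of them ([reducible_of_bound]).

    Conversely, if [dom W] is reducible with query size [f n + c], then from the
    first [m = f n + c] digits of [Z] one computes [dom W] up to length [n], and
    therefore a string that is not an output of [W] on any input of length at
    most [n].  So it suffices to describe these digits by fewer than
    [n - O(1)] bits.  Let each string of length [l] in [dom V] count
    [min 1 (2 ^ (m - l / T))].  The total count is at most [2 ^ (T * m)], by
    Kraft's inequality and because [min 1 x <= x ^ T] for [T <= 1]
    ([capped_dominated]).  Once the missing count is below [1], every missing
    string counts its true contribution to [2 ^ m * Z], so the digits are known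
    up to one bit.  The integer part of (four times) the count, with that bit,
    is thus a description of about [T * m] bits ([digits_from_count]).  If
    [n / T - f n] is unbounded, then lengths [n] with
    [T * m + 2 * d + 10 <= n] can be computed from [d] ([sparse_lengths]), and
    the description, made self-delimiting by a prefix of [d + 1] bits, is shorter
    than [n] by more than any constant ([bound_of_reducible]).

    The weights [2 ^ (- l / T)] have to be computed from rational approximations
    of [T] ([weight_approx]).  The machines of both directions are obtained from
    three translations: partial recursive functions have computable evaluators
    with bounded time ([stage_function]), they can be run by oracle machines, via
    programs over counters ([oracle_decision]), and the runs of an oracle machine
    with a finite oracle are computable ([simulate_run]).  Everything else is
    computable by the closure properties collected in the tactic [comp]. *)

(** * Recursive functions of several variables *)

(** Arguments are given as a sequence rather than a tuple, so that argument
    positions are plain numbers; only sequences of size [n] matter. *)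
Definition trec n (g : seq nat -> nat) : Prop :=
  exists e : rec_scheme n, forall (v : n.-tuple nat) y,
    rec_eval e v y <-> y = g v.

Lemma trec_ext n g g' :
  (forall v, size v = n -> g v = g' v) -> trec n g -> trec n g'.
Proof.
move=> gg' [e he]; exists e => v y.
by rewrite -gg' ?size_tuple //; exact: he.
Qed.

Lemma trec_nth n i : (i < n)%N -> trec n (fun v => nth 0 v i).
Proof.
move=> lti; exists (RProj (Ordinal lti)) => v y /=.
by rewrite (tnth_nth 0).
Qed.

Lemma trec_comp m n g (hs : nat -> seq nat -> nat) :
  trec m g -> (forall i, (i < m)%N -> trec n (hs i)) ->
  trec n (fun v => g [seq hs i v | i <- iota 0 m]).
Proof.
move=> [eg heg] hhs.
have /choice[eh heh] : forall i : 'I_m, exists e : rec_scheme n,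
  forall (v : n.-tuple nat) y, rec_eval e v y <-> y = hs i v.
  by move=> i; apply: hhs.
exists (RComp eg eh) => v y /=.
have eqw : [tuple hs i v | i < m] = [seq hs i v | i <- iota 0 m] :> seq nat.
  by rewrite /= -val_enum_ord -map_comp.
split.
  move=> [w [hw /heg ->]]; rewrite -eqw; congr (g (val _)).
  by apply: eq_from_tnth => i; rewrite tnth_mktuple; apply/heh.
move=> ->; exists [tuple hs i v | i < m]; split.
  by move=> i; apply/heh; rewrite tnth_mktuple.
by apply/heg; rewrite eqw.
Qed.

Lemma trec_comp1 n g f :
  total_recursive g -> trec n f -> trec n (fun v => g (f v)).
Proof.
move=> [eg heg] hf.
have g1 : trec 1 (fun v => g (nth 0 v 0)).
  exists eg => v y; rewrite -heg.
  have -> // : v = [tuple nth 0 v 0].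
  by case/tupleP: v => a w; rewrite (tuple0 w); apply: val_inj.
by have := @trec_comp 1 n _ (fun _ => f) g1 (fun _ _ => hf).
Qed.

Lemma trec_succ n f : trec n f -> trec n (fun v => (f v).+1).
Proof.
move=> hf; apply: (@trec_comp1 n succn) => //.
by exists RSucc => k y.
Qed.

Lemma trec_const n c : trec n (fun _ => c).
Proof.
elim: c => [|c IH]; last exact: (trec_succ IH).
have h0 : trec 0 (fun _ => 0) by exists RZero.
by have := @trec_comp 0 n _ (fun _ _ => 0) h0; apply.
Qed.

Lemma iota_nth (v : seq nat) : [seq nth 0 v i | i <- iota 0 (size v)] = v.
Proof. by rewrite map_nth_iota0 // take_size. Qed.

Lemma trec_rec n m b s :
  trec n m -> trec n b -> trec n.+2 s ->
  trec n (fun v => nat_rec (fun _ => nat) (b v) (fun k r => s (k :: r :: v)) (m v)).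
Proof.
move=> hm [eb heb] [es hes].
pose F v := nat_rec (fun _ => nat) (b (behead v))
  (fun k r => s (k :: r :: behead v)) (head 0 v).
have hF : trec n.+1 F.
  exists (RPrim eb es) => v y /=.
  have hd : thead v = head 0 v by case/tupleP: v => a w; rewrite theadE.
  split.
    move=> [c [/heb c0 cs ->]]; rewrite /F -hd.
    elim: (thead v) cs => [|k IH] cs //=.
    have /hes -> := cs k (ltnSn k); congr (s [:: _, _ & _]).
    by apply: IH => j jk; apply: cs; apply: ltnW.
  move=> ->; exists (fun k => nat_rec (fun _ => nat) (b (behead v))
    (fun k r => s (k :: r :: behead v)) k); split; first by apply/heb.
    by move=> k _; apply/hes.
  by rewrite hd.
pose hs i v := if i is j.+1 then nth 0 v j else m v.
have hhs i : (i < n.+1)%N -> trec n (hs i).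
  by case: i => [|i] // lti; apply: trec_nth.
apply: trec_ext (trec_comp hF hhs) => v sv.
rewrite /F /=.
suff -> : [seq hs i v | i <- iota 1 n] = v by [].
by rewrite (iotaDl 1 0) -map_comp -sv -[RHS]iota_nth.
Qed.

Lemma trec_drop n k f : trec n f -> trec (k + n) (fun v => f (drop k v)).
Proof.
move=> hf.
have hh i : (i < n)%N -> trec (k + n) (fun v => nth 0 v (k + i)).
  by move=> lti; apply: trec_nth; rewrite ltn_add2l.
apply: trec_ext (trec_comp hf hh) => v sv; congr (f _).
have sd : size (drop k v) = n by rewrite size_drop sv addKn.
rewrite -[RHS]iota_nth sd; apply: eq_map => i.
by rewrite nth_drop.
Qed.

Lemma trec_add n f g : trec n f -> trec n g -> trec n (fun v => f v + g v).
Proof.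
move=> hf hg.
have hs : trec n.+2 (fun v => (nth 0 v 1).+1) by apply/trec_succ/trec_nth.
apply: trec_ext (trec_rec hg hf hs) => v _ /=.
by elim: (g v) => [|k IH] /=; rewrite ?addn0 // IH addnS.
Qed.

Lemma trec_pred n f : trec n f -> trec n (fun v => (f v).-1).
Proof.
move=> hf; have hs : trec n.+2 (fun v => nth 0 v 0) by apply: trec_nth.
apply: trec_ext (trec_rec hf (trec_const n 0) hs) => v _ /=.
by case: (f v).
Qed.

Lemma trec_sub n f g : trec n f -> trec n g -> trec n (fun v => f v - g v).
Proof.
move=> hf hg.
have hs : trec n.+2 (fun v => (nth 0 v 1).-1) by apply/trec_pred/trec_nth.
apply: trec_ext (trec_rec hg hf hs) => v _ /=.
by elim: (g v) => [|k IH] /=; rewrite ?subn0 // IH subnS.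
Qed.

Lemma trec_mul n f g : trec n f -> trec n g -> trec n (fun v => f v * g v).
Proof.
move=> hf hg.
have hs : trec n.+2 (fun v => nth 0 v 1 + g (drop 2 v)).
  by apply: trec_add; [apply: trec_nth | apply: (trec_drop 2)].
apply: trec_ext (trec_rec hf (trec_const n 0) hs) => v _ /=.
by elim: (f v) => [|k IH] //=; rewrite IH drop0 mulSn addnC.
Qed.

Lemma rec_mu n g : trec n.+1 g -> exists e : rec_scheme n,
  forall (v : n.-tuple nat) y, rec_eval e v y <->
    g (y :: v) = 0 /\ forall z, (z < y)%N -> g (z :: v) <> 0.
Proof.
move=> [e he]; exists (RMu e) => v y /=; split.
  move=> [/he h0 hz]; split=> // z /hz[u /he]; rewrite /= => <-.
  by [].
move=> [h0 hz]; split; first exact/he.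
move=> z /hz; rewrite /=; case E : (g _) => [//|u] _; exists u.
by apply/he.
Qed.

Lemma trec_mu n g h : trec n.+1 g ->
  (forall v, size v = n ->
     g (h v :: v) = 0 /\ forall z, (z < h v)%N -> g (z :: v) <> 0) ->
  trec n h.
Proof.
move=> /rec_mu[e he] hh; exists e => v y; rewrite he.
have [h0 hl] := hh v (size_tuple v); split; last by move=> ->.
move=> [y0 yl]; apply/eqP; rewrite eqn_leq; apply/andP; split.
  by rewrite leqNgt; apply/negP => /yl.
by rewrite leqNgt; apply/negP => /hl.
Qed.

(** * A pairing function *)

Lemma isqrt_subproof n : exists s, (n < s.+1 ^ 2)%N.
Proof. by exists n; rewrite expnS expn1 mulSn; lia. Qed.

Definition isqrt n := ex_minn (isqrt_subproof n).

(** Any pair is recovered from [pair a b] with an integer square root, since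
    [pair a b] lies between the consecutive squares of [a + b] and
    [a + b + 1]. *)
Definition pair a b := (a + b) ^ 2 + a.
Definition pi1 n := n - isqrt n ^ 2.
Definition pi2 n := isqrt n - pi1 n.

Lemma isqrt_pair a b : isqrt (pair a b) = a + b.
Proof.
rewrite /isqrt; case: ex_minnP => s hs smin; apply/eqP; rewrite eqn_leq.
rewrite smin /=; last by rewrite /pair; nia.
by rewrite leqNgt; apply/negP => ?; move: hs; rewrite /pair; nia.
Qed.

Lemma pairK1 a b : pi1 (pair a b) = a.
Proof. by rewrite /pi1 isqrt_pair /pair addKn. Qed.

Lemma pairK2 a b : pi2 (pair a b) = b.
Proof. by rewrite /pi2 pairK1 isqrt_pair addKn. Qed.

Lemma trec_pair n f g : trec n f -> trec n g -> trec n (fun v => pair (f v) (g v)).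
Proof.
move=> hf hg; have hs := trec_add hf hg.
exact: (trec_add (trec_mul hs hs)).
Qed.

Lemma trec_isqrt n f : trec n f -> trec n (fun v => isqrt (f v)).
Proof.
move=> hf.
pose g v := (f (drop 1 v)).+1 - (nth 0 v 0).+1 * (nth 0 v 0).+1.
have hg : trec n.+1 g.
  apply: trec_sub; first by apply/trec_succ/(trec_drop 1).
  by apply: trec_mul; apply/trec_succ/trec_nth.
apply: (trec_mu hg) => v _; rewrite /g /= drop0 /isqrt.
case: ex_minnP => s hs smin; split; first by nia.
by move=> z zs; case: (ltnP (f v) (z.+1 ^ 2)) => [/smin|]; nia.
Qed.

Lemma trec_pi1 n f : trec n f -> trec n (fun v => pi1 (f v)).
Proof.
by move=> hf; have h := trec_isqrt hf; apply: trec_sub => //; apply: trec_mul.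
Qed.

Lemma trec_pi2 n f : trec n f -> trec n (fun v => pi2 (f v)).
Proof.
by move=> hf; apply: trec_sub; [apply: trec_isqrt | apply: trec_pi1].
Qed.

Lemma total_recursiveE f : total_recursive f <-> trec 1 (fun v => f (nth 0 v 0)).
Proof.
split=> [hf|[e he]]; first exact: (trec_comp1 hf (trec_nth (ltnSn 0))).
by exists e => n y; apply: he.
Qed.

Lemma total_recursive_rec b s : total_recursive b -> total_recursive s ->
  total_recursive (fun n => nat_rec (fun _ => nat) (b (pi2 n))
    (fun k r => s (pair (pi2 n) (pair k r))) (pi1 n)).
Proof.
move=> hb hs; apply/total_recursiveE.
have h0 := trec_nth (ltnSn 0).
have hs' : trec 3 (fun v => s (pair (pi2 (nth 0 v 2)) (pair (nth 0 v 0) (nth 0 v 1)))).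
  apply: (trec_comp1 hs); apply: trec_pair; first exact/trec_pi2/trec_nth.
  by apply: trec_pair; apply: trec_nth.
exact: (trec_rec (trec_pi1 h0) (trec_comp1 hb (trec_pi2 h0)) hs').
Qed.

(** With the closure properties below, this is the only source of partial
    functions that is needed: a total test and a total read-out of its least
    solution. *)
Lemma search_recursive g out : total_recursive g -> total_recursive out ->
  exists e : rec_scheme 1, forall n y, rec_eval e [tuple n] y <->
    exists t, [/\ g (pair n t) = 0, forall z, (z < t)%N -> g (pair n z) <> 0
      & y = out (pair n t)].
Proof.
move=> hg hout.
have hg' : trec 2 (fun v => g (pair (nth 0 v 1) (nth 0 v 0))).
  by apply: (trec_comp1 hg); apply: trec_pair; apply: trec_nth.
have [e he] := rec_mu hg'.
have : trec 2 (fun v => out (pair (nth 0 v 0) (nth 0 v 1))).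
  by apply: (trec_comp1 hout); apply: trec_pair; apply: trec_nth.
move=> [eo heo].
exists (RComp eo (fun i : 'I_2 => if val i == 0 then RProj ord0 else e)) => n y /=.
split.
  move=> [w [hw /heo ->]].
  have := hw ord0; have := hw ord_max; rewrite /= => /he[/= t0 tl].
  rewrite !(tnth_nth 0) /= => w0.
  exists (nth 0 w 1); rewrite !(tnth_nth 0) /= in t0 tl.
  by rewrite w0.
move=> [t [t0 tl ->]]; exists [tuple n; t]; split; last exact/heo.
move=> i; rewrite (tnth_nth 0); case: i => -[|[|//]] lti /=.
  by rewrite (tnth_nth 0).
by apply/he; split.
Qed.

(** * Computable functions between encoded types *)

(** Only values on codes matter, so [enc] may have any range and no decoding
    function is required. *)

Class Enc (A : Type) := { enc : A -> nat }.

#[global] Instance Enc_nat : Enc nat := {| enc := id |}.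
#[global] Instance Enc_bool : Enc bool := {| enc := nat_of_bool |}.
#[global] Instance Enc_prod A B (EA : Enc A) (EB : Enc B) : Enc (A * B) :=
  {| enc := fun p => pair (enc p.1) (enc p.2) |}.
#[global] Instance Enc_seq A (EA : Enc A) : Enc (seq A) :=
  {| enc := foldr (fun a n => (pair (enc a) n).+1) 0 |}.

Definition computable A B (EA : Enc A) (EB : Enc B) (f : A -> B) : Prop :=
  exists2 g, total_recursive g & forall a, g (enc a) = enc (f a).
Arguments computable {A B EA EB} f.

Definition computable2 A B C (EA : Enc A) (EB : Enc B) (EC : Enc C)
  (f : A -> B -> C) : Prop := computable (fun p : A * B => f p.1 p.2).
Arguments computable2 {A B C EA EB EC} f.

Definition computable3 A B C D (EA : Enc A) (EB : Enc B) (EC : Enc C)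
  (ED : Enc D) (f : A -> B -> C -> D) : Prop :=
  computable (fun p : A * B * C => f p.1.1 p.1.2 p.2).
Arguments computable3 {A B C D EA EB EC ED} f.

Lemma computable_nat f : total_recursive f -> computable f.
Proof. by move=> hf; exists f. Qed.

Lemma computable_natE (f : nat -> nat) : computable f -> total_recursive f.
Proof.
move=> [g hg gf]; have <- // : g = f.
by apply/funext => n; have := gf n.
Qed.

Section Calculus.
Context {A B C D : Type} {EA : Enc A} {EB : Enc B} {EC : Enc C} {ED : Enc D}.

Lemma computable_ext (f g : A -> B) : f =1 g -> computable f -> computable g.
Proof. by move=> /funext ->. Qed.

Lemma c_id : computable (fun a : A => a).
Proof.
by exists id => //; apply/total_recursiveE; apply: (trec_nth (ltnSn 0)).
Qed.

Lemma c_const (b : B) : computable (fun _ : A => b).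
Proof.
by exists (fun _ => enc b) => //; apply/total_recursiveE; apply: trec_const.
Qed.

Lemma c_comp (f : B -> C) (g : A -> B) :
  computable f -> computable g -> computable (fun a => f (g a)).
Proof.
move=> [f' hf ff'] [g' hg gg']; exists (fun n => f' (g' n)).
  by apply/total_recursiveE; apply: trec_comp1 => //; apply/total_recursiveE.
by move=> a; rewrite gg' ff'.
Qed.

Lemma c_unary (h : nat -> nat) (f : A -> B) (g : A -> C) :
  total_recursive h -> (forall a, h (enc (f a)) = enc (g a)) ->
  computable f -> computable g.
Proof.
move=> hh hfg [f' hf ff']; exists (fun n => h (f' n)).
  by apply/total_recursiveE; apply: trec_comp1 => //; apply/total_recursiveE.
by move=> a; rewrite ff' hfg.
Qed.

End Calculus.

Section Calculus1.
Context {A B C D : Type} {EA : Enc A} {EB : Enc B} {EC : Enc C} {ED : Enc D}.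

Lemma c_pair (f : A -> B) (g : A -> C) :
  computable f -> computable g -> computable (fun a => (f a, g a)).
Proof.
move=> [f' hf ff'] [g' hg gg']; exists (fun n => pair (f' n) (g' n)).
  by apply/total_recursiveE; apply: trec_pair; apply/total_recursiveE.
by move=> a; rewrite gg' ff'.
Qed.

Lemma c_fst (f : A -> B * C) : computable f -> computable (fun a => (f a).1).
Proof.
apply: c_unary => [|a]; last exact: pairK1.
by apply/total_recursiveE; apply: trec_pi1; apply: trec_nth.
Qed.

Lemma c_snd (f : A -> B * C) : computable f -> computable (fun a => (f a).2).
Proof.
apply: c_unary => [|a]; last exact: pairK2.
by apply/total_recursiveE; apply: trec_pi2; apply: trec_nth.
Qed.

Lemma c_rec (m : A -> nat) (b : A -> B) (s : A -> nat -> B -> B) :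
  computable m -> computable b -> computable (fun p => s p.1.1 p.1.2 p.2) ->
  computable (fun a => nat_rect (fun _ => B) (b a) (s a) (m a)).
Proof.
move=> [m' hm mm'] [b' hb bb'] [s' hs ss'].
pose s1 n := s' (pair (pair (pi1 n) (pi1 (pi2 n))) (pi2 (pi2 n))).
have h0 : trec 1 (fun v => nth 0 v 0) by apply: trec_nth.
have hs1 : total_recursive s1.
  apply/total_recursiveE; apply: (trec_comp1 hs).
  apply: trec_pair; first apply: trec_pair.
  - exact: trec_pi1.
  - by apply/trec_pi1/trec_pi2.
  - by apply/trec_pi2/trec_pi2.
exists (fun n => nat_rec (fun _ => nat) (b' (pi2 (pair (m' n) n)))
  (fun k r => s1 (pair (pi2 (pair (m' n) n)) (pair k r))) (pi1 (pair (m' n) n))).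
  have := total_recursive_rec hb hs1 => /trec_comp1.
  move=> /(_ 1 (fun v => pair (m' (nth 0 v 0)) (nth 0 v 0))) h.
  apply/total_recursiveE/h; apply: trec_pair => //.
  exact/total_recursiveE.
move=> a; rewrite pairK1 pairK2 mm'.
elim: (m a) => [|k IH] /=; first exact: bb'.
rewrite IH /s1 !(pairK1, pairK2).
exact: (ss' (a, k, _)).
Qed.

Lemma c_nat_of_bool (c : A -> bool) :
  computable c -> computable (fun a => nat_of_bool (c a)).
Proof. by []. Qed.

Lemma c_succ (f : A -> nat) : computable f -> computable (fun a => (f a).+1).
Proof.
by apply: c_unary => //; apply/total_recursiveE; apply: trec_succ; apply: trec_nth.
Qed.

Lemma c_pred (f : A -> nat) : computable f -> computable (fun a => (f a).-1).
Proof.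
by apply: c_unary => //; apply/total_recursiveE; apply: trec_pred; apply: trec_nth.
Qed.

Lemma c_binary (h : nat -> nat -> nat) (f g : A -> nat) :
  (forall f g, trec 1 f -> trec 1 g -> trec 1 (fun v => h (f v) (g v))) ->
  computable f -> computable g -> computable (fun a => h (f a) (g a)).
Proof.
move=> hh [f' hf ff'] [g' hg gg']; exists (fun n => h (f' n) (g' n)).
  by apply/total_recursiveE; apply: hh; apply/total_recursiveE.
by move=> a; rewrite ff' gg'.
Qed.

Lemma c_add (f g : A -> nat) :
  computable f -> computable g -> computable (fun a => f a + g a).
Proof. by apply: c_binary; apply: trec_add. Qed.

Lemma c_sub (f g : A -> nat) :
  computable f -> computable g -> computable (fun a => f a - g a).
Proof. by apply: c_binary; apply: trec_sub. Qed.

Lemma c_mul (f g : A -> nat) :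
  computable f -> computable g -> computable (fun a => f a * g a).
Proof. by apply: c_binary; apply: trec_mul. Qed.

Lemma c_pi1 (f : A -> nat) : computable f -> computable (fun a => pi1 (f a)).
Proof.
by apply: c_unary => //; apply/total_recursiveE; apply: trec_pi1; apply: trec_nth.
Qed.

Lemma c_pi2 (f : A -> nat) : computable f -> computable (fun a => pi2 (f a)).
Proof.
by apply: c_unary => //; apply/total_recursiveE; apply: trec_pi2; apply: trec_nth.
Qed.

Lemma c_comp2 (f : B -> C -> D) (g : A -> B) (h : A -> C) :
  computable2 f -> computable g -> computable h ->
  computable (fun a => f (g a) (h a)).
Proof.
by move=> hf hg hh; exact: (c_comp hf (c_pair hg hh)).
Qed.

End Calculus1.
Arguments c_rec {A B EA EB m b} s.

Lemma c_comp3 A B C D E (EA : Enc A) (EB : Enc B) (EC : Enc C) (ED : Enc D)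
    (EE : Enc E) (f : B -> C -> D -> E) (g : A -> B) (h : A -> C) (k : A -> D) :
  computable3 f -> computable g -> computable h -> computable k ->
  computable (fun a => f (g a) (h a) (k a)).
Proof.
by move=> hf hg hh hk; exact: (c_comp hf (c_pair (c_pair hg hh) hk)).
Qed.

(** Branching is recursion on the condition, seen as a number. *)
Lemma c_if A B (EA : Enc A) (EB : Enc B) (c : A -> bool) (f g : A -> B) :
  computable c -> computable f -> computable g ->
  computable (fun a => if c a then f a else g a).
Proof.
move=> hc hf hg.
have hs : computable (fun p : A * nat * B => f p.1.1).
  exact: (c_comp hf (c_fst (c_fst c_id))).
apply: computable_ext (c_rec (fun a _ _ => f a) (c_nat_of_bool hc) hg hs) => a.
by case: (c a).
Qed.

Lemma c_bool A (EA : Enc A) (c : A -> bool) :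
  computable (fun a => nat_of_bool (c a)) -> computable c.
Proof. by []. Qed.

Section Calculus2.
Context {A B : Type} {EA : Enc A} {EB : Enc B}.

Lemma c_leq (f g : A -> nat) :
  computable f -> computable g -> computable (fun a => f a <= g a)%N.
Proof.
move=> hf hg; apply: c_bool.
apply: computable_ext (c_sub (c_const 1) (c_sub hf hg)) => a.
by rewrite /leq; case: (f a - g a).
Qed.

Lemma c_andb (f g : A -> bool) :
  computable f -> computable g -> computable (fun a => f a && g a).
Proof.
move=> hf hg; apply: computable_ext (c_if hf hg (c_const false)) => a.
by case: (f a).
Qed.

Lemma c_orb (f g : A -> bool) :
  computable f -> computable g -> computable (fun a => f a || g a).
Proof.
move=> hf hg; apply: computable_ext (c_if hf (c_const true) hg) => a.
by case: (f a).
Qed.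

Lemma c_negb (f : A -> bool) : computable f -> computable (fun a => ~~ f a).
Proof.
move=> hf; apply: computable_ext (c_if hf (c_const false) (c_const true)) => a.
by case: (f a).
Qed.

Lemma c_eqn (f g : A -> nat) :
  computable f -> computable g -> computable (fun a => f a == g a).
Proof.
move=> hf hg.
apply: computable_ext (c_andb (c_leq hf hg) (c_leq hg hf)) => a.
by rewrite eqn_leq.
Qed.

End Calculus2.

Definition bsum n (g : nat -> nat) := \sum_(i < n) g i.
Definition bex n (P : pred nat) := has P (iota 0 n).
Definition ball n (P : pred nat) := all P (iota 0 n).
Definition ncase B n (b : B) (g : nat -> B) := if n is m.+1 then g m else b.

Section Calculus3.
Context {A B : Type} {EA : Enc A} {EB : Enc B}.

Lemma c_sum (n : A -> nat) (g : A -> nat -> nat) :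
  computable n -> computable (fun p => g p.1 p.2) ->
  computable (fun a => bsum (n a) (g a)).
Proof.
move=> hn hg.
have hs : computable (fun p : A * nat * nat => p.2 + g p.1.1 p.1.2).
  by apply: c_add; [exact: (c_snd c_id) | exact: (c_comp hg (c_fst c_id))].
apply: computable_ext (c_rec (fun a k r => r + g a k) hn (c_const 0) hs) => a.
by rewrite /bsum; elim: (n a) => [|k IH] /=; rewrite ?big_ord0 // big_ord_recr -IH.
Qed.

Lemma c_has (n : A -> nat) (g : A -> nat -> bool) :
  computable n -> computable (fun p => g p.1 p.2) ->
  computable (fun a => bex (n a) (g a)).
Proof.
move=> hn hg.
have hs : computable (fun p : A * nat * bool => p.2 || g p.1.1 p.1.2).
  by apply: c_orb; [exact: (c_snd c_id) | exact: (c_comp hg (c_fst c_id))].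
apply: computable_ext (c_rec (fun a k r => r || g a k) hn (c_const false) hs) => a.
rewrite /bex; elim: (n a) => [|k IH] //.
have -> : iota 0 k.+1 = rcons (iota 0 k) k by rewrite -addn1 iotaD cats1.
by rewrite has_rcons orbC /= IH.
Qed.

Lemma c_all (n : A -> nat) (g : A -> nat -> bool) :
  computable n -> computable (fun p => g p.1 p.2) ->
  computable (fun a => ball (n a) (g a)).
Proof.
move=> hn hg; have := c_negb (@c_has n (fun a i => ~~ g a i) hn (c_negb hg)).
apply: computable_ext => a.
by rewrite /bex /ball has_predC negbK.
Qed.

Lemma c_iter (n : A -> nat) (f : A -> B -> B) (b : A -> B) :
  computable n -> computable (fun p => f p.1 p.2) -> computable b ->
  computable (fun a => iter (n a) (f a) (b a)).
Proof.
move=> hn hf hb.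
have hs : computable (fun p : A * nat * B => f p.1.1 p.2).
  exact: (c_comp hf (c_pair (c_fst (c_fst c_id)) (c_snd c_id))).
apply: computable_ext (c_rec (fun a _ r => f a r) hn hb hs) => a.
by elim: (n a) => [|k IH] //=; rewrite IH.
Qed.

Lemma c_exp (f g : A -> nat) :
  computable f -> computable g -> computable (fun a => f a ^ g a).
Proof.
move=> hf hg.
have hs : computable (fun p : A * nat * nat => f p.1.1 * p.2).
  by apply: c_mul; [exact: (c_comp hf (c_fst (c_fst c_id))) | exact: (c_snd c_id)].
apply: computable_ext (c_rec (fun a _ r => f a * r) hg (c_const 1) hs) => a.
by elim: (g a) => [|k IH] //=; rewrite IH expnS.
Qed.

(** The quotient is counted: [m %/ d] is the number of [i] with
    [i.+1 * d <= m]. *)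
Lemma c_divn (f g : A -> nat) :
  computable f -> computable g -> computable (fun a => f a %/ g a).
Proof.
move=> hf hg.
have hs : computable (fun p : A * nat =>
    nat_of_bool ((0 < g p.1) && (p.2.+1 * g p.1 <= f p.1))%N).
  have hg' := c_comp hg (c_fst c_id); have hf' := c_comp hf (c_fst c_id).
  apply: c_nat_of_bool; apply: c_andb; apply: c_leq => //; first exact: c_const.
  by apply: c_mul => //; apply/c_succ/c_snd/c_id.
apply: computable_ext (@c_sum _ (fun a i => nat_of_bool ((0 < g a) && (i.+1 * g a <= f a))%N) hf hs) => a /=.
rewrite /bsum; case: (posnP (g a)) => [->|g0]; first by rewrite divn0 big1.
suff E n : \sum_(i < n) (i.+1 * g a <= f a)%N = minn n (f a %/ g a).
  by rewrite E; apply/minn_idPr/leq_div.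
elim: n => [|n IH]; first by rewrite big_ord0 min0n.
by rewrite big_ord_recr /= IH -leq_divRL //; lia.
Qed.

Lemma c_modn (f g : A -> nat) :
  computable f -> computable g -> computable (fun a => f a %% g a).
Proof.
move=> hf hg; apply: computable_ext (c_sub hf (c_mul (c_divn hf hg) hg)) => a.
by rewrite {1}(divn_eq (f a) (g a)) addKn.
Qed.

Lemma c_odd (f : A -> nat) : computable f -> computable (fun a => odd (f a)).
Proof.
move=> hf; have h := c_divn hf (c_const 2); apply: c_bool.
apply: computable_ext (c_sub hf (c_mul h (c_const 2))) => a.
by rewrite divn2 muln2; have := odd_double_half (f a); lia.
Qed.

Lemma c_case0 (f : A -> nat) (b : A -> B) (g : A -> nat -> B) :
  computable f -> computable b -> computable (fun p => g p.1 p.2) ->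
  computable (fun a => ncase (f a) (b a) (g a)).
Proof.
move=> hf hb hg; have hg' := c_comp hg (c_pair c_id (c_pred hf)).
have h0 := c_eqn hf (c_const 0).
apply: computable_ext (c_if h0 hb hg') => a /=.
by case: (f a).
Qed.

(** ** Sequences *)

Lemma c_cons (f : A -> B) (g : A -> seq B) :
  computable f -> computable g -> computable (fun a => f a :: g a).
Proof.
move=> [f' hf ff'] [g' hg gg']; exists (fun n => (pair (f' n) (g' n)).+1).
  by apply/total_recursiveE/trec_succ; apply: trec_pair; apply/total_recursiveE.
by move=> a; rewrite gg' ff'.
Qed.

Lemma c_behead (f : A -> seq B) :
  computable f -> computable (fun a => behead (f a)).
Proof.
apply: (@c_unary _ _ _ _ _ _ (fun n => pi2 n.-1)).
  apply: computable_natE; apply/c_pi2/c_pred/c_id.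
move=> a; case: (f a) => [|x s] /=; first exact: (pairK2 0 0).
by rewrite pairK2.
Qed.

Lemma c_head (x0 : B) (f : A -> seq B) :
  computable f -> computable (fun a => head x0 (f a)).
Proof.
apply: (@c_unary _ _ _ _ _ _ (fun n => if n == 0 then enc x0 else pi1 n.-1)).
  apply: computable_natE; apply: c_if; first exact: (c_eqn c_id (c_const 0)).
    exact: c_const.
  by apply/c_pi1/c_pred/c_id.
by move=> a; case: (f a) => [|x s] //=; rewrite pairK1.
Qed.

Lemma c_map (I : Type) (l : seq I) (g : I -> A -> B) :
  (forall i, computable (g i)) -> computable (fun a => [seq g i a | i <- l]).
Proof.
move=> hg; elim: l => [|i l IH] /=; first exact: c_const.
exact: c_cons.
Qed.

Lemma c_all_seq (I : Type) (l : seq I) (g : I -> A -> bool) :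
  (forall i, computable (g i)) -> computable (fun a => all (fun i => g i a) l).
Proof.
move=> hg; elim: l => [|i l IH] /=; first exact: c_const.
exact: c_andb.
Qed.

End Calculus3.
Arguments c_sum {A EA n} g.
Arguments c_has {A EA n} g.
Arguments c_all {A EA n} g.
Arguments c_iter {A B EA EB n} f {b}.
Arguments c_case0 {A B EA EB f b} g.

Lemma c_nth A B (EA : Enc A) (EB : Enc B) (x0 : B) (f : A -> seq B) (n : A -> nat) :
  computable f -> computable n -> computable (fun a => nth x0 (f a) (n a)).
Proof.
move=> hf hn.
have hb : computable (fun p : A * seq B => behead p.2) by apply/c_behead/c_snd/c_id.
apply: computable_ext (c_head x0 (c_iter (fun _ s => behead s) hn hb hf)) => a.
rewrite -nth0; elim: (n a) (f a) => [|k IH] s //.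
by rewrite iterSr IH nth_behead.
Qed.

Class EncInj A (EA : Enc A) := enc_inj : injective (@enc A EA).

#[global] Instance EncInj_nat : EncInj Enc_nat. Proof. by []. Qed.
#[global] Instance EncInj_prod A B (EA : Enc A) (EB : Enc B)
  (IA : EncInj EA) (IB : EncInj EB) : EncInj (Enc_prod EA EB).
Proof.
move=> [a b] [a' b'] /= E; have := congr1 pi1 E; have := congr1 pi2 E.
by rewrite !pairK1 !pairK2 => /(@enc_inj _ _ IB) -> /(@enc_inj _ _ IA) ->.
Qed.
#[global] Instance EncInj_seq A (EA : Enc A) (IA : EncInj EA) :
  EncInj (Enc_seq EA).
Proof.
elim=> [|a s IH] [|b t] //= [E]; have := congr1 pi1 E; have := congr1 pi2 E.
by rewrite !pairK1 !pairK2 => /IH -> /(@enc_inj _ _ IA) ->.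
Qed.

(** A function that only matters at finitely many arguments is computable from
    its table of values. *)
Lemma computable_finite (D : finType) A B (EA : Enc A) (EB : Enc B)
    (IA : EncInj EA) (c : D -> A) (h : D -> B) (b0 : B) : injective c ->
  exists2 g : A -> B, computable g & forall d, g (c d) = h d.
Proof.
move=> cI.
suff [g gP hg] : exists2 g : A -> B, @computable A B EA EB g &
    forall d, d \in enum D -> g (c d) = h d.
  by exists g => // d; apply: hg; rewrite mem_enum.
elim: (enum D) => [|d s [g gP hg]]; first by exists (fun _ => b0); first exact: c_const.
exists (fun a => if enc a == enc (c d) then h d else g a).
  apply: c_if => //; last exact: c_const.
  have henc : computable (fun a : A => enc a).
    by case: (@c_id A EA) => g' hg' gg'; exists g'.
  exact: (c_eqn henc (c_const (enc (c d)))).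
move=> d'; rewrite inE => /orP[/eqP->|/hg E]; first by rewrite eqxx.
by case: eqP => // /(@enc_inj A EA IA)/cI ->.
Qed.

Lemma computable2E A B C (EA : Enc A) (EB : Enc B) (EC : Enc C) (f : A -> B -> C) :
  computable (fun p : A * B => f p.1 p.2) -> computable2 f.
Proof. by []. Qed.

Lemma computable3E A B C D (EA : Enc A) (EB : Enc B) (EC : Enc C) (ED : Enc D)
    (f : A -> B -> C -> D) :
  computable (fun p : A * B * C => f p.1.1 p.1.2 p.2) -> computable3 f.
Proof. by []. Qed.

(** Proves that a function is computable by following the shape of its body;
    computability of the functions that occur in it is looked up in the context. *)
Ltac comp0 := lazymatch goal with
| |- computable2 _ => apply: computable2E
| |- computable3 _ => apply: computable3E
| |- computable (fun a => a) => exact: c_id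
| |- computable fst => exact: (c_fst c_id)
| |- computable snd => exact: (c_snd c_id)
| |- computable (fun _ => ?c) => exact: c_const
| |- computable (fun a => (@?f a, @?g a)) => apply: (@c_pair _ _ _ _ _ _ f g)
| |- computable (fun a => (@?f a).1) => apply: (@c_fst _ _ _ _ _ _ f)
| |- computable (fun a => (@?f a).2) => apply: (@c_snd _ _ _ _ _ _ f)
| |- computable (fun a => addn (@?f a) (@?g a)) => apply: (@c_add _ _ f g)
| |- computable (fun a => subn (@?f a) (@?g a)) => apply: (@c_sub _ _ f g)
| |- computable (fun a => muln (@?f a) (@?g a)) => apply: (@c_mul _ _ f g)
| |- computable (fun a => expn (@?f a) (@?g a)) => apply: (@c_exp _ _ f g)
| |- computable (fun a => divn (@?f a) (@?g a)) => apply: (@c_divn _ _ f g)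
| |- computable (fun a => modn (@?f a) (@?g a)) => apply: (@c_modn _ _ f g)
| |- computable (fun a => leq (@?f a) (@?g a)) => apply: (@c_leq _ _ f g)
| |- computable (fun a => S (@?f a)) => apply: (@c_succ _ _ f)
| |- computable (fun a => predn (@?f a)) => apply: (@c_pred _ _ f)
| |- computable (fun a => pi1 (@?f a)) => apply: (@c_pi1 _ _ f)
| |- computable (fun a => pi2 (@?f a)) => apply: (@c_pi2 _ _ f)
| |- computable (fun a => odd (@?f a)) => apply: (@c_odd _ _ f)
| |- computable (fun a => nat_of_bool (@?f a)) => apply: (@c_nat_of_bool _ _ f)
| |- computable (fun a => andb (@?f a) (@?g a)) => apply: (@c_andb _ _ f g)
| |- computable (fun a => orb (@?f a) (@?g a)) => apply: (@c_orb _ _ f g)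
| |- computable (fun a => negb (@?f a)) => apply: (@c_negb _ _ f)
| |- computable (fun a => eq_op (@?f a) (@?g a)) => apply: (@c_eqn _ _ f g)
| |- computable (fun a => (@?f a) :: (@?g a)) => apply: (@c_cons _ _ _ _ f g)
| |- computable (fun a => head ?x (@?f a)) => apply: (@c_head _ _ _ _ x f)
| |- computable (fun a => behead (@?f a)) => apply: (@c_behead _ _ _ _ f)
| |- computable (fun a => nth ?x (@?f a) (@?n a)) => apply: (@c_nth _ _ _ _ x f n)
| |- computable (fun a => bsum (@?n a) (@?g a)) => apply: (@c_sum _ _ n g)
| |- computable (fun a => bex (@?n a) (@?g a)) => apply: (@c_has _ _ n g)
| |- computable (fun a => ball (@?n a) (@?g a)) => apply: (@c_all _ _ n g)
| |- computable (fun a => iter (@?n a) (@?f a) (@?b a)) =>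
    apply: (@c_iter _ _ _ _ n f b)
| |- computable (fun a => ncase (@?f a) (@?b a) (@?g a)) =>
    apply: (@c_case0 _ _ _ _ f b g)
| H : computable ?g |- computable (fun a => ?g (@?f a)) =>
    apply: (@c_comp _ _ _ _ _ _ g f H)
| H : computable2 ?h |- computable (fun a => ?h (@?f a) (@?g a)) =>
    apply: (@c_comp2 _ _ _ _ _ _ _ _ h f g H)
| H : computable3 ?h |- computable (fun a => ?h (@?f a) (@?g a) (@?k a)) =>
    apply: (@c_comp3 _ _ _ _ _ _ _ _ _ _ h f g k H)
end.
Ltac comp1 := first [comp0 | apply: c_if]; cbv beta.
Ltac comp := repeat comp1.

(** * Evaluation with bounded time *)

(** [0] stands for no value and [y.+1] for the value [y].  The bound [t] limits
    nothing but the unbounded searches.  The loop for [RMu] uses the codes [0]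
    for a search still going on, [1] for one that met an undefined value, and
    [z.+2] for one that ended at [z]. *)
Fixpoint evf n (e : rec_scheme n) (t : nat) : seq nat -> nat :=
  match e with
  | RZero => fun _ => 1
  | RSucc => fun v => (head 0 v).+2
  | RProj n i => fun v => (nth 0 v i).+1
  | RComp m n g h => fun v =>
      if all (fun i => evf (h i) t v != 0) (enum 'I_m)
      then evf g t [seq (evf (h i) t v).-1 | i <- enum 'I_m] else 0
  | RPrim n g h => fun v =>
      nat_rect (fun _ => nat) (evf g t (behead v))
        (fun k r => ncase r 0 (fun r' => evf h t (k :: r' :: behead v))) (head 0 v)
  | RMu n g => fun v =>
      (nat_rect (fun _ => nat) 0
        (fun z r => if r == 0 then
                      ncase (evf g t (z :: v)) 1 (fun u => if u == 0 then z.+2 else 0)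
                    else r) t).-1
  end.

Lemma evf_computable n (e : rec_scheme n) : computable2 (evf e).
Proof.
elim: e => [||{}n i|m {}n g IHg h IHh|{}n g IHg h IHh|{}n g IHg] /=; comp1; cbn [evf].
- by comp.
- by comp.
- by comp.
- apply: c_if.
  + apply: (@c_all_seq _ _ _ _ (fun i p => evf (h i) p.1 p.2 != 0)) => i.
    by have hi := IHh i; comp.
  + apply: (c_comp2 IHg); first by comp.
    apply: (@c_map _ _ _ _ _ _ (fun i p => (evf (h i) p.1 p.2).-1)) => i.
    by have hi := IHh i; comp.
  + by comp.
- apply: (c_rec (fun p k r => ncase r 0 (fun r' => evf h p.1 (k :: r' :: behead p.2)))); by comp.
- apply: c_pred; apply: (c_rec (fun p z r => if r == 0 then
      ncase (evf g p.1 (z :: p.2)) 1 (fun u => if u == 0 then z.+2 else 0)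
      else r)); by comp.
Qed.

Lemma ncase_neq0 r (f : nat -> nat) : ncase r 0 f <> 0 ->
  exists2 r', r = r'.+1 & ncase r 0 f = f r'.
Proof. by case: r => // r' _; exists r'. Qed.

Section MuLoop.
Variable E : nat -> nat.
Let step z r :=
  if r == 0 then ncase (E z) 1 (fun u => if u == 0 then z.+2 else 0) else r.
Let loop k := nat_rect (fun _ => nat) 0 step k.

Lemma mu_loop_sound k :
  (loop k = 0 -> forall z, (z < k)%N -> exists u, E z = u.+2) /\
  (forall y, loop k = y.+2 -> E y = 1 /\ forall z, (z < y)%N -> exists u, E z = u.+2).
Proof.
elim: k => [|k [IH0 IHS]]; first by split.
rewrite /loop /= -/(loop k) /step; case L : (loop k) => [|r] /=; last first.
  by split=> // y [ry]; apply: IHS; rewrite L ry.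
case Ek : (E k) => [|[|u]] /=; split=> //.
- by move=> y [<-]; split=> //; apply: IH0.
- move=> _ z; rewrite ltnS leq_eqVlt => /orP[/eqP->|]; first by exists u.
  exact: IH0.
Qed.

Lemma mu_loop_complete k y : (y < k)%N -> E y = 1 ->
  (forall z, (z < y)%N -> exists u, E z = u.+2) -> loop k = y.+2.
Proof.
move=> yk Ey Ez.
have L0 j : (j <= y)%N -> loop j = 0.
  elim: j => // j IH jy; rewrite /loop /= -/(loop j) IH; last exact: ltnW.
  by rewrite /step /=; have [u ->] := Ez j jy.
elim: k yk => // k IH; rewrite ltnS leq_eqVlt => /orP[/eqP<-|/IH].
  by rewrite /loop /= -/(loop y) L0 // /step /= Ey.
by rewrite /loop /= -/(loop k) => ->.
Qed.

End MuLoop.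

Lemma evf_sound n (e : rec_scheme n) t (v : n.-tuple nat) y :
  evf e t v = y.+1 -> rec_eval e v y.
Proof.
elim: e v y => [||{}n i|m {}n g IHg h IHh|{}n g IHg h IHh|{}n g IHg] v y /=.
- by case.
- by case/tupleP: v => a w [].
- by case=> <-; rewrite (tnth_nth 0).
- case: ifP => // /allP hall hy.
  exists [tuple (evf (h i) t v).-1 | i < m]; split; last exact: IHg.
  move=> i; rewrite tnth_mktuple; apply: IHh; rewrite prednK // lt0n.
  by apply: hall; rewrite mem_enum.
- have -> : thead v = head 0 v by case/tupleP: v => a w; rewrite theadE.
  set a := head 0 v; set w := behead v => hy.
  pose R k := nat_rect (fun _ => nat) (evf g t w)
        (fun k r => ncase r 0 (fun r' => evf h t [:: k, r' & w])) k.
  have hR k : (k <= a)%N -> R k <> 0.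
    move=> ka R0; suff : R a = 0 by rewrite /R hy.
    rewrite -(subnKC ka); elim: (a - k) => [|j IH]; first by rewrite addn0.
    by rewrite addnS /R /= -/(R (k + j)) IH.
  exists (fun k => (R k).-1); split.
  + by apply: IHg; rewrite prednK // lt0n; apply/eqP/(hR 0).
  + move=> k ka; apply: IHh; rewrite prednK ?lt0n; last exact/eqP/hR.
    have := hR k.+1 ka; rewrite /R /= -/(R k).
    by case/ncase_neq0 => r' -> ->.
  + by rewrite /R hy.
- set L := nat_rect _ _ _ _; case EL : L => [//|[//|y']] /= [<-].
  have [_ /(_ _ EL)[h0 hz]] := mu_loop_sound (fun z => evf g t (z :: v)) t.
  split; first by apply: IHg.
  by move=> z /hz[u hu]; exists u; apply: IHg.
Qed.

Lemma evf_complete n (e : rec_scheme n) (v : n.-tuple nat) y :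
  rec_eval e v y -> exists t0, forall t, (t0 <= t)%N -> evf e t v = y.+1.
Proof.
elim: e v y => [||{}n i|m {}n g IHg h IHh|{}n g IHg h IHh|{}n g IHg] v y /=.
- by move=> ->; exists 0.
- by case/tupleP: v => a w; rewrite theadE => ->; exists 0.
- by move=> ->; exists 0 => t _; rewrite (tnth_nth 0).
- move=> [w [hw /IHg[t0 ht0]]].
  have /choice[tt htt] : forall i, exists t0, forall t, (t0 <= t)%N ->
    evf (h i) t v = (tnth w i).+1 by move=> i; apply: IHh; apply: hw.
  exists (maxn t0 (\max_i tt i)) => t; rewrite geq_max => /andP[le0 lem].
  have ht i : evf (h i) t v = (tnth w i).+1.
    by apply: htt; apply: leq_trans lem; apply: leq_bigmax.
  rewrite ifT; last by apply/allP => i _; rewrite ht.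
  rewrite -(ht0 _ le0); congr (evf g t _).
  rewrite -[RHS](map_tnth_enum w); apply: eq_map => i.
  by rewrite ht.
- have -> : thead v = head 0 v by case/tupleP: v => a w; rewrite theadE.
  set a := head 0 v; set w := behead v => -[s [hs0 hs ->]].
  suff : forall k, (k <= a)%N -> exists t0, forall t, (t0 <= t)%N ->
      nat_rect (fun _ => nat) (evf g t w)
        (fun k r => ncase r 0 (fun r' => evf h t [:: k, r' & w])) k = (s k).+1.
    by move=> /(_ a (leqnn a)).
  elim=> [|k IH] ka; first exact: (IHg _ _ hs0).
  have [t0 ht0] := IH (ltnW ka); have [t1 ht1] := IHh _ _ (hs k ka).
  exists (maxn t0 t1) => t; rewrite geq_max => /andP[le0 le1].
  by rewrite /= ht0 //= ht1.
- move=> [/IHg[t0 ht0] hz].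
  have : forall k, (k <= y)%N -> exists t1, forall t, (t1 <= t)%N ->
      forall z, (z < k)%N -> exists u, evf g t (z :: v) = u.+2.
    elim=> [|k IH] ky; first by exists 0.
    have [t1 ht1] := IH (ltnW ky); have [u /IHg[t2 ht2]] := hz k ky.
    exists (maxn t1 t2) => t; rewrite geq_max => /andP[le1 le2] z.
    rewrite ltnS leq_eqVlt => /orP[/eqP->|]; first by exists u; apply: ht2.
    exact: ht1.
  move=> /(_ y (leqnn y))[t1 ht1].
  exists (maxn y.+1 (maxn t0 t1)) => t; rewrite !geq_max => /and3P[yt le0 le1].
  rewrite (@mu_loop_complete (fun z => evf g t (z :: v)) t y) //.
    by apply: ht0.
  exact: ht1.
Qed.

Lemma rec_eval_fun n (e : rec_scheme n) v y y' :
  rec_eval e v y -> rec_eval e v y' -> y = y'.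
Proof.
move=> /evf_complete[t0 h0] /evf_complete[t1 h1].
have := h0 _ (leq_maxl t0 t1); have := h1 _ (leq_maxr t0 t1).
by move=> -> [].
Qed.

(** * Strings and their codes *)

(** The initial value [n] is a parameter because [n = 0] gives the value of a
    binary notation and [n = 1] the successor of the string code. *)
Definition bits_value (n : nat) (x : string) : nat :=
  foldl (fun n (b : bool) => n.*2 + b)%N n x.

Lemma bits_value_cat n x y : bits_value n (x ++ y) = bits_value (bits_value n x) y.
Proof. exact: foldl_cat. Qed.

Lemma bits_value_rcons n x b : bits_value n (rcons x b) = (bits_value n x).*2 + b.
Proof. by rewrite -cats1 bits_value_cat. Qed.

Lemma bits_valueE n x : bits_value n x = n * 2 ^ size x + bits_value 0 x.
Proof.
elim/last_ind: x => [|x b IH]; first by rewrite /= muln1 addn0.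
by rewrite !bits_value_rcons IH size_rcons expnS; nia.
Qed.

Lemma bits_value_lt x : (bits_value 0 x < 2 ^ size x)%N.
Proof.
elim/last_ind: x => [|x b IH] //.
by rewrite bits_value_rcons size_rcons expnS; case: b; nia.
Qed.

Lemma string_codeE x : (string_code x).+1 = bits_value 1 x.
Proof.
rewrite /string_code prednK // -/(bits_value 1 x) bits_valueE mul1n.
by rewrite addn_gt0 expn_gt0.
Qed.

(** The [k]-digit binary notation of [n] modulo [2 ^ k]. *)
Fixpoint bits (k n : nat) : string :=
  if k is k'.+1 then rcons (bits k' (n %/ 2)) (odd n) else [::].

Lemma size_bits k n : size (bits k n) = k.
Proof. by elim: k n => [|k IH] n //=; rewrite size_rcons IH. Qed.

Lemma bits_valueK x : bits (size x) (bits_value 0 x) = x.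
Proof.
elim/last_ind: x => [|x b IH] //; rewrite size_rcons bits_value_rcons /=.
have -> : ((bits_value 0 x).*2 + b) %/ 2 = bits_value 0 x by rewrite divn2; case: b; lia.
by rewrite IH oddD odd_double oddb.
Qed.

Lemma bitsK k n : (n < 2 ^ k)%N -> bits_value 0 (bits k n) = n.
Proof.
elim: k n => [|k IH] n; first by case: n.
rewrite expnS => ltn /=; rewrite bits_value_rcons IH; last by lia.
by rewrite divn2; have := odd_double_half n; lia.
Qed.

Lemma bits_value_inj x y : size x = size y ->
  bits_value 0 x = bits_value 0 y -> x = y.
Proof. by move=> sxy exy; rewrite -(bits_valueK x) sxy exy bits_valueK. Qed.

Definition code_size (n : nat) : nat := trunc_log 2 n.+1.

Definition decode (n : nat) : string := bits (code_size n) (n.+1 - 2 ^ code_size n).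

Lemma decodeK n : string_code (decode n) = n.
Proof.
apply: succn_inj; rewrite string_codeE bits_valueE mul1n /decode size_bits.
have /andP[l u] := @trunc_log_bounds 2 n.+1 isT isT.
by rewrite bitsK ?subnKC //; rewrite expnS in u; rewrite /code_size; lia.
Qed.

Lemma string_code_size x : code_size (string_code x) = size x.
Proof.
rewrite /code_size string_codeE bits_valueE mul1n.
by apply: trunc_log_eq => //; have := bits_value_lt x; rewrite expnS leq_addr; lia.
Qed.

Lemma string_code_inj : injective string_code.
Proof.
move=> x y exy; have sxy : size x = size y by rewrite -!string_code_size exy.
apply: bits_value_inj => //; have := congr1 succn exy.
by rewrite !string_codeE !(bits_valueE 1) sxy => /addnI.
Qed.

Lemma string_codeK x : decode (string_code x) = x.
Proof. by apply: string_code_inj; rewrite decodeK. Qed.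

Lemma code_size_computable : computable code_size.
Proof.
have h : computable (fun n => bsum n (fun i => (2 ^ i.+1 <= n.+1)%N)) by comp.
apply: computable_ext h => n; rewrite /code_size /bsum.
suff E m : \sum_(i < m) (2 ^ i.+1 <= n.+1)%N = minn m (trunc_log 2 n.+1).
  rewrite E; apply/minn_idPr; have := @trunc_logP 2 n.+1 isT isT.
  by have := ltn_expl (trunc_log 2 n.+1) (isT : 1 < 2)%N; lia.
elim: m => [|m IH]; first by rewrite big_ord0 min0n.
rewrite big_ord_recr /= IH.
have -> : (2 ^ m.+1 <= n.+1)%N = (m < trunc_log 2 n.+1)%N; last by lia.
apply/idP/idP => [|lem]; first exact: trunc_log_max.
by apply: leq_trans (@trunc_logP 2 n.+1 isT isT); rewrite leq_exp2l.
Qed.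

(** * Partial recursive functions as searches *)

Lemma search_scheme (test : nat -> nat -> bool) (out : nat -> nat -> nat) :
  computable2 test -> computable2 out ->
  exists e : rec_scheme 1, forall n y, rec_eval e [tuple n] y <->
    exists t, [/\ test n t, forall z, (z < t)%N -> ~~ test n z & y = out n t].
Proof.
move=> htest hout.
have h1 : total_recursive (fun n => nat_of_bool (~~ test (pi1 n) (pi2 n))).
  by apply: computable_natE; comp.
have h2 : total_recursive (fun n => out (pi1 n) (pi2 n)).
  by apply: computable_natE; comp.
have [e he] := search_recursive h1 h2.
exists e => n y; rewrite he; split=> -[t [t0 tl ->]].
  move: t0; rewrite !pairK1 !pairK2 => t0; exists t; split=> //; first by move: t0; case: (test _ _).
  by move=> z /tl; rewrite pairK1 pairK2; case: (test _ _).
exists t; rewrite !pairK1 !pairK2 t0; split=> // z /tl.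
by rewrite pairK1 pairK2 => ->.
Qed.

Lemma search_machine (test : nat -> nat -> bool) (out : nat -> nat -> nat) :
  computable2 test -> computable2 out ->
  exists2 F : string -> option string, partial_recursive F &
    forall x y, F x = Some y <-> exists t, [/\ test (string_code x) t,
      forall z, (z < t)%N -> ~~ test (string_code x) z &
      string_code y = out (string_code x) t].
Proof.
move=> htest hout; have [e he] := search_scheme htest hout.
pose F x := if pselect (exists n, rec_eval e [tuple string_code x] n) is left h
  then Some (decode (projT1 (cid h))) else None.
have FP x y : F x = Some y <-> rec_eval e [tuple string_code x] (string_code y).
  rewrite /F; case: pselect => [h|h]; last by split=> // hy; case: h; eexists; exact: hy.
  have h' := projT2 (cid h); split=> [[<-]|hy]; first by rewrite decodeK.
  by rewrite (rec_eval_fun h' hy) string_codeK.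
exists F; last by move=> x y; rewrite FP he.
exists e => x n; split=> [hn|[y /FP hy ->] //].
by exists (decode n); rewrite ?FP decodeK.
Qed.

(** The second argument of [st] is a time bound: a partial recursive function is
    the limit of finite stages that can be computed. *)
Lemma stage_function F : partial_recursive F ->
  exists2 st : nat -> nat -> nat, computable2 st &
    forall x y, F x = Some y <-> exists s, st (string_code x) s = (string_code y).+1.
Proof.
move=> [e he]; exists (fun i s => evf e s [:: i]).
  by have := evf_computable e => h; comp.
move=> x y; split=> [Fx|[s /(@evf_sound _ e s [tuple string_code x])/he[z -> /string_code_inj-> //]]].
have /evf_complete[t0 ht0] : rec_eval e [tuple string_code x] (string_code y).
  by apply/he; exists y.
by exists t0; apply: (ht0 _ (leqnn t0)).
Qed.

(** * Counter programs with an oracle *)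

(** Structured programs into which Kleene schemes translate easily, and whose
    counters an oracle machine can keep in unary on one tape each.  The commands
    [CAsk r] and [CRead b r] report a positive answer, or the bit [b] in the
    input, by incrementing [r]. *)
Inductive cmd :=
| CSkip
| CInc of nat
| CDec of nat
| CSeq of cmd & cmd
| CWhile of nat & cmd
| CEmit of bool
| CAsk of nat
| CRead of bool & nat.

Record mstate := MState { regs : nat -> nat; qry : string; inp : string }.

Definition setr s r n :=
  MState (fun r' => if r' == r then n else regs s r') (qry s) (inp s).

(** The bound [bd] on the queries is part of the semantics, so that a terminating
    run of a program bounds the queries of the machine that executes it. *)
Inductive exec (B : set string) (bd : nat) : cmd -> mstate -> mstate -> Prop :=
| ESkip s : exec B bd CSkip s s
| EInc r s : exec B bd (CInc r) s (setr s r (regs s r).+1)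
| EDec r s : exec B bd (CDec r) s (setr s r (regs s r).-1)
| ESeq c1 c2 s s1 s2 : exec B bd c1 s s1 -> exec B bd c2 s1 s2 ->
    exec B bd (CSeq c1 c2) s s2
| EWhile0 r c s : regs s r = 0 -> exec B bd (CWhile r c) s s
| EWhileS r c s s1 s2 : regs s r <> 0 -> exec B bd c s s1 ->
    exec B bd (CWhile r c) s1 s2 -> exec B bd (CWhile r c) s s2
| EEmit b s : exec B bd (CEmit b) s (MState (regs s) (rcons (qry s) b) (inp s))
| EAsk r s : (size (qry s) <= bd)%N ->
    exec B bd (CAsk r) s
      (setr (MState (regs s) [::] (inp s)) r (regs s r + (qry s \in B)))
| ERead b r s i : inp s = b :: i ->
    exec B bd (CRead b r) s (setr (MState (regs s) (qry s) i) r (regs s r).+1)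
| EReadN b r s : (forall i, inp s <> b :: i) -> exec B bd (CRead b r) s s.

Lemma mstate_ext s s' :
  regs s =1 regs s' -> qry s = qry s' -> inp s = inp s' -> s = s'.
Proof. by case: s s' => [r q i] [r' q' i'] /= /funext -> -> ->. Qed.

Ltac mst := apply: mstate_ext => //= ?; repeat case: eqP; intros; subst;
  try congruence; try lia.

Ltac nreg := do !(case: eqP => [?|_]; first by lia).

Section Programs.
Variables (B : set string) (bd : nat).
Local Notation exec := (exec B bd).

Lemma exec_eq c s s' s'' : exec c s s' -> s' = s'' -> exec c s s''.
Proof. by move=> h <-. Qed.

Definition clear r := CWhile r (CDec r).

Lemma exec_clear r s : exec (clear r) s (setr s r 0).
Proof.
move E : (regs s r) => n; elim: n s E => [|n IH] s E.
  by apply: (exec_eq (EWhile0 _ _ _ E)); mst.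
apply: (EWhileS (s1 := setr s r n)); first by rewrite E.
  by apply: (exec_eq (EDec _ _ _ _)); rewrite E.
by apply: (exec_eq (IH _ _)); rewrite /= ?eqxx //; mst.
Qed.

Definition move a b := CWhile a (CSeq (CDec a) (CInc b)).

Lemma exec_move a b s : a != b ->
  exec (move a b) s (setr (setr s b (regs s b + regs s a)) a 0).
Proof.
move=> ab; move E : (regs s a) => n; elim: n s E => [|n IH] s E.
  by apply: (exec_eq (EWhile0 _ _ _ E)); mst.
apply: (EWhileS (s1 := setr (setr s a n) b (regs s b).+1)); first by rewrite E.
  apply: ESeq; first exact: EDec.
  by apply: (exec_eq (EInc _ _ _ _)); mst.
apply: (exec_eq (IH _ _)); first by rewrite /= (negPf ab) eqxx.
by mst.
Qed.

Definition copy a b t :=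
  CSeq (CWhile a (CSeq (CDec a) (CSeq (CInc b) (CInc t)))) (move t a).

Lemma exec_copy a b t s : a != b -> b != t -> a != t -> regs s t = 0 ->
  exec (copy a b t) s (setr s b (regs s b + regs s a)).
Proof.
move=> ab bt at_ t0; apply: (ESeq (s1 :=
  setr (setr (setr s b (regs s b + regs s a)) t (regs s t + regs s a)) a 0)).
  move E : (regs s a) => n; move: (n) {t0} s E; clear n.
  elim=> [|n IH] s E.
    by apply: (exec_eq (EWhile0 _ _ _ E)); mst.
  apply: (EWhileS (s1 := setr (setr (setr s a n) b (regs s b).+1) t (regs s t).+1)).
  - by rewrite E.
  - apply: ESeq; first exact: EDec.
    apply: ESeq; first exact: EInc.
    by apply: (exec_eq (EInc _ _ _ _)); mst.
  - apply: (exec_eq (IH _ _)); first by rewrite /= (negPf ab) (negPf at_) eqxx.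
    by mst.
by apply: (exec_eq (exec_move _ _)); rewrite 1?eq_sym //; mst.
Qed.

(** The counters from [k] on are workspace: they hold [0] before and after, which
    makes it possible to state the effect of a program as an equation between
    states. *)
Fixpoint compile n (e : rec_scheme n) (args : nat -> nat) (o k : nat) : cmd :=
  match e with
  | RZero => CSkip
  | RSucc => CSeq (copy (args 0) o k) (CInc o)
  | RProj n i => copy (args i) o k
  | RComp m n g h =>
      CSeq (foldr CSeq CSkip [seq compile (h i) args (k + i) (k + m) | i <- enum 'I_m])
     (CSeq (compile g (fun i => k + i) o (k + m))
           (foldr CSeq CSkip [seq clear r | r <- iota k m]))
  | RPrim n g h =>
      CSeq (copy (args 0) k k.+3)
     (CSeq (compile g (fun i => args i.+1) k.+2 k.+4)
     (CSeq (CWhile k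
             (CSeq (CDec k)
             (CSeq (compile h (fun i => if i is j.+2 then args j.+1 else k.+1 + i) k.+3 k.+4)
             (CSeq (clear k.+2)
             (CSeq (move k.+3 k.+2)
                   (CInc k.+1))))))
     (CSeq (move k.+2 o) (clear k.+1))))
  | RMu n g =>
      let body := compile g (fun i => if i is j.+1 then args j else k) k.+1 k.+2 in
      CSeq body
     (CSeq (CWhile k.+1 (CSeq (clear k.+1) (CSeq (CInc k) body)))
           (move k o))
  end.

Definition comp_ok n (e : rec_scheme n) := forall args o k s (v : n.-tuple nat) y,
  (forall i, (i < n)%N -> (args i < k)%N /\ args i != o) -> (o < k)%N ->
  (forall r, (k <= r)%N -> regs s r = 0) -> regs s o = 0 ->
  (forall i, (i < n)%N -> regs s (args i) = nth 0 v i) ->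
  rec_eval e v y -> exec (compile e args o k) s (setr s o y).

Lemma exec_clears l s :
  exec (foldr CSeq CSkip [seq clear r | r <- l]) s
    (MState (fun r => if r \in l then 0 else regs s r) (qry s) (inp s)).
Proof.
elim: l s => [|r l IH] s /=; first by case: s => *; exact: ESkip.
apply: ESeq; first exact: exec_clear.
apply: (exec_eq (IH _)); apply: mstate_ext => //= r'; rewrite inE.
by case: ifP => //; case: eqP.
Qed.

Lemma exec_args m n (h : 'I_m -> rec_scheme n) args k s (v : n.-tuple nat)
    (w : m.-tuple nat) (l : seq 'I_m) :
  (forall i, comp_ok (h i)) -> uniq l ->
  (forall i, (i < n)%N -> (args i < k)%N) ->
  (forall r, (k <= r)%N -> (forall i, i \in l -> r = k + i -> regs s r = 0)) ->
  (forall r, (k + m <= r)%N -> regs s r = 0) ->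
  (forall i, (i < n)%N -> regs s (args i) = nth 0 v i) ->
  (forall i, rec_eval (h i) v (tnth w i)) ->
  exec (foldr CSeq CSkip [seq compile (h i) args (k + i) (k + m) | i <- l]) s
    (MState (fun r => if r \in [seq k + i | i : 'I_m <- l] then nth 0 w (r - k)
                      else regs s r) (qry s) (inp s)).
Proof.
move=> hh; elim: l s => [|i l IH] s /=; first by case: s => *; exact: ESkip.
move=> /andP[il ul] hargs h0 hz hv hw.
apply: ESeq.
  apply: hh (hw i) => //.
  - move=> j jn; have ja := hargs j jn; split; first by lia.
    by apply/eqP => E; lia.
  - by rewrite ltn_add2l.
  - by apply: (h0 _ _ i) => //; [lia | rewrite inE eqxx].
apply: (exec_eq (IH _ ul _ _ _ _ _)) => //=.
- move=> r kr j jl E; case: eqP => [E'|_].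
    have ij : i = j by apply: val_inj => /=; lia.
    by rewrite ij jl in il.
  by apply: (h0 r kr j) => //; rewrite inE jl orbT.
- by move=> r kmr; rewrite hz //; case: eqP => // E; have := ltn_ord i; lia.
- by move=> j jn; rewrite hv //; case: eqP => // E; have := hargs j jn; lia.
- apply: mstate_ext => //= r; rewrite inE.
  case: (r =P k + i) => [->|//] /=; case: ifP => // _.
  by rewrite addKn (tnth_nth 0).
Qed.

(** By induction on the scheme.  For [RPrim] the loop keeps the number of
    remaining rounds, the index and the current value in [k], [k.+1] and [k.+2];
    for [RMu] it keeps the candidate and its value in [k] and [k.+1]. *)
Lemma compile_ok n (e : rec_scheme n) : comp_ok e.
Proof.
elim: e => [||{}n i|m {}n g IHg h IHh|{}n g IHg h IHh|{}n g IHg];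
  move=> args o k s v y hargs ok_ hz ho hv /=.
- by move=> ->; apply: (exec_eq (ESkip _ _ _)); mst.
- have [a0 ao] := hargs 0 isT.
  have -> : thead v = nth 0 v 0 by case/tupleP: v {hv} => a w; rewrite theadE.
  move=> ->; apply: ESeq; first by apply: exec_copy => //; try (apply/eqP; lia); apply: hz.
  by apply: (exec_eq (EInc _ _ _ _)); rewrite /= eqxx ho hv //; mst.
- move=> ->; have [ai aio] := hargs i (ltn_ord i).
  apply: (exec_eq (exec_copy _ _ _ _)) => //; try (apply/eqP; lia); first exact: hz.
  by rewrite ho hv // (tnth_nth 0).
- move=> [w [hw hy]]; apply: ESeq.
    apply: (@exec_args m n h args k s v w) => //.
    + exact: enum_uniq.
    + by move=> i /hargs[].
    + by move=> r kr *; apply: hz.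
    + by move=> r kr; apply: hz; lia.
  apply: ESeq.
    apply: (IHg) hy => /=.
    + by move=> i im; split; [lia | apply/eqP; lia].
    + by lia.
    + move=> r kmr; case: ifP => [/mapP[i _ E]|_]; first by have := ltn_ord i; lia.
      by apply: hz; lia.
    + by case: ifP => // /mapP[i _ E]; lia.
    + move=> i im; rewrite ifT ?addKn //; apply/mapP.
      by exists (Ordinal im) => //; rewrite mem_enum.
  apply: (exec_eq (exec_clears _ _)); apply: mstate_ext => //= r.
  rewrite mem_iota; case: (r =P o) => [->|ro].
    by rewrite ifF //; apply/negbTE; lia.
  case: ifP => [/andP[kr _]|hkr]; first by rewrite hz.
  by case: ifP => // /mapP[i _ E]; have := ltn_ord i; lia.
- have -> : thead v = nth 0 v 0 by case/tupleP: v {hv} => a w; rewrite theadE.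
  move=> [c [hc0 hc ->]]; set N := nth 0 v 0 in hc *.
  have [a0 ao] := hargs 0 isT.
  pose st a b d := setr (setr (setr s k a) k.+1 b) k.+2 d.
  apply: (ESeq (s1 := st N 0 0)).
    apply: (exec_eq (exec_copy _ _ _ _)); try (apply/eqP; lia); first by apply: hz; lia.
    by rewrite hv // -/N (hz k) // add0n; mst; rewrite hz //; lia.
  apply: (ESeq (s1 := st N 0 (c 0))).
    apply: (exec_eq (IHg _ _ _ _ _ _ _ _ _ _ _ hc0)).
    + by move=> i /= lti; have [??] := hargs i.+1 lti; split; [lia | apply/eqP; lia].
    + by lia.
    + by move=> r kr /=; nreg; apply: hz; lia.
    + by rewrite /= eqxx.
    + move=> i lti; have [??] := hargs i.+1 lti; rewrite /=.
      nreg.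
      by rewrite hv // nth_behead.
    + by mst.
  apply: (ESeq (s1 := st 0 N (c N))).
    suff : forall d j, d + j = N -> exec (CWhile k
             (CSeq (CDec k)
             (CSeq (compile h (fun i => if i is j.+2 then args j.+1 else k.+1 + i) k.+3 k.+4)
             (CSeq (clear k.+2)
             (CSeq (move k.+3 k.+2)
                   (CInc k.+1)))))) (st d j (c j)) (st 0 N (c N)).
      by move=> /(_ N 0 (addn0 N)).
    elim=> [|d IH] j dj.
      rewrite -dj add0n; apply: (exec_eq (EWhile0 _ _ _ _)) => //=.
      by do !(case: eqP => //); lia.
    apply: (EWhileS (s1 := st d j.+1 (c j.+1))).
    + by rewrite /=; do !(case: eqP => //); lia.
    + apply: (ESeq (s1 := st d j (c j))).
        apply: (exec_eq (EDec _ _ _ _)); rewrite /=.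
        by mst.
      apply: ESeq.
        apply: (IHh) (hc j _); last by lia.
        * move=> [|[|i]] lti; try by split; [lia | apply/eqP; lia].
          by have [??] := hargs i.+1 lti; split; [lia | apply/eqP; lia].
        * by lia.
        * by move=> r kr /=; nreg; apply: hz; lia.
        * by rewrite /=; nreg; apply: hz; lia.
        * move=> [|[|i]] lti /=; try by do !(case: eqP => //; try lia).
          have [??] := hargs i.+1 lti.
          nreg.
          by rewrite hv // nth_behead.
      apply: ESeq; first exact: exec_clear.
      apply: ESeq; first by apply: exec_move; apply/eqP; lia.
      apply: (exec_eq (EInc _ _ _ _)); rewrite /=.
      by mst; rewrite hz //; lia.
    + by apply: IH; lia.
  apply: ESeq; first by apply: exec_move; apply/eqP; lia.
  apply: (exec_eq (exec_clear _ _)); rewrite /=.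
  mst; rewrite ?ho ?hz //; lia.
- move=> [hy hlt].
  pose st a b := setr (setr s k a) k.+1 b.
  set body := compile g _ _ _.
  have hbody a b : rec_eval g [tuple of a :: v] b -> exec body (st a 0) (st a b).
    move=> hab; apply: (exec_eq (IHg _ _ _ _ _ _ _ _ _ _ _ hab)).
    + move=> [|i] lti; first by split; [lia | apply/eqP; lia].
      by have [??] := hargs i lti; split; [lia | apply/eqP; lia].
    + by lia.
    + by move=> r kr /=; nreg; apply: hz; lia.
    + by rewrite /= eqxx.
    + move=> [|i] lti /=; first by do !(case: eqP => //; try lia).
      have [??] := hargs i lti.
      nreg.
      by rewrite hv.
    + by mst.
  have [u hu] : exists u, rec_eval g [tuple of 0 :: v] u.
    case: (posnP y) => [y0|y0]; first by exists 0; rewrite -[in X in [tuple of X :: _]]y0.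
    by have [u hu] := hlt 0 y0; exists u.+1.
  apply: (ESeq (s1 := st 0 u)).
    have -> : s = st 0 0 by mst; rewrite hz //; lia.
    exact: hbody.
  apply: (ESeq (s1 := st y 0)).
    suff : forall d j u, d + j = y -> rec_eval g [tuple of j :: v] u ->
        exec (CWhile k.+1 (CSeq (clear k.+1) (CSeq (CInc k) body))) (st j u) (st y 0).
      by move=> /(_ y 0 u (addn0 y) hu).
    elim=> [|d IH] j {}u dj {}hu.
      move: dj hu; rewrite add0n => -> /rec_eval_fun/(_ hy) ->.
      by apply: EWhile0; rewrite /= eqxx.
    have jy : (j < y)%N by lia.
    have [u0 hu0] := hlt j jy; rewrite (rec_eval_fun hu hu0).
    have [u' hu'] : exists u', rec_eval g [tuple of j.+1 :: v] u'.
      case: (ltnP j.+1 y) => [/hlt[u' hu']|yj]; first by exists u'.+1.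
      by exists 0; have -> : j.+1 = y by lia.
    apply: (EWhileS (s1 := st j.+1 u')); first by rewrite /= eqxx.
      apply: (ESeq (s1 := st j 0)); first by apply: (exec_eq (exec_clear _ _)); mst.
      apply: (ESeq (s1 := st j.+1 0)); last exact: hbody.
      apply: (exec_eq (EInc _ _ _ _)); rewrite /=.
      by mst.
    by apply: IH hu'; lia.
  apply: (exec_eq (exec_move _ _)); first by apply/eqP; lia.
  by mst; rewrite ?ho ?hz //; lia.
Qed.

End Programs.

(** * Programs as oracle machines *)

(** Jump targets are absolute positions in the code. *)
Inductive instr :=
| IInc of nat
| IDec of nat
| IJz of nat & nat
| IJmp of nat
| IEmit of bool
| IAsk of nat
| IRead of bool & nat.

Fixpoint flat_size (c : cmd) : nat :=
  match c with
  | CSkip => 0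
  | CSeq c1 c2 => flat_size c1 + flat_size c2
  | CWhile _ c => (flat_size c).+2
  | _ => 1
  end.

Fixpoint flatten (c : cmd) (p : nat) : seq instr :=
  match c with
  | CSkip => [::]
  | CInc r => [:: IInc r]
  | CDec r => [:: IDec r]
  | CSeq c1 c2 => flatten c1 p ++ flatten c2 (p + flat_size c1)
  | CWhile r c => IJz r (p + (flat_size c).+2) :: rcons (flatten c p.+1) (IJmp p)
  | CEmit b => [:: IEmit b]
  | CAsk r => [:: IAsk r]
  | CRead b r => [:: IRead b r]
  end.

Lemma size_flatten c p : size (flatten c p) = flat_size c.
Proof.
elim: c p => //= [c1 IH1 c2 IH2|r c IH] p; first by rewrite size_cat IH1 IH2.
by rewrite size_rcons IH.
Qed.

Fixpoint regs_lt (c : cmd) (K : nat) : bool :=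
  match c with
  | CSkip | CEmit _ => true
  | CInc r | CDec r | CAsk r | CRead _ r => (r < K)%N
  | CSeq c1 c2 => regs_lt c1 K && regs_lt c2 K
  | CWhile r c => (r < K)%N && regs_lt c K
  end.

Lemma regs_lt_mono c K K' : (K <= K')%N -> regs_lt c K -> regs_lt c K'.
Proof.
move=> KK; elim: c => //=.
- by move=> r rK; apply: leq_trans KK.
- by move=> r rK; apply: leq_trans KK.
- by move=> c1 IH1 c2 IH2 /andP[/IH1 -> /IH2 ->].
- by move=> r c IH /andP[rK /IH ->]; rewrite (leq_trans rK KK).
- by move=> r rK; apply: leq_trans KK.
- by move=> b r rK; apply: leq_trans KK.
Qed.

Lemma regs_lt_bound c : exists K, regs_lt c K.
Proof.
elim: c => /=; try by exists 0.
- by move=> r; exists r.+1.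
- by move=> r; exists r.+1.
- move=> c1 [K1 h1] c2 [K2 h2]; exists (maxn K1 K2).
  by rewrite (regs_lt_mono _ h1) ?leq_maxl // (regs_lt_mono _ h2) ?leq_maxr.
- move=> r c [K h]; exists (maxn r.+1 K).
  by rewrite leq_maxl (regs_lt_mono _ h) ?leq_maxr.
- by move=> r; exists r.+1.
- by move=> b r; exists r.+1.
Qed.

Section Machine.
Variables (code : seq instr) (K out : nat).

Let N := size code.
Definition mc_state : finType := ('I_5 + 'I_N.+1 * 'I_3)%type.
Definition mc_aux : finType := 'I_N.+1.

Let sym := symbol mc_aux.
Let mark : sym := Some (inl true).

(* Tape 0 holds the input, tape [r.+1] the counter [r] in unary, and the last
   tape the position to return to after a query, since the states entered by
   the answer of the oracle do not remember it. *)
Let tp (r : nat) : 'I_K.+2 := inord r.+1.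
Let act := (K.+2.-tuple (sym * direction))%type.

Definition mc_st (p ph : nat) : mc_state := inr (inord p, inord ph).
Definition mc_halt (i : nat) : mc_state := inl (inord i).

Definition noop (reads : K.+2.-tuple sym) : act :=
  [tuple (tnth reads i, Stay) | i < K.+2].

Definition act_on (i : 'I_K.+2) (a : sym * direction) (reads : K.+2.-tuple sym) : act :=
  [tuple if j == i then a else (tnth reads j, Stay) | j < K.+2].

Definition target (p : nat) : nat :=
  match nth (IJmp 0) code p with
  | IInc r | IAsk r | IRead _ r => r
  | _ => 0
  end.

(* Phases 1 and 2 increment the target counter of the instruction. *)
Definition mc_delta (q : mc_state) (reads : K.+2.-tuple sym) :
    mc_state * act * option bool :=
  match q with
  | inl i =>
      match tnth reads ord_max with
      | Some (inr p) =>
          (if i == 3 :> nat then mc_st p 1 else mc_st p.+1 0, noop reads, None)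
      | _ => (q, noop reads, None)
      end
  | inr (p, ph) =>
      if p == N :> nat then
        (mc_halt (if tnth reads (tp out) is None then 1 else 0), noop reads, None)
      else if ph == 1 :> nat then
        (mc_st p 2, act_on (tp (target p)) (tnth reads (tp (target p)), Right) reads, None)
      else if ph == 2 :> nat then
        (mc_st p.+1 0, act_on (tp (target p)) (mark, Stay) reads, None)
      else
        match nth (IJmp 0) code p with
        | IInc r => (mc_st p 1, noop reads, None)
        | IDec r =>
            (mc_st p.+1 0,
             if tnth reads (tp r) is None then noop reads
             else act_on (tp r) (None, Left) reads, None)
        | IJz r t =>
            (mc_st (if tnth reads (tp r) is None then t else p.+1) 0, noop reads, None)
        | IJmp t => (mc_st t 0, noop reads, None)
        | IEmit b => (mc_st p.+1 0, noop reads, Some b)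
        | IAsk r => (mc_halt 2, act_on ord_max (Some (inr p), Stay) reads, None)
        | IRead b r =>
            if tnth reads ord0 == Some (inl b) then
              (mc_st p 1, act_on ord0 (Some (inl b), Right) reads, None)
            else (mc_st p.+1 0, noop reads, None)
        end
  end.

Arguments mc_delta : simpl never.

Lemma mc_distinct :
  uniq [:: mc_halt 0; mc_halt 1; mc_halt 2; mc_halt 3; mc_halt 4].
Proof.
apply: (@map_uniq _ _ (fun q : mc_state => if q is inl i then val i else 5)).
by rewrite /= !inordK.
Qed.

Definition machine : oracle_tm :=
  @OracleTM mc_state mc_aux K.+1 (mc_st 0 0) _ _ _ _ _ mc_distinct mc_delta.

Variables (B : set string) (bd : nat).
Let step := @otm_step machine B.
Let ok (c : config machine) :=
  cfg_state c = otm_query machine -> (size (cfg_query c) <= bd)%N.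

(** A counter with value [n] is a block of [n] marks with the head on the last
    one, so that the scanned cell is blank exactly when [n = 0]. *)
Definition reg_tape (t : tape mc_aux) (n : nat) :=
  (forall i, nth None (tape_left t) i = if (i < n.-1)%N then mark else None) /\
  (forall i, nth None (tape_right t) i = if (i == 0) && (0 < n)%N then mark else None).

(* The tape of a counter whose head has left its last mark to the right. *)
Definition reg_tape_right (t : tape mc_aux) (n : nat) :=
  (forall i, nth None (tape_left t) i = if (i < n)%N then mark else None) /\
  (forall i, nth None (tape_right t) i = None).

Definition input_tape (t : tape mc_aux) (x : string) :=
  forall i, nth None (tape_right t) i = nth None [seq Some (inl b) | b <- x] i.

Lemma tape_readE (t : tape mc_aux) : tape_read t = nth None (tape_right t) 0.
Proof. by rewrite nth0. Qed.

Lemma reg_read t n : reg_tape t n -> (tape_read t = None) <-> (n = 0).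
Proof. by move=> [_ h]; rewrite tape_readE h; case: n {h}. Qed.

Lemma noop_right t i :
  nth None (tape_right (tape_act t (tape_read t, Stay))) i =
  nth None (tape_right t) i :> sym.
Proof. by case: t => l [|a r]; case: i => [|[|i]]. Qed.

Lemma noop_left (t : tape mc_aux) :
  tape_left (tape_act t (tape_read t, Stay)) = tape_left t.
Proof. by case: t. Qed.

Lemma noop_reg t n : reg_tape t n -> reg_tape (tape_act t (tape_read t, Stay)) n.
Proof.
move=> [hl hr]; split=> i; first by rewrite noop_left hl.
by rewrite noop_right hr.
Qed.

Lemma noop_input t x :
  input_tape t x -> input_tape (tape_act t (tape_read t, Stay)) x.
Proof. by move=> h i; rewrite noop_right h. Qed.

Lemma reg_right t n :
  reg_tape t n -> reg_tape_right (tape_act t (tape_read t, Right)) n.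
Proof.
case: t => l r [/= hl hr]; split=> [[|i]|i] /=.
- by rewrite tape_readE hr.
- by rewrite hl; case: n {hl hr}.
- by rewrite nth_behead hr.
Qed.

Lemma reg_mark t n :
  reg_tape_right t n -> reg_tape (tape_act t (mark, Stay)) n.+1.
Proof.
by case: t => l r [/= hl hr]; split=> [//|[|i]] //=; rewrite nth_behead hr.
Qed.

Lemma reg_dec t n :
  reg_tape t n.+1 -> reg_tape (tape_act t (None, Left)) n.
Proof.
case: t => l r [/= hl hr]; split=> [i|[|[|i]]] //=.
- by rewrite nth_behead hl; case: n {hl hr} => [|n]; rewrite ?ltn0.
- by rewrite -nth0 hl; case: n {hl hr}.
- by rewrite nth_behead hr.
Qed.

Lemma input_right t b x :
  input_tape t (b :: x) -> input_tape (tape_act t (Some (inl b), Right)) x.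
Proof. by case: t => l r /= h i; rewrite /= nth_behead h. Qed.

Lemma val_tp r : (r < K)%N -> tp r = r.+1 :> nat.
Proof. by move=> rK; rewrite /tp inordK // !ltnS ltnW. Qed.

Lemma tp_inj r r' : (r < K)%N -> (r' < K)%N -> (tp r == tp r') = (r == r').
Proof. by move=> rK r'K; rewrite -val_eqE /= !val_tp. Qed.

Lemma tp_neq0 r : (r < K)%N -> (ord0 == tp r) = false.
Proof. by move=> rK; rewrite -val_eqE /= val_tp. Qed.

Lemma tp_neqmax r : (r < K)%N -> (tp r == ord_max) = false.
Proof. by move=> rK; rewrite -val_eqE /= val_tp // eqSS ltn_eqF. Qed.

(* [Some r] exempts the counter [r], whose tape is between the two steps of an
   increment. *)
Definition tapes_but (r : option nat) (ts : K.+2.-tuple (tape mc_aux)) s :=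
  input_tape (tnth ts ord0) (inp s) /\
  forall r', (r' < K)%N -> Some r' != r -> reg_tape (tnth ts (tp r')) (regs s r').

Definition repr (c : config machine) p ph s :=
  [/\ cfg_state c = mc_st p ph, cfg_query c = qry s & tapes_but None (cfg_tapes c) s].

Definition act_tapes (ts : K.+2.-tuple (tape mc_aux)) (a : act) :=
  [tuple tape_act (tnth ts i) (tnth a i) | i < K.+2].

Definition reads (ts : K.+2.-tuple (tape mc_aux)) := map_tuple (@tape_read mc_aux) ts.

Lemma tapes_noop r ts s :
  tapes_but r ts s -> tapes_but r (act_tapes ts (noop (reads ts))) s.
Proof.
move=> [hi hr]; split; first by rewrite !(tnth_mktuple, tnth_map); apply: noop_input.
by move=> r' rK nr; rewrite !(tnth_mktuple, tnth_map); apply/noop_reg/hr.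
Qed.

Lemma tapes_act r a ts s : (r < K)%N ->
  tapes_but (Some r) ts s -> tapes_but (Some r) (act_tapes ts (act_on (tp r) a (reads ts))) s.
Proof.
move=> rK [hi hr]; split.
  by rewrite !tnth_mktuple tp_neq0 // tnth_map; apply: noop_input.
move=> r' rK' nr; rewrite !tnth_mktuple tp_inj //.
rewrite ifF; last by apply: contraNF nr => /eqP ->.
by rewrite tnth_map; apply/noop_reg/hr.
Qed.

Lemma tapes_act_reg r a ts : (r < K)%N ->
  tnth (act_tapes ts (act_on (tp r) a (reads ts))) (tp r) = tape_act (tnth ts (tp r)) a.
Proof. by move=> rK; rewrite !tnth_mktuple eqxx. Qed.

Lemma tapes_butS r ts s : tapes_but None ts s -> tapes_but (Some r) ts s.
Proof. by move=> [hi hr]; split=> // r' rK _; apply: hr. Qed.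

Lemma tapes_set r n ts s : (r < K)%N ->
  tapes_but (Some r) ts s -> reg_tape (tnth ts (tp r)) n -> tapes_but None ts (setr s r n).
Proof.
move=> rK [hi hr] hn; split=> // r' rK' _ /=.
case: (r' =P r) => [-> //|nr]; apply: hr => //.
by apply/eqP => -[].
Qed.

Lemma step_inr (c : config machine) (a : 'I_N.+1 * 'I_3) :
  cfg_state c = (inr a : mc_state) ->
  step c = let d := mc_delta (inr a) (reads (cfg_tapes c)) in
    Config (M := machine) d.1.1 (act_tapes (cfg_tapes c) d.1.2)
      (if d.2 is Some b then rcons (cfg_query c) b else cfg_query c).
Proof.
case: c => q ts w /= ->; rewrite /step /otm_step inE orFb inE /= -/(reads ts).
by case: (mc_delta _ _) => [[q' acts] o].
Qed.

Lemma ok_inr (c : config machine) (a : 'I_N.+1 * 'I_3) :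
  cfg_state c = (inr a : mc_state) -> ok c.
Proof. by rewrite /ok => ->. Qed.

Definition sim c p s := exists n, repr (iter n step c) p 0 s /\
  forall i, (i < n)%N -> ok (iter i step c).

Lemma sim_refl c p s : repr c p 0 s -> sim c p s.
Proof. by move=> h; exists 0. Qed.

Lemma sim_step c p s : ok c -> sim (step c) p s -> sim c p s.
Proof.
move=> okc [n [hn hok]]; exists n.+1; rewrite iterSr; split=> // -[|i] //.
by rewrite iterSr => /hok.
Qed.

Lemma sim_trans c p s p' s' : sim c p s ->
  (forall c', repr c' p 0 s -> sim c' p' s') -> sim c p' s'.
Proof.
move=> [n [hn hok]] /(_ _ hn)[n' [hn' hok']].
exists (n' + n); rewrite iterD; split=> // i lti.
case: (ltnP i n) => [/hok //|ni]; rewrite -(subnK ni) iterD; apply: hok'.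
by rewrite ltn_subLR // addnC.
Qed.

Lemma inord_N p : (p <= N)%N -> @inord N p = p :> nat.
Proof. by move=> pN; rewrite inordK. Qed.

Lemma step_at c p s q a o : (p < N)%N -> repr c p 0 s ->
  mc_delta (mc_st p 0) (reads (cfg_tapes c)) = (q, a, o) ->
  step c = Config (M := machine) q (act_tapes (cfg_tapes c) a)
    (if o is Some b then rcons (cfg_query c) b else cfg_query c).
Proof. by move=> pN [hq _ _] hd; rewrite (step_inr hq) hd. Qed.

Lemma mc_deltaE p ts : (p < N)%N -> mc_delta (mc_st p 0) ts =
  match nth (IJmp 0) code p with
  | IInc r => (mc_st p 1, noop ts, None)
  | IDec r =>
      (mc_st p.+1 0,
       if tnth ts (tp r) is None then noop ts else act_on (tp r) (None, Left) ts, None)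
  | IJz r t => (mc_st (if tnth ts (tp r) is None then t else p.+1) 0, noop ts, None)
  | IJmp t => (mc_st t 0, noop ts, None)
  | IEmit b => (mc_st p.+1 0, noop ts, Some b)
  | IAsk r => (mc_halt 2, act_on ord_max (Some (inr (inord p)), Stay) ts, None)
  | IRead b r =>
      if tnth ts ord0 == Some (inl b) then
        (mc_st p 1, act_on ord0 (Some (inl b), Right) ts, None)
      else (mc_st p.+1 0, noop ts, None)
  end.
Proof.
by move=> pN; rewrite /mc_delta /= inord_N ?(ltnW pN) // !inordK // (ltn_eqF pN) /=.
Qed.

Lemma sim_inc c p s : (p < N)%N -> (target p < K)%N -> repr c p 1 s ->
  sim c p.+1 (setr s (target p) (regs s (target p)).+1).
Proof.
move=> pN rK [hq hw ht]; set t := target p.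
have E1 : step c = Config (M := machine) (mc_st p 2)
    (act_tapes (cfg_tapes c)
       (act_on (tp t) (tnth (reads (cfg_tapes c)) (tp t), Right) (reads (cfg_tapes c))))
    (cfg_query c).
  by rewrite (step_inr hq) /mc_delta /= !inord_N ?(ltnW pN) // inordK // (ltn_eqF pN) /=.
have E2 ts w : step (Config (M := machine) (mc_st p 2) ts w) =
    Config (M := machine) (mc_st p.+1 0)
      (act_tapes ts (act_on (tp t) (mark, Stay) (reads ts))) w.
  rewrite (@step_inr _ (inord p, inord 2)) // /mc_delta /=.
  by rewrite !inord_N ?(ltnW pN) // inordK // (ltn_eqF pN) /=.
apply: sim_step; first exact: ok_inr hq.
rewrite E1; apply: sim_step; first exact: (@ok_inr _ (inord p, inord 2)).
rewrite E2; apply: sim_refl; split=> //=.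
set ts := act_tapes (cfg_tapes c) _.
have h1 : tapes_but (Some t) ts s by apply: tapes_act => //; apply: tapes_butS.
apply: tapes_set => //; first exact: tapes_act.
rewrite tapes_act_reg //; apply: reg_mark; rewrite tapes_act_reg // tnth_map.
by apply: reg_right; case: ht => _; apply.
Qed.

Lemma read_reg c p ph s r : (r < K)%N -> repr c p ph s ->
  (if tnth (reads (cfg_tapes c)) (tp r) is None then true else false) = (regs s r == 0).
Proof.
move=> rK [_ _ [_ /(_ r rK isT)/reg_read h]]; rewrite tnth_map.
case E : (tape_read _) => [x|]; first by case: eqP => // /h; rewrite E.
by have /h -> : tape_read (tnth (cfg_tapes c) (tp r)) = None by [].
Qed.

Lemma sim_noop c p s q : (p < N)%N -> repr c p 0 s ->
  mc_delta (mc_st p 0) (reads (cfg_tapes c)) =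
    (mc_st q 0, noop (reads (cfg_tapes c)), None) -> sim c q s.
Proof.
move=> pN h hd; have [hq hw ht] := h.
apply: sim_step; first exact: ok_inr hq.
rewrite (step_at pN h hd); apply: sim_refl; split=> //.
exact: tapes_noop.
Qed.

Lemma sim_IInc c p s r : (p < N)%N -> (r < K)%N -> nth (IJmp 0) code p = IInc r ->
  repr c p 0 s -> sim c p.+1 (setr s r (regs s r).+1).
Proof.
move=> pN rK hp h; have [hq hw ht] := h.
apply: sim_step; first exact: ok_inr hq.
have hd : mc_delta (mc_st p 0) (reads (cfg_tapes c)) =
    (mc_st p 1, noop (reads (cfg_tapes c)), None) by rewrite mc_deltaE // hp.
rewrite (step_at pN h hd); have tE : target p = r by rewrite /target hp.
rewrite -[X in setr s X]tE -[X in regs s X]tE; apply: sim_inc => //; first by rewrite tE.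
by split=> //; apply: tapes_noop.
Qed.

Lemma sim_IDec c p s r : (p < N)%N -> (r < K)%N -> nth (IJmp 0) code p = IDec r ->
  repr c p 0 s -> sim c p.+1 (setr s r (regs s r).-1).
Proof.
move=> pN rK hp h; have [hq hw ht] := h; have hr := read_reg rK h.
have hd := mc_deltaE (reads (cfg_tapes c)) pN; rewrite hp in hd.
move: hr hd; case E : (tnth _ (tp r)) => [x|] /esym hr hd.
  apply: sim_step; first exact: ok_inr hq.
  rewrite (step_at pN h hd); apply: sim_refl; split=> //=.
  apply: tapes_set => //; first by apply: tapes_act => //; apply: tapes_butS.
  rewrite tapes_act_reg //; apply: reg_dec.
  by rewrite prednK ?lt0n ?hr //; case: ht => _; apply.
have -> : setr s r (regs s r).-1 = s by move/eqP: hr => hr; mst.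
exact: (sim_noop pN h).
Qed.

Lemma sim_IJz c p s r t : (p < N)%N -> (r < K)%N -> nth (IJmp 0) code p = IJz r t ->
  repr c p 0 s -> sim c (if regs s r == 0 then t else p.+1) s.
Proof.
move=> pN rK hp h; apply: (sim_noop pN h); rewrite mc_deltaE // hp.
by rewrite -(read_reg rK h); case: (tnth _ (tp r)).
Qed.

Lemma sim_IEmit c p s b : (p < N)%N -> nth (IJmp 0) code p = IEmit b ->
  repr c p 0 s -> sim c p.+1 (MState (regs s) (rcons (qry s) b) (inp s)).
Proof.
move=> pN hp h; have [hq hw ht] := h.
apply: sim_step; first exact: ok_inr hq.
have hd : mc_delta (mc_st p 0) (reads (cfg_tapes c)) =
    (mc_st p.+1 0, noop (reads (cfg_tapes c)), Some b) by rewrite mc_deltaE // hp.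
rewrite (step_at pN h hd); apply: sim_refl; split=> //=; first by rewrite hw.
exact: (tapes_noop (s := s)).
Qed.

Lemma sim_IRead c p s b r i : (p < N)%N -> (r < K)%N ->
  nth (IJmp 0) code p = IRead b r -> inp s = b :: i ->
  repr c p 0 s -> sim c p.+1 (setr (MState (regs s) (qry s) i) r (regs s r).+1).
Proof.
move=> pN rK hp hi h; have [hq hw ht] := h.
apply: sim_step; first exact: ok_inr hq.
have hd : mc_delta (mc_st p 0) (reads (cfg_tapes c)) =
    (mc_st p 1, act_on ord0 (Some (inl b), Right) (reads (cfg_tapes c)), None).
  rewrite mc_deltaE // hp tnth_map tape_readE.
  by case: ht => /(_ 0); rewrite hi /= => -> _; rewrite eqxx.
rewrite (step_at pN h hd); have tE : target p = r by rewrite /target hp.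
have := @sim_inc _ p (MState (regs s) (qry s) i) pN; rewrite tE; apply=> //.
split=> //; split=> /=.
  rewrite tnth_mktuple tnth_mktuple eqxx; apply: input_right.
  by rewrite -hi; case: ht.
move=> r' rK' _; rewrite !tnth_mktuple eq_sym tp_neq0 // tnth_map.
by apply: noop_reg; case: ht => _; apply.
Qed.

Lemma sim_IReadN c p s b r : (p < N)%N -> nth (IJmp 0) code p = IRead b r ->
  (forall i, inp s <> b :: i) -> repr c p 0 s -> sim c p.+1 s.
Proof.
move=> pN hp hi h; have [hq hw [ht _]] := h.
apply: (sim_noop pN h); rewrite mc_deltaE // hp tnth_map tape_readE ht.
case E : (inp s) => [//|b' i] /=; rewrite ifF //.
by apply/negbTE/negP => /eqP [E']; apply: (hi i); rewrite E E'.
Qed.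

Lemma mc_haltE i j : (i < 5)%N -> (j < 5)%N -> (mc_halt i == mc_halt j) = (i == j).
Proof.
move=> i5 j5; apply/eqP/eqP => [[/(congr1 val)]|-> //].
by rewrite /= !inordK.
Qed.

Lemma step_query ts w : step (Config (M := machine) (mc_halt 2) ts w) =
  Config (M := machine) (mc_halt (if w \in B then 3 else 4)) ts [::].
Proof.
by rewrite /step /otm_step !inE /= !mc_haltE //=; case: (w \in B).
Qed.

Lemma step_return ts i p : i = 3 \/ i = 4 ->
  tnth (reads ts) ord_max = Some (inr p) ->
  step (Config (M := machine) (mc_halt i) ts [::]) =
  Config (M := machine) (if i == 3 then mc_st p 1 else mc_st p.+1 0)
    (act_tapes ts (noop (reads ts))) [::].
Proof.
move=> hi hp; have i5 : (i < 5)%N by case: hi => ->.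
rewrite /step /otm_step !inE /= !mc_haltE //.
have -> : (i == 0) || (i == 1) = false by case: hi => ->.
have -> : (i == 2) = false by case: hi => ->.
by rewrite -/(reads ts) /mc_delta /= hp inordK.
Qed.

Lemma sim_IAsk c p s r : (p < N)%N -> (r < K)%N -> nth (IJmp 0) code p = IAsk r ->
  (size (qry s) <= bd)%N -> repr c p 0 s ->
  sim c p.+1 (setr (MState (regs s) [::] (inp s)) r (regs s r + (qry s \in B))).
Proof.
move=> pN rK hp hs h; have [hq hw ht] := h.
apply: sim_step; first exact: ok_inr hq.
have hd := mc_deltaE (reads (cfg_tapes c)) pN; rewrite hp in hd.
rewrite (step_at pN h hd); set ts := act_tapes _ _.
have hts : tapes_but None ts (MState (regs s) [::] (inp s)).
  case: ht => hi hr; split=> /=.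
    by rewrite !tnth_mktuple (negbTE (_ : ord0 != ord_max)) // tnth_map; apply: noop_input.
  move=> r' rK' _; rewrite !tnth_mktuple tp_neqmax // tnth_map.
  by apply: noop_reg; apply: hr.
have hret : tnth (reads ts) ord_max = Some (inr (inord p)).
  by rewrite tnth_map !tnth_mktuple eqxx; case: (tnth _ _).
apply: sim_step; first by move=> _ /=; rewrite hw.
rewrite step_query hw.
have tE : target p = r by rewrite /target hp.
apply: sim_step; first by rewrite /ok /= => _.
case: (qry s \in B).
  rewrite (step_return (or_introl (erefl 3)) hret) /= addn1.
  have := @sim_inc _ p (MState (regs s) [::] (inp s)) pN; rewrite tE; apply=> //.
  split=> //=; first by rewrite inord_N // ltnW.
  exact: tapes_noop.
rewrite (step_return (or_intror (erefl 4)) hret) /=; apply: sim_refl; split=> //=.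
  by rewrite inord_N // ltnW.
rewrite addn0; have -> : setr (MState (regs s) [::] (inp s)) r (regs s r) =
  MState (regs s) [::] (inp s) by mst.
exact: tapes_noop.
Qed.

(** By induction on the execution; the code of [c] may occur anywhere in the
    program, at the position [p]. *)
Lemma flat_sim c s s' : exec B bd c s s' -> forall p pre post cfg,
  code = pre ++ flatten c p ++ post -> size pre = p -> regs_lt c K ->
  repr cfg p 0 s -> sim cfg (p + flat_size c) s'.
Proof.
have at1 p pre post i : code = pre ++ i :: post -> size pre = p ->
    (p < N)%N /\ nth (IJmp 0) code p = i.
  move=> hc <-; rewrite /N hc size_cat /= nth_cat ltnn subnn.
  by split=> //; rewrite -addSnnS leq_addr.
elim=> {c s s'} /=.
- by move=> s p pre post cfg _ _ _ h; rewrite addn0; apply: sim_refl.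
- move=> r s p pre post cfg hc hp rK h; rewrite addn1.
  by have [pN hi] := at1 _ _ _ _ hc hp; apply: sim_IInc.
- move=> r s p pre post cfg hc hp rK h; rewrite addn1.
  by have [pN hi] := at1 _ _ _ _ hc hp; apply: sim_IDec.
- move=> c1 c2 s s1 s2 _ IH1 _ IH2 p pre post cfg hc hp /andP[K1 K2] h.
  apply: (@sim_trans _ (p + flat_size c1) s1).
    by apply: (IH1 _ pre (flatten c2 (p + flat_size c1) ++ post)) h => //; rewrite hc -catA.
  move=> cfg' h'; rewrite addnA.
  apply: (IH2 _ (pre ++ flatten c1 p) post) => //; first by rewrite hc -!catA.
  by rewrite size_cat size_flatten hp.
- move=> r c s r0 p pre post cfg hc hp /andP[rK cK] h.
  have [pN hi] := at1 _ _ _ _ hc hp.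
  by have := sim_IJz pN rK hi h; rewrite r0.
- move=> r c s s1 s2 r0 _ IH1 _ IH2 p pre post cfg hc hp /andP[rK cK] h.
  have [pN hi] := at1 _ _ _ _ hc hp.
  apply: (@sim_trans _ p.+1 s).
    by have := sim_IJz pN rK hi h; case: eqP.
  move=> cfg1 h1; apply: (@sim_trans _ (p.+1 + flat_size c) s1).
    apply: (IH1 _ (rcons pre (IJz r (p + (flat_size c).+2))) (IJmp p :: post)) h1 => //.
      by rewrite hc cat_rcons /= -cats1 -catA.
    by rewrite size_rcons hp.
  move=> cfg2 h2; apply: (@sim_trans _ p s1); last first.
    by move=> cfg3; apply: IH2 hc hp _; rewrite /= rK.
  have [] := at1 (p.+1 + flat_size c) (pre ++ IJz r (p + (flat_size c).+2) :: flatten c p.+1)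
    post (IJmp p).
  - by rewrite hc -catA /= cat_rcons.
  - by rewrite size_cat /= size_flatten hp addnS.
  - move=> p'N hi'; apply: (sim_noop p'N h2).
    by rewrite mc_deltaE // hi'.
- move=> b s p pre post cfg hc hp _ h; rewrite addn1.
  by have [pN hi] := at1 _ _ _ _ hc hp; apply: sim_IEmit.
- move=> r s hs p pre post cfg hc hp rK h; rewrite addn1.
  by have [pN hi] := at1 _ _ _ _ hc hp; apply: sim_IAsk.
- move=> b r s i hin p pre post cfg hc hp rK h; rewrite addn1.
  by have [pN hi] := at1 _ _ _ _ hc hp; apply: (sim_IRead pN rK hi hin).
- move=> b r s hin p pre post cfg hc hp rK h; rewrite addn1.
  by have [pN hi] := at1 _ _ _ _ hc hp; apply: (sim_IReadN pN hi).
Qed.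

Definition init x := MState (fun _ => 0) [::] x.

Lemma repr_init x : repr (initial_config machine x) 0 0 (init x).
Proof.
split=> //; split=> [i|r rK _]; rewrite (tnth_nth (Tape [::] [::])) //=.
rewrite val_tp //=; case: (r) => [|r'] /=; last rewrite nth_nseq if_same.
  by split=> -[|i].
by split=> -[|i].
Qed.

Lemma step_end c s : (out < K)%N -> repr c N 0 s ->
  step c = Config (M := machine) (if (0 < regs s out)%N then mc_halt 0 else mc_halt 1)
    (act_tapes (cfg_tapes c) (noop (reads (cfg_tapes c)))) (cfg_query c).
Proof.
move=> oK h; have [hq _ _] := h; have ho := read_reg oK h.
rewrite (step_inr hq) /mc_delta /= inord_N // eqxx /=.
by move: ho; case: (tnth _ _) => [x|] /esym ho; rewrite lt0n ho.
Qed.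

End Machine.

Lemma otm_step_halt (M : oracle_tm) B (c : config M) :
  cfg_state c = otm_accept M \/ cfg_state c = otm_reject M -> otm_step B c = c.
Proof. by case: c => q ts w /= [] ->; rewrite !inE eqxx ?orbT. Qed.

(** Only [CAsk] enters the query state, so the bound of the semantics is a bound
    on the queries of the machine. *)
Lemma machine_of_cmd (c : cmd) (out : nat) : exists M : oracle_tm,
  forall B x bd s', exec B bd c (init x) s' ->
    (exists t, cfg_state (otm_run M B x t) =
       if (0 < regs s' out)%N then otm_accept M else otm_reject M) /\
    (forall t, cfg_state (otm_run M B x t) = otm_query M ->
       (size (cfg_query (otm_run M B x t)) <= bd)%N).
Proof.
have [K0 hK0] := regs_lt_bound c.
pose K := maxn K0 out.+1.
have hK : regs_lt c K by apply: regs_lt_mono hK0; apply: leq_maxl.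
have oK : (out < K)%N by apply: leq_maxr.
exists (machine (flatten c 0) K out) => B x bd s' hex.
have [] := @flat_sim (flatten c 0) K out B bd c _ _ hex 0 [::] [::] _ _ erefl hK
  (repr_init _ _ _ x); first by rewrite cats0.
move=> n [hn hok]; rewrite add0n -(size_flatten c 0) in hn.
have hend := step_end B oK hn.
have hN : otm_run (machine (flatten c 0) K out) B x n.+1 = _ := hend.
have halted t : otm_run (machine (flatten c 0) K out) B x (t + n.+1) =
    otm_run (machine (flatten c 0) K out) B x n.+1.
  elim: t => // t IH; rewrite addSn /otm_run iterS -!/(otm_run _ _ _ _) IH.
  apply: otm_step_halt; rewrite hN /=; by case: ifP; [left | right].
split; first by exists n.+1; rewrite hN; case: ifP.
move=> t; case: (ltnP t n) => [/hok //|].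
rewrite leq_eqVlt => /orP[/eqP <-|nt].
  by case: hn => hq _ _; rewrite /otm_run hq.
rewrite -(subnK nt) halted hN /=.
by case: ifP => _ /eqP; rewrite mc_haltE.
Qed.

(** * Deciding with a prefix found by the oracle *)

Lemma computable2_scheme (g : nat -> nat -> nat) : computable2 g ->
  exists e : rec_scheme 2, forall (v : 2.-tuple nat) y,
    rec_eval e v y <-> y = g (nth 0 v 0) (nth 0 v 1).
Proof.
move=> hg; have h : total_recursive (fun n => g (pi1 n) (pi2 n)).
  by apply: computable_natE; comp.
have := @trec_comp1 2 _ _ h (trec_pair (trec_nth (isT : 0 < 2)%N) (trec_nth (isT : 1 < 2)%N)).
move=> h2; have h3 : trec 2 (fun v => g (nth 0 v 0) (nth 0 v 1)).
  by apply: trec_ext h2 => v _; rewrite pairK1 pairK2.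
exact: h3.
Qed.

Lemma bitsS k n : bits k.+1 n = odd (n %/ 2 ^ k) :: bits k n.
Proof.
elim: k n => [|k IH] n; first by rewrite /= divn1.
rewrite -[LHS]/(rcons (bits k.+1 (n %/ 2)) (odd n)) IH /=.
by rewrite -divnMA expnS.
Qed.

Section Decision.
Variables (em : rec_scheme 1) (ebit epair : rec_scheme 2) (ed : rec_scheme 1).
Variable m : nat -> nat.
Hypothesis hm : forall n y, rec_eval em [tuple n] y <-> y = m n.
Hypothesis hbit : forall (v : 2.-tuple nat) y,
  rec_eval ebit v y <-> y = odd (nth 0 v 0 %/ 2 ^ nth 0 v 1).
Hypothesis hpair : forall (v : 2.-tuple nat) y,
  rec_eval epair v y <-> y = pair (nth 0 v 0) (nth 0 v 1).

Variables (B : set string) (bd : nat).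
Local Notation exec := (exec B bd).

Let X := 0. Let F := 1. Let Z := 2. Let Y := 3. Let L := 4. Let W := 5.
Let A := 6. Let J := 7. Let D := 8. Let P := 9. Let O := 10. Let E := 11.
Let G := 12. Let k0 := 20.

Definition double :=
  CSeq (CWhile X (CSeq (CDec X) (CSeq (CInc Y) (CInc Y)))) (move Y X).

Lemma exec_double s : regs s Y = 0 -> exec double s (setr s X (regs s X).*2).
Proof.
move=> hY; apply: (ESeq (s1 := setr (setr s X 0) Y (regs s X).*2)).
  have -> : (regs s X).*2 = regs s Y + (regs s X).*2 by rewrite hY.
  move En : (regs s X) => n; elim: n s En {hY} => [|n IH] s En.
    by apply: (exec_eq (EWhile0 _ _ _ En)); mst.
  apply: (EWhileS (s1 := setr (setr s X n) Y (regs s Y).+2)); first by rewrite En.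
    apply: ESeq; first exact: EDec.
    apply: ESeq; first exact: EInc.
    by apply: (exec_eq (EInc _ _ _ _)); rewrite /=; mst.
  by apply: (exec_eq (IH _ _)) => //=; mst.
apply: (exec_eq (exec_move _ _ _ _)) => //=; mst.
Qed.

(* [X] holds the binary number whose digits are a [1] and the bits read so far,
   so that its predecessor is the code of the input; [F] records whether a bit
   was read. *)
Definition read_bit (b : bool) :=
  CSeq (CRead b Z)
    (CWhile Z (CSeq (CDec Z) (CSeq double (CSeq (if b then CInc X else CSkip) (CInc F))))).

Definition read_res (b : bool) s :=
  if inp s is b' :: i then
    if b' == b then
      setr (setr (MState (regs s) (qry s) i) X ((regs s X).*2 + b)) F (regs s F).+1
    else s
  else s.

Lemma exec_read_bit b s : regs s Y = 0 -> regs s Z = 0 ->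
  exec (read_bit b) s (read_res b s).
Proof.
move=> hY hZ; rewrite /read_res.
have skip : (forall i, inp s <> b :: i) -> exec (read_bit b) s s.
  by move=> h; apply: ESeq; [apply: EReadN | apply: EWhile0].
case Ei : (inp s) => [|b' i]; first by apply: skip => i; rewrite Ei.
case: eqP => [E1|nb]; last by apply: skip => j; rewrite Ei => -[].
rewrite {}E1 in Ei *.
apply: ESeq; first exact: (ERead _ _ _ Ei).
set s1 := setr _ _ _.
apply: (EWhileS (s1 := setr (setr (MState (regs s) (qry s) i) X ((regs s X).*2 + b)) F (regs s F).+1)).
- by rewrite /s1 /= hZ.
- apply: ESeq; first exact: EDec.
  apply: ESeq; first by apply: exec_double.
  have h2 : exec (if b then CInc X else CSkip)
      (setr (setr s1 Z (regs s1 Z).-1) X (regs (setr s1 Z (regs s1 Z).-1) X).*2)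
      (setr (MState (regs s) (qry s) i) X ((regs s X).*2 + b)).
    case: (b); last by apply: (exec_eq (ESkip _ _ _)); rewrite /s1 /=; mst.
    by apply: (exec_eq (EInc _ _ _ _)); rewrite /s1 /=; mst.
  apply: ESeq h2 _.
  by apply: (exec_eq (EInc _ _ _ _)); rewrite /=; mst.
- exact: EWhile0.
Qed.

Definition read_input :=
  CSeq (CInc X) (CSeq (CInc F)
    (CSeq (CWhile F (CSeq (clear F) (CSeq (read_bit false) (read_bit true)))) (CDec X))).

Lemma exec_read_input x :
  exec read_input (init x) (setr (init [::]) X (string_code x)).
Proof.
pose st n f x := setr (setr (init x) X n) F f.
apply: (ESeq (s1 := st 1 0 x)); first by apply: (exec_eq (EInc _ _ _ _)); rewrite /=; mst.
apply: (ESeq (s1 := st 1 1 x)); first by apply: (exec_eq (EInc _ _ _ _)); rewrite /=; mst.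
apply: (ESeq (s1 := st (bits_value 1 x) 0 [::])); last first.
  by apply: (exec_eq (EDec _ _ _ _)); rewrite /= -string_codeE /=; mst.
suff H n y a f : f <> 0 -> (size y <= n)%N ->
    exec (CWhile F (CSeq (clear F) (CSeq (read_bit false) (read_bit true))))
      (st a f y) (st (bits_value a y) 0 [::]) by exact: (H (size x)).
clear x; elim: n y a f => [|n IH] x a f f0.
  rewrite leqn0 size_eq0 => /eqP ->; rewrite /=.
  apply: (EWhileS (s1 := st a 0 [::])) => //; last exact: EWhile0.
  apply: (ESeq (s1 := st a 0 [::])); first by apply: (exec_eq (exec_clear _ _ _ _)); mst.
  apply: (ESeq (s1 := st a 0 [::])); exact: exec_read_bit.
move=> sx; apply: (EWhileS (s1 := read_res true (read_res false (st a 0 x)))) => //.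
  apply: (ESeq (s1 := st a 0 x)); first by apply: (exec_eq (exec_clear _ _ _ _)); mst.
  apply: ESeq; first exact: exec_read_bit.
  by apply: exec_read_bit; rewrite /read_res /=; case: (x) => [|[] x1].
have E1 b y g : read_res b (st a g (b :: y)) = st (a.*2 + b) g.+1 y.
  by rewrite /read_res /= eqxx /=; mst.
case: x sx => [|[] x] /=; rewrite ?ltnS => sx.
- by rewrite /read_res /=; apply: EWhile0.
- have -> : read_res false (st a 0 (true :: x)) = st a 0 (true :: x) by [].
  by rewrite E1; apply: IH.
- rewrite E1 addn0; case: x sx => [|[] x] /= sx.
  + exact: (IH [::]).
  + rewrite /read_res /=.
    have -> : setr (setr (MState (regs (st a.*2 1 (true :: x))) [::] x) X (a.*2.*2 + 1)) F 2
      = st (a.*2.*2 + 1) 2 x by mst.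
    by apply: IH => //; apply: ltnW.
  + exact: (IH (false :: x)).
Qed.

Definition emit_bit :=
  CSeq (compile ebit (fun i => if i == 0 then W else J) D k0)
 (CSeq (CInc E)
 (CSeq (CWhile D (CSeq (CDec D) (CSeq (CDec E) (CEmit true))))
       (CWhile E (CSeq (CDec E) (CEmit false))))).

Definition work0 s := [/\ regs s D = 0, regs s E = 0, regs s A = 0 &
  forall r, (k0 <= r)%N -> regs s r = 0].

Lemma exec_emit_bit s : work0 s -> exec emit_bit s
  (MState (regs s) (rcons (qry s) (odd (regs s W %/ 2 ^ regs s J))) (inp s)).
Proof.
move=> [hD hE hA hz]; set b := odd _.
apply: (ESeq (s1 := setr s D b)).
  apply: (@compile_ok _ _ _ _ _ _ _ _ [tuple regs s W; regs s J]) => //.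
  - by move=> [|[|]].
  - by move=> [|[|]].
  - by apply/hbit.
apply: (ESeq (s1 := setr (setr s D b) E 1)).
  by apply: (exec_eq (EInc _ _ _ _)); rewrite /= hE.
case: (b); last first.
  apply: ESeq; first by apply: EWhile0.
  apply: (EWhileS (s1 := MState (regs s) (rcons (qry s) false) (inp s))) => //; last exact: EWhile0.
  apply: ESeq; first exact: EDec.
  by apply: (exec_eq (EEmit _ _ _ _)); rewrite /=; mst.
apply: (ESeq (s1 := MState (regs s) (rcons (qry s) true) (inp s))); last exact: EWhile0.
apply: (EWhileS (s1 := MState (regs s) (rcons (qry s) true) (inp s))) => //; last exact: EWhile0.
apply: ESeq; first exact: EDec.
apply: ESeq; first exact: EDec.
by apply: (exec_eq (EEmit _ _ _ _)); rewrite /=; mst.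
Qed.

Definition emit_string := CSeq (copy L J k0) (CWhile J (CSeq (CDec J) emit_bit)).

Lemma exec_emit_string s : work0 s -> regs s J = 0 -> exec emit_string s
  (MState (regs s) (qry s ++ bits (regs s L) (regs s W)) (inp s)).
Proof.
move=> hs hJ; have [hD hE hA hz] := hs.
apply: (ESeq (s1 := setr s J (regs s L))).
  by apply: (exec_eq (exec_copy _ _ _ _ _ _)) => //; [apply: hz | rewrite hJ].
suff H j q : exec (CWhile J (CSeq (CDec J) emit_bit))
    (setr (MState (regs s) q (inp s)) J j)
    (MState (regs s) (q ++ bits j (regs s W)) (inp s)).
  exact: H.
elim: j q => [|j IH] q.
  by apply: (exec_eq (EWhile0 _ _ _ _)) => //; rewrite cats0; mst.
rewrite bitsS -cat_rcons.
apply: (EWhileS (s1 := setr (MState (regs s) (rcons q (odd (regs s W %/ 2 ^ j))) (inp s)) J j)) => //.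
apply: (ESeq (s1 := setr (MState (regs s) q (inp s)) J j)).
  by apply: (exec_eq (EDec _ _ _ _)); rewrite /=; mst.
apply: (exec_eq (exec_emit_bit _)).
  by split=> //= r kr; rewrite hz // ifF //; apply/negbTE/eqP; rewrite /J; move: kr; rewrite /k0; lia.
by mst.
Qed.

(* All strings of length [L] are put to the oracle in lexicographic order until
   one is accepted, so every query has length [L]. *)
Definition find_prefix :=
  CSeq (CInc G) (CWhile G
    (CSeq emit_string
    (CSeq (CAsk A)
    (CSeq (CInc W)
          (CWhile A (CSeq (CDec A) (CSeq (CDec G) (CDec W)))))))).

Lemma exec_find_prefix s z : work0 s -> regs s J = 0 -> regs s W = 0 ->
  regs s G = 0 -> qry s = [::] -> (regs s L <= bd)%N ->
  B (bits (regs s L) z) -> (forall i, (i < z)%N -> ~ B (bits (regs s L) i)) ->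
  exec find_prefix s (setr s W z).
Proof.
move=> hs hJ hW hG hq hL hz hlt; have [hD hE hA hk] := hs.
apply: (ESeq (s1 := setr (setr s W 0) G 1)).
  by apply: (exec_eq (EInc _ _ _ _)); rewrite /= hG; mst.
suff H d w : d + w = z -> exec (CWhile G
    (CSeq emit_string
    (CSeq (CAsk A)
    (CSeq (CInc W)
          (CWhile A (CSeq (CDec A) (CSeq (CDec G) (CDec W)))))))) (setr (setr s W w) G 1) (setr s W z).
  exact: (H z 0 (addn0 z)).
elim: d w => [|d IH] w dw.
  rewrite add0n in dw; rewrite {}dw.
  apply: (EWhileS (s1 := setr s W z)) => //; last by apply: EWhile0; rewrite /= hG.
  apply: ESeq; first apply: exec_emit_string.
  - by split=> //= r kr; rewrite hk // !ifF //; apply/negbTE/eqP; rewrite /W /G; move: kr; rewrite /k0; lia.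
  - by [].
  apply: ESeq; first by apply: EAsk; rewrite /= hq size_bits.
  apply: ESeq; first exact: EInc.
  apply: (EWhileS (s1 := setr s W z)); last exact: EWhile0.
    by rewrite /= hA hq /= mem_set.
  apply: ESeq; first exact: EDec.
  apply: ESeq; first exact: EDec.
  apply: (exec_eq (EDec _ _ _ _)); rewrite /= hA hq /= mem_set //=.
  by mst.
apply: (EWhileS (s1 := setr (setr s W w.+1) G 1)) => //; last by apply: IH; lia.
apply: ESeq; first apply: exec_emit_string.
- by split=> //= r kr; rewrite hk // !ifF //; apply/negbTE/eqP; rewrite /W /G; move: kr; rewrite /k0; lia.
- by [].
apply: ESeq; first by apply: EAsk; rewrite /= hq size_bits.
apply: ESeq; first exact: EInc.
have nB : bits (regs s L) w \in B = false.
  by apply/negbTE/negP; rewrite inE; apply: hlt; lia.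
apply: (exec_eq (EWhile0 _ _ _ _)); first by rewrite /= hA hq /= nB.
rewrite /= hA hq /= nB.
by mst.
Qed.

Definition decision :=
  CSeq read_input
 (CSeq (compile em (fun _ => X) L k0)
 (CSeq find_prefix
 (CSeq (compile epair (fun i => if i == 0 then X else W) P k0)
       (compile ed (fun _ => P) O k0)))).

Lemma exec_decision x z y : m (string_code x) = bd ->
  B (bits bd z) -> (forall i, (i < z)%N -> ~ B (bits bd i)) ->
  rec_eval ed [tuple pair (string_code x) z] y ->
  exists2 s, exec decision (init x) s & regs s O = y.
Proof.
move=> hbd hB hlt hy.
pose s1 := setr (init [::]) X (string_code x).
pose s2 := setr s1 L bd; pose s3 := setr s2 W z.
pose s4 := setr s3 P (pair (string_code x) z).
have kz r : (k0 <= r)%N -> [/\ regs s1 r = 0, regs s2 r = 0, regs s3 r = 0 & regs s4 r = 0].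
  by rewrite /k0 => kr; split; rewrite /= !ifF //; apply/negbTE/eqP; rewrite /X /L /P /W; lia.
exists (setr s4 O y) => //.
apply: ESeq; first exact: exec_read_input.
apply: (ESeq (s1 := s2)).
  apply: (@compile_ok _ _ _ _ _ _ _ _ [tuple string_code x]) => //.
  - by move=> r /kz[].
  - by move=> [].
  - by apply/hm; rewrite hbd.
apply: (ESeq (s1 := s3)).
  apply: exec_find_prefix => //.
  by split=> // r /kz[].
apply: (ESeq (s1 := s4)).
  apply: (@compile_ok _ _ _ _ _ _ _ _ [tuple string_code x; z]) => //.
  - by move=> [|[|]].
  - by move=> r /kz[].
  - by move=> [|[|]].
  - by apply/hpair.
apply: (@compile_ok _ _ _ _ _ _ _ _ [tuple pair (string_code x) z]) => //.
  by move=> r /kz[].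
by move=> [].
Qed.

End Decision.

(** The machine finds the number [z] whose notation of length [m] is in the
    oracle, by asking only strings of that length, and then runs [ed] without
    further queries. *)
Lemma oracle_decision (m : nat -> nat) (ed : rec_scheme 1) : total_recursive m ->
  exists M : oracle_tm, forall (B : set string) x z y,
    B (bits (m (string_code x)) z) ->
    (forall i, (i < z)%N -> ~ B (bits (m (string_code x)) i)) ->
    rec_eval ed [tuple pair (string_code x) z] y ->
    (exists t, cfg_state (otm_run M B x t) =
       if (0 < y)%N then otm_accept M else otm_reject M) /\
    (forall t, cfg_state (otm_run M B x t) = otm_query M ->
       (size (cfg_query (otm_run M B x t)) <= m (string_code x))%N).
Proof.
move=> [em hm].
have [ebit hbit] : exists e : rec_scheme 2, forall (v : 2.-tuple nat) y,
    rec_eval e v y <-> y = odd (nth 0 v 0 %/ 2 ^ nth 0 v 1).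
  by apply: (@computable2_scheme (fun a b => odd (a %/ 2 ^ b))); comp.
have [epair hpair] : exists e : rec_scheme 2, forall (v : 2.-tuple nat) y,
    rec_eval e v y <-> y = pair (nth 0 v 0) (nth 0 v 1).
  apply: (@computable2_scheme pair); comp1.
  by apply: (@c_binary _ _ pair fst snd); [exact: trec_pair | comp | comp].
have [M hM] := machine_of_cmd (decision em ebit epair ed) 10.
exists M => B x z y hB hlt hy.
have [s hs <-] := exec_decision hm hbit hpair (erefl _) hB hlt hy.
exact: hM hs.
Qed.

(** * Computing the runs of an oracle machine *)

(** The finite oracle formed by the prefixes of a string [w], where
    [S = bits_value 1 w] and [u] is [bits_value 1] of the query: cutting off the
    last [j] bits of [w] is division by [2 ^ j]. *)
Definition prefix_oracle (S u : nat) : bool := bex S.+1 (fun j => u == S %/ 2 ^ j).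

Lemma prefix_oracleP m z w : (z < 2 ^ m)%N -> (size w <= m)%N ->
  prefix_oracle (2 ^ m + z) (bits_value 1 w) = (bits_value 0 w == z %/ 2 ^ (m - size w)).
Proof.
move=> zm wm.
have divE j : (j <= m)%N -> (2 ^ m + z) %/ 2 ^ j = 2 ^ (m - j) + z %/ 2 ^ j.
  move=> jm; rewrite -{1}(subnK jm) expnD divnMDl //.
  by rewrite expn_gt0.
rewrite bits_valueE mul1n; apply/hasP/eqP => [[j _ /eqP]|hz].
  move=> hj; have jm : (j <= m)%N.
    rewrite leqNgt; apply/negP => mj.
    have : (2 ^ m + z) %/ 2 ^ j = 0.
      apply: divn_small; apply: (@leq_trans (2 ^ m.+1)); last by rewrite leq_exp2l.
      by rewrite expnS; lia.
    by rewrite -hj => /eqP; rewrite addn_eq0 expn_eq0.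
  rewrite divE // in hj.
  have lz : (z %/ 2 ^ j < 2 ^ (m - j))%N.
    by rewrite ltn_divLR ?expn_gt0 // -expnD subnK.
  have lw := bits_value_lt w.
  have sj : size w = m - j.
    move: (z %/ 2 ^ j) hj lz => q hj lz.
    apply/eqP; rewrite eqn_leq; apply/andP; split.
      rewrite leqNgt; apply/negP => h.
      have : (2 ^ (m - j).+1 <= 2 ^ size w)%N by rewrite leq_exp2l.
      by rewrite expnS; lia.
    rewrite leqNgt; apply/negP => h.
    have : (2 ^ (size w).+1 <= 2 ^ (m - j))%N by rewrite leq_exp2l.
    by rewrite expnS; lia.
  by move: hj; rewrite sj subKn // => /addnI.
exists (m - size w).
  rewrite mem_iota /= add0n ltnS; apply: leq_trans (leq_subr _ _) _.
  by have := ltn_expl m (isT : 1 < 2)%N; lia.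
by rewrite divE ?leq_subr // subKn // hz.
Qed.

Section Simulation.
Variable M : oracle_tm.

Let n := (otm_ntapes M).+1.
Let sym := symbol (otm_aux M).

Definition sym_code (a : sym) : nat := if a is Some b then (enum_rank b).+1 else 0.

Lemma sym_code_inj : injective sym_code.
Proof. by case=> [a|] [b|] //= [/val_inj/enum_rank_inj ->]. Qed.

Definition state_code (q : otm_state M) : nat := enum_rank q.

Lemma state_code_inj : injective state_code.
Proof. by move=> p q /val_inj/enum_rank_inj. Qed.

Definition dir_code (d : direction) : nat :=
  match d with Left => 0 | Stay => 1 | Right => 2 end.

Definition tape_code (t : tape (otm_aux M)) : seq nat * seq nat :=
  (map sym_code (tape_left t), map sym_code (tape_right t)).

Definition cfg_code (c : config M) : nat * seq (seq nat * seq nat) * nat :=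
  (state_code (cfg_state c), [seq tape_code t | t <- cfg_tapes c],
   bits_value 1 (cfg_query c)).

Definition tape_act_code (t : seq nat * seq nat) (a : nat * nat) : seq nat * seq nat :=
  if a.2 == 0 then (behead t.1, head 0 t.1 :: a.1 :: behead t.2)
  else if a.2 == 1 then (t.1, a.1 :: behead t.2)
  else (a.1 :: t.1, behead t.2).

Lemma tape_act_codeE t a :
  tape_code (tape_act t a) = tape_act_code (tape_code t) (sym_code a.1, dir_code a.2).
Proof.
by case: t a => l r [a []]; rewrite /tape_code /tape_act_code /=; case: l; case: r.
Qed.

(** The transition function of [M] has a finite domain, hence is computable as a
    table; the rest of a step is list surgery on the tapes. *)
Lemma simulate_step : exists2 st : nat -> nat * seq (seq nat * seq nat) * nat ->
    nat * seq (seq nat * seq nat) * nat, computable2 st &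
  forall B S c, (cfg_state c = otm_query M ->
      (cfg_query c \in B) = prefix_oracle S (bits_value 1 (cfg_query c))) ->
    cfg_code (otm_step B c) = st S (cfg_code c).
Proof.
pose D : finType := (otm_state M * n.-tuple sym)%type.
pose cD (d : D) := (state_code d.1, [seq sym_code a | a <- d.2]).
pose hD (d : D) : nat * seq (nat * nat) * nat :=
  let r := otm_delta d.1 d.2 in
  (state_code r.1.1, [seq (sym_code a.1, dir_code a.2) | a <- r.1.2],
   if r.2 is Some b then (nat_of_bool b).+1 else 0).
have cDI : injective cD.
  move=> [q v] [q' v'] [/state_code_inj -> /(inj_map sym_code_inj) /val_inj ->] //.
have [delta hdelta deltaE] := @computable_finite D _ _ _ _ _ cD hD (0, [::], 0) cDI.
pose t0 : seq nat * seq nat := ([::], [::]).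
pose rd (ts : seq (seq nat * seq nat)) := [seq head 0 (nth t0 ts i).2 | i <- iota 0 n].
pose st S (c : nat * seq (seq nat * seq nat) * nat) :=
  if (c.1.1 == state_code (otm_accept M)) || (c.1.1 == state_code (otm_reject M))
  then c else
  if c.1.1 == state_code (otm_query M) then
    (if prefix_oracle S c.2 then state_code (otm_yes M) else state_code (otm_no M),
     c.1.2, 1)
  else
    let d := delta (c.1.1, rd c.1.2) in
    (d.1.1, [seq tape_act_code (nth t0 c.1.2 i) (nth (0, 0) d.1.2 i) | i <- iota 0 n],
     if d.2 == 0 then c.2 else c.2 + c.2 + d.2.-1).
have hrd : computable rd.
  apply: (@c_map _ _ _ _ _ _ (fun i ts => head 0 (nth t0 ts i).2)) => i.
  by comp.
exists st.
  have htr : computable2 tape_act_code by comp.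
  rewrite /st /prefix_oracle; comp.
  apply: (@c_map _ _ _ _ _ _ (fun i (p : nat * (nat * seq (seq nat * seq nat) * nat)) =>
    tape_act_code (nth t0 p.2.1.2 i) (nth (0, 0) (delta (p.2.1.1, rd p.2.1.2)).1.2 i))) => i.
  by comp.
move=> B S [q ts w] hq; have [idx hidx] : {idx | iota 0 n = idx} by exists (iota 0 n).
rewrite /st /cfg_code hidx /=.
rewrite !(inj_eq state_code_inj) /otm_step !inE.
case: ifP => // _; case: ifP => [/eqP qq|_].
  by rewrite -hq //; case: (w \in B).
have -> : rd [seq tape_code t | t <- ts] = [seq sym_code a | a <- map (@tape_read _) ts].
  rewrite /rd; apply: (@eq_from_nth _ 0); first by rewrite size_map size_iota !size_map size_tuple.
  move=> i; rewrite size_map size_iota => lti.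
  rewrite (nth_map 0) ?size_iota // nth_iota // add0n.
  rewrite (nth_map (Tape [::] [::])) ?size_tuple //.
  rewrite (nth_map None) ?size_map ?size_tuple //.
  rewrite (nth_map (Tape [::] [::])) ?size_tuple //=.
  by rewrite /tape_read; case: (tape_right _).
have := deltaE (q, map_tuple (@tape_read _) ts); rewrite /cD /hD /= => ->.
case: (otm_delta q _) => [[q' acts] o] /=; congr (_, _, _); last first.
  by case: o => [b|] //=; rewrite bits_value_rcons addnn.
have -> : idx = [seq val i | i <- enum 'I_n] by rewrite val_enum_ord hidx.
rewrite -!map_comp; apply: eq_map => i /=.
rewrite tape_act_codeE (nth_map (Tape [::] [::])) ?size_tuple //.
rewrite (nth_map (None, Stay)) ?size_tuple //.
by rewrite !(tnth_nth (Tape [::] [::])) (tnth_nth (None, Stay)).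
Qed.

Lemma code_bits (a0 a1 : nat) : exists2 f : nat -> seq nat, computable f &
  forall x, f (string_code x) = [seq if b then a1 else a0 | b <- x].
Proof.
pose g (p : nat * seq nat) :=
  if (p.1 <= 1)%N then p else (p.1 %/ 2, (if odd p.1 then a1 else a0) :: p.2).
exists (fun i => (iter i.+1 g (i.+1, [::])).2).
  have hg : computable g by rewrite /g; comp.
  by comp.
move=> x; rewrite string_codeE.
have : (size x <= bits_value 1 x)%N.
  rewrite bits_valueE mul1n; have := ltn_expl (size x) (isT : 1 < 2)%N; lia.
move: {1 2}(bits_value 1 x) => k sk.
rewrite -[RHS]cats0; move: [::] => l.
elim/last_ind: x k sk l => [|x b IH] k sk l.
  have -> // : iter k g (bits_value 1 [::], l) = (1, l) by elim: k {sk} => //= k ->.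
case: k sk => [|k]; rewrite size_rcons // ltnS => sk.
rewrite iterSr {2}/g bits_value_rcons /= ifF; last first.
  apply/negbTE; rewrite -ltnNge bits_valueE.
  by have := expn_gt0 2 (size x); rewrite /=; lia.
have -> : ((bits_value 1 x).*2 + b) %/ 2 = bits_value 1 x by rewrite divn2; case: (b); lia.
by rewrite oddD odd_double oddb map_rcons cat_rcons; apply: IH.
Qed.

(** The oracles are compared on the queries that are actually made: these have
    bounded length, so a finite oracle is enough. *)
Lemma simulate_run : exists2 run : nat -> nat -> nat -> nat, computable3 run &
  forall B x S t,
    (forall t', cfg_state (otm_run M B x t') = otm_query M ->
      (cfg_query (otm_run M B x t') \in B) =
       prefix_oracle S (bits_value 1 (cfg_query (otm_run M B x t')))) ->
    run (string_code x) S t =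
      if cfg_state (otm_run M B x t) == otm_accept M then 1
      else if cfg_state (otm_run M B x t) == otm_reject M then 2 else 0.
Proof.
have [st hst stE] := simulate_step.
have [f hf fE] := code_bits (sym_code (Some (inl false))) (sym_code (Some (inl true))).
pose c0 i : nat * seq (seq nat * seq nat) * nat :=
  (state_code (otm_start M), ([::], f i) :: nseq (otm_ntapes M) ([::], [::]), 1).
pose c i S t := iter t (st S) (c0 i).
exists (fun i S t => if (c i S t).1.1 == state_code (otm_accept M) then 1
  else if (c i S t).1.1 == state_code (otm_reject M) then 2 else 0).
  by rewrite /c /c0; comp.
move=> B x S t hq.
suff -> : c (string_code x) S t = cfg_code (otm_run M B x t).
  by rewrite /= !(inj_eq state_code_inj).
elim: t => [|t IH]; last first.
  rewrite /c iterS -/(c _ _ _) IH /otm_run iterS -/(otm_run M B x t).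
  by rewrite (stE B S) //; apply: hq.
rewrite /c /c0 fE /cfg_code /= map_nseq; congr (_, (_, _) :: _, _).
by rewrite -map_comp; apply: eq_map; case.
Qed.

End Simulation.

(** * Rational approximation of the weights *)

Lemma total_search (test : nat -> nat -> bool) : computable2 test ->
  (forall n, exists t, test n t) ->
  exists2 h : nat -> nat, computable h &
    forall n, test n (h n) /\ forall z, (z < h n)%N -> ~~ test n z.
Proof.
move=> htest ex; exists (fun n => ex_minn (ex n)); last first.
  by move=> n; case: ex_minnP => k hk kmin; split=> // z; apply: contraL => /kmin; rewrite -leqNgt.
apply: computable_nat; apply/total_recursiveE.
have h : total_recursive (fun n => nat_of_bool (~~ test (pi1 n) (pi2 n))).
  by apply: computable_natE; comp.
have h2 : trec 2 (fun v => nat_of_bool (~~ test (nth 0 v 1) (nth 0 v 0)))%N.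
  have := @trec_comp1 2 _ _ h (trec_pair (trec_nth (isT : 1 < 2)%N) (trec_nth (isT : 0 < 2)%N)).
  by apply: trec_ext => v _; rewrite pairK1 pairK2.
apply: (trec_mu h2) => v _ /=; case: ex_minnP => k hk kmin; split; first by rewrite hk.
by move=> z zk; case E : (test _ z) => //; have := kmin z E; rewrite leqNgt zk.
Qed.

Section Approximation.
Local Open Scope ring_scope.
Variables (R : realType) (T : R).
Hypotheses (T_gt0 : 0 < T) (T_computable : computable_real T).

Definition weight (l : nat) : R := 2 `^ (- l%:R / T).

Lemma weight_gt0 l : 0 < weight l.
Proof. by rewrite powR_gt0. Qed.

(** Lower bounds [D / v] and upper bounds [U / v] of [T] by fractions of natural
    numbers, within [2 / 2 ^ N]; a numerator [D N = 0] means that the lower bound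
    is useless, since it is not known to be positive. *)
Lemma rational_bounds : exists D U v : nat -> nat,
  [/\ computable D, computable U, computable v &
   forall N, [/\ (0 < v N)%N, T < (U N)%:R / (v N)%:R,
     (U N)%:R / (v N)%:R <= T + 2 / 2 ^+ N,
     (0 < D N)%N -> (D N)%:R / (v N)%:R < T &
     T - 2 / 2 ^+ N <= (D N)%:R / (v N)%:R]].
Proof.
have T0 : 0 < T := T_gt0.
have [a [s [p [q [hs hp hq ha]]]] aT] := T_computable.
have {}hs := computable_nat hs; have {}hp := computable_nat hp.
have {}hq := computable_nat hq.
exists (fun N => if odd (s N) then 0 else p N * 2 ^ N - q N)%N,
  (fun N => if odd (s N) then q N - p N * 2 ^ N else q N + p N * 2 ^ N)%N,
  (fun N => q N * 2 ^ N)%N.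
split; [by comp | by comp | by comp |].
move=> N; have [q0 aE] := ha N; have := aT N; rewrite {}aE.
have -> : ratr ((-1) ^+ s N * ((p N)%:R / (q N)%:R)) =
    (-1) ^+ odd (s N) * ((p N)%:R / (q N)%:R) :> R.
  by rewrite rmorphM rmorphXn rmorphN rmorph1 fmorph_div !rmorph_nat signr_odd.
rewrite -lt0n in q0; rewrite natrM natrX.
have e0 : (0 : R) < 2 ^+ N by rewrite exprn_gt0.
have qR : (0 : R) < (q N)%:R by rewrite ltr0n.
rewrite ltr_norml; set e : R := 2 ^+ N in e0 *; move=> /andP[h1 h2].
have eE : (2 ^ N)%N%:R = e by rewrite natrX.
have [f [fE f0 fe]] : exists f : R, [/\ f = e^-1, 0 < f & f * e = 1].
  by exists e^-1; rewrite invr_gt0 e0 mulVf // gt_eqF.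
have ei : 2 / e = f + f by rewrite fE mulrDl mul1r.
have fracB (x y : R) : (x - y) / ((q N)%:R * e) = x / e / (q N)%:R - y / e / (q N)%:R.
  by rewrite invfM mulrBl !mulrA; congr (_ - _); rewrite mulrAC.
have fracD (x y : R) : (x + y) / ((q N)%:R * e) = x / e / (q N)%:R + y / e / (q N)%:R.
  by rewrite invfM mulrDl !mulrA; congr (_ + _); rewrite mulrAC.
have qe : (q N)%:R / e / (q N)%:R = f by rewrite mulrAC mulfV ?mul1r // gt_eqF.
pose r : R := (p N)%:R / (q N)%:R.
have pe : (p N)%:R * e / e / (q N)%:R = r by rewrite mulfK // gt_eqF.
have r0 : 0 <= r by rewrite divr_ge0.
have pr : (p N)%:R = r * (q N)%:R :> R by rewrite mulfVK // gt_eqF.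
have v0 : (0 < q N * 2 ^ N)%N by rewrite muln_gt0 q0 expn_gt0.
have {}h1 : - f < T - (-1) ^+ odd (s N) * r by rewrite fE.
have {}h2 : T - (-1) ^+ odd (s N) * r < f by rewrite fE.
clearbody r e; rewrite ei.
case: (odd (s N)) h1 h2; rewrite /= ?expr1 ?expr0 ?mulN1r ?mul1r ?opprK => h1 h2.
  have rf : r <= f by lra.
  have qp : (p N * 2 ^ N <= q N)%N.
    rewrite -(ler_nat R) natrM eE pr.
    have : r * e <= 1 by rewrite -fe ler_wpM2r // ltW.
    by move=> /(ler_wpM2r (ltW qR)); rewrite mul1r mulrAC.
  by rewrite natrB // natrM eE fracB pe qe mul0r; split=> //; lra.
rewrite natrD natrM eE fracD pe qe.
case: (leqP (p N * 2 ^ N) (q N)) => [pq|qp].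
  have rf : r <= f.
    rewrite -(ler_pM2r e0) fe -(ler_pM2r qR) mul1r mulrAC -pr -eE -natrM.
    by rewrite ler_nat.
  have -> : (p N * 2 ^ N - q N = 0)%N by apply/eqP; rewrite subn_eq0.
  by rewrite mul0r; split=> //; lra.
by rewrite natrB ?(ltnW qp) // natrM eE fracB pe qe; split=> // *; lra.
Qed.

Lemma ln_pow_le (a d e f : nat) : (0 < a)%N ->
  (a ^ d * 2 ^ e <= 2 ^ f)%N = (d%:R * ln a%:R + e%:R * ln 2 <= f%:R * ln (2 : R)).
Proof.
move=> a0; have aR : (0 : R) < a%:R by rewrite ltr0n.
rewrite -(ler_nat R) natrM !natrX -[LHS]ler_ln ?posrE ?mulr_gt0 ?exprn_gt0 //.
by rewrite lnM ?posrE ?exprn_gt0 // !lnXn // !mulr_natl.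
Qed.

Lemma ln_pow_ge (a d e f : nat) : (0 < a)%N ->
  (2 ^ f <= a ^ d * 2 ^ e)%N = (f%:R * ln (2 : R) <= d%:R * ln a%:R + e%:R * ln 2).
Proof.
move=> a0; have aR : (0 : R) < a%:R by rewrite ltr0n.
rewrite -(ler_nat R) natrM !natrX -[LHS]ler_ln ?posrE ?mulr_gt0 ?exprn_gt0 //.
by rewrite lnM ?posrE ?exprn_gt0 // !lnXn // !mulr_natl.
Qed.

Lemma ln2_gt0 : 0 < ln (2 : R).
Proof. by rewrite ln_gt0 // ltr1n. Qed.

Lemma ln_weight l K : ln (2 ^+ K * weight l) = K%:R * ln 2 - l%:R / T * ln 2.
Proof.
rewrite lnM ?posrE ?exprn_gt0 ?weight_gt0 // lnXn // ln_powR mulr_natl.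
by rewrite mulNr mulNr.
Qed.

(** Taking logarithms makes comparison with a weight linear in [T]. *)
Lemma weight_geE l K b : (0 < b)%N ->
  (b%:R <= 2 ^+ K * weight l) = (l%:R * ln 2 <= T * (K%:R * ln 2 - ln b%:R)).
Proof.
move=> b0; rewrite -[LHS]ler_ln ?posrE ?mulr_gt0 ?exprn_gt0 ?weight_gt0 ?ltr0n //.
rewrite ln_weight -subr_ge0 -[in RHS]subr_ge0.
rewrite -(pmulr_rge0 _ T_gt0); congr (_ <= _).
by field; rewrite gt_eqF.
Qed.

Lemma weight_leE l K b : (0 < b)%N ->
  (2 ^+ K * weight l <= b%:R) = (T * (K%:R * ln 2 - ln b%:R) <= l%:R * ln 2).
Proof.
move=> b0; rewrite -[LHS]ler_ln ?posrE ?mulr_gt0 ?exprn_gt0 ?weight_gt0 ?ltr0n //.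
rewrite ln_weight -subr_ge0 -[in RHS]subr_ge0.
rewrite -(pmulr_rge0 _ T_gt0); congr (_ <= _).
by field; rewrite gt_eqF.
Qed.

Lemma small_pow (e : R) : 0 < e -> exists N : nat, 2 / 2 ^+ N < e.
Proof.
move=> e0; exists (Num.truncn (2 / e)).+1.
set n := Num.truncn _; have h : 2 / e < n.+1%:R by apply: truncnS_gt.
rewrite ltr_pdivrMr ?exprn_gt0 // mulrC -ltr_pdivrMr //.
apply: lt_trans h _; rewrite -natrX ltr_nat; exact: ltn_expl.
Qed.

(** Comparing the integer powers in [test] amounts to comparing [b] and [b + 2]
    with [2 ^ (K - l / t)] for a rational [t] below or above [T].  Since the
    interval between [b] and [b + 2] can be chosen to contain the weight in its
    interior, the search for [b] and a good enough [t] ends. *)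
Lemma weight_approx : exists2 L : nat -> nat -> nat, computable2 L &
  forall l K, (L l K)%:R <= 2 ^+ K * weight l <= (L l K + 2)%:R.
Proof.
have T0 : 0 < T := T_gt0.
have [D [U [v [hD hU hv hDU]]]] := rational_bounds.
pose test n t :=
  let l := pi1 n in let K := pi2 n in let N := pi1 t in let b := pi2 t in
  [&& (0 < D N)%N, (b ^ D N * 2 ^ (l * v N) <= 2 ^ (K * D N))%N &
      (2 ^ (K * U N) <= (b + 2) ^ U N * 2 ^ (l * v N))%N].
have htest : computable2 test by rewrite /test; comp.
have hsound n t : test n t -> (pi2 t)%:R <= 2 ^+ pi2 n * weight (pi1 n) <= (pi2 t + 2)%:R.
  rewrite /test /=; set l := pi1 n; set K := pi2 n; set N := pi1 t; set b := pi2 t.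
  have [v0 TU _ DT _] := hDU N.
  have vR : (0 : R) < (v N)%:R by rewrite ltr0n.
  move=> /and3P[D0 h1 h2]; apply/andP; split.
    case: (posnP b) => [->|b0]; first by rewrite mulr_ge0 ?exprn_ge0 // ltW ?weight_gt0.
    rewrite weight_geE //; move: h1; rewrite ln_pow_le // !natrM => h1.
    have DR : (0 : R) < (D N)%:R by rewrite ltr0n.
    set c := K%:R * ln 2 - ln b%:R.
    have hc : l%:R * ln 2 <= (D N)%:R / (v N)%:R * c.
      rewrite mulrAC ler_pdivlMr // /c; lra.
    apply: (le_trans hc); apply: ler_wpM2r; last exact/ltW/DT.
    rewrite -(pmulr_rge0 _ (divr_gt0 DR vR)); apply: (le_trans _ hc).
    by rewrite mulr_ge0 // ltW // ln2_gt0.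
  rewrite addn2 weight_leE //; move: h2; rewrite addn2 ln_pow_ge // !natrM => h2.
  set c := K%:R * ln 2 - ln b.+2%:R.
  have hc : (U N)%:R / (v N)%:R * c <= l%:R * ln 2.
    rewrite mulrAC ler_pdivrMr // /c; lra.
  case: (lerP 0 c) => c0; first by apply: (le_trans _ hc); apply: ler_wpM2r => //; apply: ltW.
  apply: (@le_trans _ _ 0); first by rewrite pmulr_rle0 // ltW.
  by rewrite mulr_ge0 // ltW // ln2_gt0.
have hex n : exists t, test n t.
  set l := pi1 n; set K := pi2 n; pose x := 2 ^+ K * weight l.
  have x0 : 0 < x by rewrite mulr_gt0 ?exprn_gt0 ?weight_gt0.
  have [b /andP[bx xb]] : exists b : nat, b%:R < x < (b + 2)%:R.
    have /andP[tx xt] := truncn_itv (ltW x0).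
    move: tx; rewrite le_eqVlt => /orP[/eqP tx|tx]; last first.
      by exists (Num.truncn x); rewrite tx (lt_trans xt) // ltr_nat addn2.
    exists (Num.truncn x).-1; case: (Num.truncn x) tx xt => [tx|m <- _]; first by rewrite -tx ltxx in x0.
    by rewrite !ltr_nat addn2 /= !ltnS !leqnn.
  have l2 := ln2_gt0.
  pose c1 : R := K%:R * ln 2 - ln b%:R; pose c2 : R := K%:R * ln 2 - ln (b + 2)%:R.
  pose d1 : R := if (0 < b)%N then T * c1 - l%:R * ln 2 else 1.
  pose d2 : R := l%:R * ln 2 - T * c2.
  have d10 : 0 < d1.
    rewrite /d1 /c1; case: ifP => // b0; rewrite subr_gt0 ltNge -weight_leE //.
    by rewrite -ltNge.
  have d20 : 0 < d2.
    by rewrite subr_gt0 ltNge /c2 -weight_geE ?addn2 // -ltNge -[b.+2]addn2.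
  pose C : R := 1 + `|c1| + `|c2|.
  have C0 : 0 < C by rewrite /C -addrA ltr_wpDr // addr_ge0.
  pose e : R := Num.min (T / 1) (Num.min (d1 / C) (d2 / C)).
  have e0 : 0 < e by rewrite /e !lt_min divr1 T_gt0 !divr_gt0.
  have [N hN] := small_pow e0; exists (pair N b).
  rewrite /test pairK1 pairK2 -/l -/K.
  have [v0 TU UT DT TD] := hDU N.
  have vR : (0 : R) < (v N)%:R by rewrite ltr0n.
  move: hN; rewrite /e !lt_min divr1 !ltr_pdivlMr // => /and3P[hT h1 h2].
  set eps : R := 2 / 2 ^+ N in TD UT hT h1 h2.
  have eps0 : 0 < eps by rewrite divr_gt0 ?exprn_gt0.
  have D0 : (0 < D N)%N.
    rewrite -(ltr_nat R) -(pmulr_lgt0 _ (_ : 0 < (v N)%:R^-1)) ?invr_gt0 //; lra.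
  have le1 : eps * `|c1| <= eps * C by rewrite ler_pM2l // /C; have := normr_ge0 c2; lra.
  have le2 : eps * `|c2| <= eps * C by rewrite ler_pM2l // /C; have := normr_ge0 c1; lra.
  rewrite D0 /=; apply/andP; split.
    case: (posnP b) => [->|b0]; first by rewrite exp0n.
    rewrite ln_pow_le // !natrM.
    have : l%:R * ln 2 <= (D N)%:R / (v N)%:R * c1.
      have : T * c1 - (D N)%:R / (v N)%:R * c1 <= eps * `|c1|.
        rewrite -mulrBl; apply: (@le_trans _ _ `|(T - (D N)%:R / (v N)%:R) * c1|); first exact: ler_norm.
        rewrite normrM ler_wpM2r // ger0_norm; first lra.
        by rewrite subr_ge0 ltW // DT.
      by move: h1; rewrite /d1 b0; lra.
    rewrite mulrAC ler_pdivlMr // /c1; lra.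
  rewrite ln_pow_ge ?addn2 // -[b.+2]addn2 !natrM.
  have : (U N)%:R / (v N)%:R * c2 <= l%:R * ln 2.
    have : (U N)%:R / (v N)%:R * c2 - T * c2 <= eps * `|c2|.
      rewrite -mulrBl; apply: (@le_trans _ _ `|((U N)%:R / (v N)%:R - T) * c2|); first exact: ler_norm.
      rewrite normrM ler_wpM2r // ger0_norm; first lra.
      by rewrite subr_ge0 ltW.
    by move: h2; rewrite /d2; lra.
  rewrite mulrAC ler_pdivrMr // /c2; lra.
have [h hh hP] := total_search htest hex.
exists (fun l K => pi2 (h (pair l K))).
  have hpair : computable2 pair.
    by comp1; apply: (@c_binary _ _ pair fst snd); [exact: trec_pair | comp | comp].
  by comp.
move=> l K; have [/hsound] := hP (pair l K).
by rewrite pairK1 pairK2.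
Qed.

End Approximation.

(** * Sums over a prefix-free domain *)

(** Kraft's inequality, by induction on a bound for the lengths: strings are
    separated by their first bit. *)
Lemma kraft_nat n (s : seq string) : uniq s ->
  {in s &, forall p q, prefix p q -> p = q} ->
  {in s, forall p, (size p <= n)%N} ->
  (\sum_(p <- s) 2 ^ (n - size p) <= 2 ^ n)%N.
Proof.
elim: n s => [|n IH] s us pf sz.
  have sE p : p \in s -> p = [::] by move=> /sz; rewrite leqn0 size_eq0 => /eqP.
  case: s us pf sz sE => [|p [|q s]] us pf sz sE; rewrite ?big_nil //.
    by rewrite big_seq1.
  have := sE p; have := sE q; rewrite !inE !eqxx ?orbT /= => qE pE.
  by move: us; rewrite /= (pE isT) (qE isT) !inE eqxx.
case: (boolP ([::] \in s)) => [s0|s0].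
  have sE p : p \in s -> p = [::] by move=> ps; rewrite -(pf [::] p) // prefix0s.
  case: s us pf sz sE {s0} => [|p [|q s]] us pf sz sE; rewrite ?big_nil //.
    by rewrite big_seq1 leq_exp2l // leq_subr.
  have := sE p; have := sE q; rewrite !inE !eqxx ?orbT /= => qE pE.
  by move: us; rewrite /= (pE isT) (qE isT) !inE eqxx.
have half b : (\sum_(p <- s | ohead p == Some b) 2 ^ (n.+1 - size p) <= 2 ^ n)%N.
  pose s' := [seq behead p | p <- s & ohead p == Some b].
  have hs p : p \in [seq p <- s | ohead p == Some b] -> p \in s /\ p = b :: behead p.
    by rewrite mem_filter => /andP[/eqP hp ps]; split=> //; case: p hp {ps} => //= ? ? [->].
  apply: leq_trans (IH s' _ _ _).
  - rewrite big_map -big_filter big_seq [X in (_ <= X)%N]big_seq.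
    by apply: leq_sum => p /hs[_ ->] /=; rewrite subSS.
  - rewrite map_inj_in_uniq ?filter_uniq // => p q /hs[_ ->] /hs[_ ->] /=.
    by move=> ->.
  - move=> p q /mapP[p' /hs[p's pE] ->] /mapP[q' /hs[q's qE] ->] pq.
    by rewrite (pf p' q') // pE qE /= eqxx.
  - move=> p /mapP[p' /hs[/sz p's pE] ->].
    by move: p's; rewrite pE.
rewrite (bigID (fun p => ohead p == Some true)) /= expnS mul2n -addnn leq_add //.
apply: leq_trans (half false); rewrite big_seq_cond [X in (_ <= X)%N]big_seq_cond.
rewrite (eq_bigl (fun p => (p \in s) && (ohead p == Some false))) //.
by case=> [|[] p] //=; rewrite (negPf s0).
Qed.

Section Sums.
Local Open Scope ring_scope.
Variables (R : realType) (V : string -> option string).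
Hypothesis V_prefix_free : prefix_free (dom V).

Lemma kraft (s : seq string) : uniq s -> {in s, forall p, dom V p} ->
  \sum_(p <- s) (2 ^- size p : R) <= 1.
Proof.
move=> us sV; pose n := (\max_(p <- s) size p)%N.
have sz : {in s, forall p, (size p <= n)%N}.
  by move=> p ps; rewrite /n (big_rem p) //= leq_maxl.
have := kraft_nat us _ sz; rewrite -(ler_nat R) natr_sum natrX => h.
have e0 : 0 < (2 ^+ n : R) by rewrite exprn_gt0.
rewrite -(ler_pM2l e0) mulr1 mulr_sumr; apply: le_trans (h _); last first.
  by move=> p q /sV ? /sV ? ?; apply: V_prefix_free.
rewrite big_seq [X in _ <= X]big_seq; apply: ler_sum => p /sz pn.
by rewrite natrX expfB_cond // pnatr_eq0.
Qed.

Definition gsum (g : nat -> R) : R := fine (\esum_(p in dom V) (g (size p))%:E).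

(** By Kraft's inequality, [C] bounds the sum of such a [g] over the lengths of
    the strings of a prefix-free set. *)
Definition dominated (C : R) (g : nat -> R) := forall l, 0 <= g l <= C / 2 ^+ l.

Section Dominated.
Variables (C : R) (g : nat -> R).
Hypothesis gC : dominated C g.

Lemma dominated_ge0 l : 0 <= g l.
Proof. by have /andP[] := gC l. Qed.

Lemma dominated_const : 0 <= C.
Proof. by have /andP[h] := gC 0; rewrite expr0 divr1; apply: le_trans. Qed.

Lemma finite_sum_le (s : seq string) : uniq s -> {in s, forall p, dom V p} ->
  \sum_(p <- s) g (size p) <= C.
Proof.
move=> us sV; apply: (@le_trans _ _ (C * \sum_(p <- s) 2 ^- size p)).
  by rewrite mulr_sumr; apply: ler_sum => p _; have /andP[] := gC (size p).
by rewrite -[leRHS]mulr1 ler_wpM2l ?dominated_const ?kraft.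
Qed.

Lemma gsumE : (gsum g)%:E = \esum_(p in dom V) (g (size p))%:E.
Proof.
rewrite fineK // ge0_fin_numE; last first.
  by apply: esum_ge0 => p _; rewrite lee_fin dominated_ge0.
apply: (@le_lt_trans _ _ C%:E); last by rewrite ltry.
apply: ge_ereal_sup => _ [A [finA AV] <-].
rewrite fsbig_finite // sumEFin lee_fin; apply: finite_sum_le; first exact: finmap.fset_uniq.
by move=> p; rewrite in_fset_set // inE => /AV.
Qed.

Lemma gsum_le : gsum g <= C.
Proof.
rewrite -lee_fin gsumE; apply: ge_ereal_sup => _ [A [finA AV] <-].
rewrite fsbig_finite // sumEFin lee_fin; apply: finite_sum_le; first exact: finmap.fset_uniq.
by move=> p; rewrite in_fset_set // inE => /AV.
Qed.

Lemma gsum_ub (s : seq string) : uniq s -> {in s, forall p, dom V p} ->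
  \sum_(p <- s) g (size p) <= gsum g.
Proof.
move=> us sV; rewrite -lee_fin gsumE; apply: esum_ge; exists [set` s]%classic.
  by split; [exact: finite_seq | move=> p /= /sV].
by rewrite -fsbig_seq // sumEFin.
Qed.

Lemma gsum_adherent (e : R) : 0 < e -> exists s : seq string,
  [/\ uniq s, {in s, forall p, dom V p} & gsum g - e < \sum_(p <- s) g (size p)].
Proof.
move=> e0; have fin : \esum_(p in dom V) (g (size p))%:E \is a fin_num by rewrite -gsumE.
have [_ [A [finA AV] <-]] := ub_ereal_sup_adherent e0 fin.
rewrite -/(esum _ _) -gsumE -EFinB fsbig_finite // sumEFin lte_fin => h.
exists (finmap.enum_fset (fset_set A)); split=> //; first exact: finmap.fset_uniq.
by move=> p; rewrite in_fset_set // inE => /AV.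
Qed.

End Dominated.

Variable st : nat -> nat -> nat.
Hypothesis stP : forall x y,
  V x = Some y <-> exists s, st (string_code x) s = (string_code y).+1.

Definition found (k i : nat) : bool := (i < k)%N && bex k (fun s => st i s != 0%N).

Lemma found_dom k i : found k i -> dom V (decode i).
Proof.
move=> /andP[_ /hasP[s _]]; case E : (st i s) => [//|y] _.
rewrite /dom /= (_ : V (decode i) = Some (decode y)) //.
by apply/stP; exists s; rewrite !decodeK.
Qed.

Lemma found_mono k j i : (k <= j)%N -> found k i -> found j i.
Proof.
move=> kj /andP[ik /hasP[s]]; rewrite mem_iota add0n => /andP[_ sk] hs.
rewrite /found (leq_trans ik kj); apply/hasP; exists s => //.
by rewrite mem_iota add0n (leq_trans sk kj).
Qed.

Lemma dom_found p : dom V p -> exists k, found k (string_code p).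
Proof.
rewrite /dom /=; case E : (V p) => [y|//] _; have /stP[s hs] := E.
exists (maxn (string_code p) s).+1; rewrite /found ltnS leq_maxl.
by apply/hasP; exists s; rewrite ?hs // mem_iota add0n ltnS leq_maxr.
Qed.

Definition stage_sum k (g : nat -> R) : R :=
  \sum_(i < k | found k i) g (code_size i).

Definition stage k : seq string := [seq decode i | i <- iota 0 k & found k i].

Lemma stage_uniq k : uniq (stage k).
Proof.
rewrite map_inj_uniq ?filter_uniq ?iota_uniq //.
by move=> i j /(congr1 string_code); rewrite !decodeK.
Qed.

Lemma stage_dom k : {in stage k, forall p, dom V p}.
Proof. by move=> p /mapP[i]; rewrite mem_filter => /andP[/found_dom h _] ->. Qed.

Lemma mem_stage k p : (p \in stage k) = found k (string_code p).
Proof.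
apply/mapP/idP => [[i]|h].
  by rewrite mem_filter => /andP[h _] ->; rewrite decodeK.
exists (string_code p); last by rewrite string_codeK.
by rewrite mem_filter h mem_iota /= add0n; case/andP: h.
Qed.

Lemma stage_sumE k g : stage_sum k g = \sum_(p <- stage k) g (size p).
Proof.
rewrite /stage_sum -(big_mkord (found k) (fun i => g (code_size i))).
rewrite big_map big_filter /index_iota subn0.
by apply: eq_bigr => i _; rewrite -string_code_size decodeK.
Qed.

Section StageSums.
Variables (C : R) (g : nat -> R).
Hypothesis gC : dominated C g.

Lemma stage_sum_le k : stage_sum k g <= gsum g.
Proof. by rewrite stage_sumE (gsum_ub gC (stage_uniq k) (@stage_dom k)). Qed.

Lemma stage_sum_miss k p : dom V p -> ~~ found k (string_code p) ->
  stage_sum k g + g (size p) <= gsum g.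
Proof.
move=> pV pk; have := @gsum_ub _ _ gC (p :: stage k).
rewrite big_cons -stage_sumE addrC; apply.
  by rewrite /= mem_stage pk stage_uniq.
by move=> q; rewrite inE => /orP[/eqP-> //|/stage_dom].
Qed.

Lemma stage_sum_cvg (e : R) : 0 < e ->
  exists k0, forall k, (k0 <= k)%N -> gsum g - e < stage_sum k g.
Proof.
move=> e0; have [s [us sV hs]] := gsum_adherent gC e0.
have [k0 hk0] : exists k0, {in s, forall p, found k0 (string_code p)}.
  elim: (s) sV => [|p s' IH] sV; first by exists 0%N.
  have [k1 h1] := IH (fun q qs => sV q (mem_behead (s := p :: s') qs)).
  have [k2 h2] := dom_found (sV p (mem_head p s')).
  exists (maxn k1 k2) => q; rewrite inE => /orP[/eqP->|/h1].
    by apply: found_mono h2; apply: leq_maxr.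
  by apply: found_mono; apply: leq_maxl.
exists k0 => k k0k; apply: (lt_le_trans hs); rewrite stage_sumE.
have sk : {subset s <= stage k}.
  by move=> p /hk0; rewrite mem_stage; apply: found_mono.
have g0 := dominated_ge0 gC.
rewrite [leRHS](bigID (fun p => p \in s)) /= -[leLHS]addr0 lerD //.
  rewrite -[leRHS]big_filter le_eqVlt; apply/orP; left; apply/eqP.
  apply: perm_big; apply: uniq_perm; rewrite ?filter_uniq ?stage_uniq //.
  move=> p; rewrite mem_filter; case: (boolP (p \in s)) => //= /sk -> //.
by apply: sumr_ge0 => p _; apply: g0.
Qed.

(** What a sum still lacks at stage [k] comes from the missing strings alone, so
    a comparison of [g] and [h] there is enough, however they compare
    elsewhere. *)
Lemma gsum_gap (C' a : R) (h : nat -> R) k : dominated C' h -> 0 <= a ->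
  (forall p, dom V p -> ~~ found k (string_code p) -> a * g (size p) <= h (size p)) ->
  a * (gsum g - stage_sum k g) <= gsum h - stage_sum k h.
Proof.
move=> hC a0 gh.
have split f j : (k <= j)%N -> stage_sum j f =
    stage_sum k f + \sum_(i < j | found j i && ~~ found k i) f (code_size i).
  move=> kj; rewrite [LHS](bigID (fun i : 'I_j => found k i)) /=; congr (_ + _).
  rewrite /stage_sum (big_ord_widen_cond j (found k) (fun i => f (code_size i))) //.
  apply: eq_bigl => i; case: (boolP (found k i)) => fk; rewrite ?andbF //=.
  by rewrite (found_mono kj fk); case/andP: fk => ->.
apply/ler_addgt0Pr => e e0.
have a1 : 0 < a + 1 by rewrite ltr_wpDl.
have [k0 hk0] := stage_sum_cvg (divr_gt0 e0 a1).
have := hk0 _ (leq_maxl k0 k); set j := maxn k0 k.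
have kj : (k <= j)%N by apply: leq_maxr.
have hh : stage_sum j h <= gsum h.
  by rewrite stage_sumE (gsum_ub hC (stage_uniq j) (@stage_dom j)).
rewrite split // => hg; rewrite split // in hh.
have hs : a * \sum_(i < j | found j i && ~~ found k i) g (code_size i) <=
    \sum_(i < j | found j i && ~~ found k i) h (code_size i).
  rewrite mulr_sumr; apply: ler_sum => i /andP[/found_dom fj fk].
  rewrite -[nat_of_ord i]decodeK string_code_size; apply: gh => //.
  by rewrite decodeK.
have he : a * (e / (a + 1)) <= e.
  by rewrite mulrCA ger_pMr // ler_pdivrMr // mul1r lerDl.
have : a * (gsum g - e / (a + 1)) <= a * (stage_sum k g +
    \sum_(i < j | found j i && ~~ found k i) g (code_size i)).
  by rewrite ler_wpM2l // ltW.
rewrite mulrBr mulrDr mulrBr.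
set s1 := a * \sum_(i < j | _) _ in hs *; set s2 := \sum_(i < j | _) _ in hs hh.
lra.
Qed.

End StageSums.

(** There are at most [k] terms at stage [k], each with an error of at most
    [2 / 2 ^ (k + 5)], and [k <= 2 ^ k]. *)
Lemma integer_stage_sum k (G : nat -> nat) (g : nat -> R) :
  (forall l, (G l)%:R <= 2 ^+ (k + 5) * g l <= (G l + 2)%:R) ->
  stage_sum k g - 16^-1 <=
    (bsum k (fun i => found k i * G (code_size i)))%N%:R / 2 ^+ (k + 5) <=
    stage_sum k g.
Proof.
move=> hG; set S := bsum _ _; have e0 : 0 < (2 ^+ (k + 5) : R) by rewrite exprn_gt0.
rewrite ler_pdivlMr // ler_pdivrMr // /stage_sum.
have SE : S%:R = \sum_(i < k | found k i) (G (code_size i))%:R :> R.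
  rewrite /S /bsum natr_sum [RHS]big_mkcond; apply: eq_bigr => i _.
  by case: (found k i); rewrite ?mul1n ?mul0n.
rewrite SE mulrBl mulr_suml; apply/andP; split; last first.
  by apply: ler_sum => i _; have /andP[h _] := hG (code_size i); rewrite mulrC.
rewrite lerBlDr; apply: (@le_trans _ _ (\sum_(i < k | found k i) ((G (code_size i))%:R + 2))).
  apply: ler_sum => i _; have /andP[_ h] := hG (code_size i).
  by rewrite mulrC (le_trans h) // natrD.
rewrite big_split /= lerD2l.
apply: (@le_trans _ _ (\sum_(i < k) (2 : R))).
  rewrite [X in X <= _]big_mkcond; apply: ler_sum => i _.
  by case: ifP => // _; rewrite ler0n.
rewrite sumr_const card_ord -[_ *+ k]mulr_natr exprD.
have : (k%:R : R) <= 2 ^+ k by rewrite -natrX ler_nat ltnW // ltn_expl.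
by move: (2 ^+ k) => x kx; rewrite (_ : 2 ^+ 5 = 32 :> R); [lra | rewrite -natrX].
Qed.

End Sums.


(** * Binary expansions *)

Section BinaryExpansion.
Local Open Scope ring_scope.
Variables (R : realType) (x : R).

Definition frac : R := x - (Num.floor x)%:~R.

Lemma frac_ge0 : 0 <= frac.
Proof. by rewrite subr_ge0 floor_le. Qed.

Lemma frac_lt1 : frac < 1.
Proof. by rewrite ltrBlDl -intrD1 floorD1_gt. Qed.

Definition digits (n : nat) : nat := Num.truncn (2 ^+ n * frac).

Lemma digitsP n : (digits n)%:R <= 2 ^+ n * frac < (digits n + 1)%:R.
Proof. by rewrite addn1; apply: truncn_itv; rewrite mulr_ge0 ?exprn_ge0 ?frac_ge0. Qed.

Lemma digits_unique n v : v%:R <= 2 ^+ n * frac < (v + 1)%:R -> digits n = v.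
Proof. by rewrite addn1; apply: truncn_def. Qed.

Lemma digits_lt n : (digits n < 2 ^ n)%N.
Proof.
rewrite -(ltr_nat R) natrX; have /andP[h _] := digitsP n; apply: (le_lt_trans h).
by rewrite -[ltRHS]mulr1 ltr_pM2l ?exprn_gt0 ?frac_lt1.
Qed.

Lemma digits_div n m : (n <= m)%N -> digits n = (digits m %/ 2 ^ (m - n))%N.
Proof.
move=> nm; apply: digits_unique; have /andP[h1 h2] := digitsP m.
set d := (2 ^ (m - n))%N; have d0 : (0 < d)%N by rewrite expn_gt0.
have dR : 0 < (d%:R : R) by rewrite ltr0n.
have mE : 2 ^+ m = d%:R * 2 ^+ n :> R by rewrite /d natrX -exprD subnK.
have hd := divn_eq (digits m) d; have hm := ltn_pmod (digits m) d0.
apply/andP; split.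
  rewrite -(ler_pM2l dR) mulrA -mE; apply: le_trans h1.
  by rewrite -natrM ler_nat mulnC leq_trunc_div.
rewrite -(ltr_pM2l dR) mulrA -mE; apply: (lt_le_trans h2).
by rewrite -natrM ler_nat; nia.
Qed.

Definition partial (b : nat -> bool) (n : nat) : R :=
  (bits_value 0 (mkseq b n))%:R / 2 ^+ n.

Lemma partialS b n : partial b n.+1 = partial b n + (b n)%:R / 2 ^+ n.+1.
Proof.
have mkS : mkseq b n.+1 = rcons (mkseq b n) (b n).
  by rewrite /mkseq -addn1 iotaD map_cat cats1.
rewrite /partial mkS bits_value_rcons natrD -muln2 natrM exprS mulrDl.
congr (_ + _); rewrite invfM; set u := (bits_value _ _)%:R.
by rewrite mulrA mulfK // pnatr_eq0.
Qed.

Lemma seriesE (b : nat -> bool) : series (fun i => (b i)%:R / 2 ^+ i.+1) = partial b.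
Proof.
apply/funext => n; elim: n => [|n IH].
  by rewrite /series /= big_geq // /partial /= mul0r.
by rewrite partialS -IH /series /= big_nat_recr.
Qed.

Lemma partial_le b n m : (n <= m)%N ->
  partial b n <= partial b m <= partial b n + 2 ^- n - 2 ^- m.
Proof.
move=> /subnK <-; elim: (m - n)%N => [|k IH]; first by rewrite add0n addrK !lexx.
rewrite addSn partialS; set p := partial b _ in IH *.
have e0 : 0 < (2 ^- (k + n) : R) by rewrite invr_gt0 exprn_gt0.
have -> : 2 ^- (k + n).+1 = 2^-1 * 2 ^- (k + n) :> R by rewrite exprS invfM.
move: (2 ^- (k + n) : R) e0 IH => e e0 /andP[h1 h2].
by case: (b _); rewrite /=; lra.
Qed.

(** Later bits add at most [2 ^- n] to the partial sum at [n], and strictly less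
    because one of them is [0]. *)
Lemma digits_of_expansion b n : binary_expansion x b ->
  bits_value 0 (mkseq b n) = digits n.
Proof.
move=> [cv zeros]; rewrite seriesE -/frac in cv.
have e0 k : 0 < (2 ^+ k : R) by rewrite exprn_gt0.
have low m : partial b m <= frac.
  rewrite -(cvg_lim _ cv) //; apply: limr_ge; first by apply/cvg_ex; exists frac.
  near=> k; have mk : (m <= k)%N by near: k; exists m.
  by have /andP[] := partial_le b mk.
have up m : frac <= partial b m + 2 ^- m.
  rewrite -(cvg_lim _ cv) //; apply: limr_le; first by apply/cvg_ex; exists frac.
  near=> k; have mk : (m <= k)%N by near: k; exists m.
  have /andP[_] := partial_le b mk.
  by move=> /le_trans; apply; rewrite gerBl invr_ge0 ltW.
apply/esym/digits_unique; rewrite natrD; apply/andP; split.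
  by have := low n; rewrite /partial ler_pdivrMr // mulrC.
have [m nm bm] := zeros n.
have h1 := up m.+1; rewrite partialS bm mul0r addr0 in h1.
have /andP[_ h2] := partial_le b nm.
have h3 : (2 ^- m.+1 : R) < 2 ^- m by rewrite ltf_pV2 ?posrE // ltr_eXn2l // ltr1n.
have : frac < partial b n + 2 ^- n by lra.
have -> : partial b n + 2 ^- n = ((bits_value 0 (mkseq b n))%:R + 1) / 2 ^+ n.
  by rewrite mulrDl mul1r.
by rewrite ltr_pdivlMr // mulrC.
Unshelve. all: by end_near. Qed.

Lemma expansion_exists : exists2 b, binary_expansion x b &
  forall n, bits_value 0 (mkseq b n) = digits n.
Proof.
have e0 k : 0 < (2 ^+ k : R) by rewrite exprn_gt0.
pose b i := odd (digits i.+1).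
have bE n : bits_value 0 (mkseq b n) = digits n.
  elim: n => [|n IH]; first by apply/esym/eqP; have := digits_lt 0; rewrite ltnS leqn0.
  have -> : mkseq b n.+1 = rcons (mkseq b n) (b n).
    by rewrite /mkseq -addn1 iotaD map_cat cats1.
  rewrite bits_value_rcons IH (digits_div (leqnSn n)) subSnn expn1 divn2 /b.
  by rewrite addnC odd_double_half.
have low n : partial b n <= frac.
  by rewrite /partial bE ler_pdivrMr // mulrC; have /andP[] := digitsP n.
have up n : frac < partial b n + 2 ^- n.
  have -> : partial b n + 2 ^- n = ((digits n)%:R + 1) / 2 ^+ n.
    by rewrite /partial bE mulrDl mul1r.
  rewrite ltr_pdivlMr // mulrC.
  by have /andP[_] := digitsP n; rewrite natrD.
exists b => //; split.
  rewrite seriesE -/frac; apply/cvgrPdist_le => e e_gt0.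
  have [N hN] := small_pow e_gt0.
  exists N => // n /= Nn; rewrite ger0_norm ?subr_ge0 //.
  have h1 := up n.
  have h2 : (2 ^- n : R) <= 2 ^- N by rewrite lef_pV2 ?posrE // ler_eXn2l // ltr1n.
  have h3 : (2 ^- N : R) <= 2 / 2 ^+ N by rewrite ler_peMl ?invr_ge0 ?ler1n // ltW.
  lra.
move=> n; apply: contrapT => h.
have b1 m : (n <= m)%N -> b m = true.
  by move=> nm; apply: contrapT => /negP/negbTE bm; apply: h; exists m.
have pE k : partial b (k + n) = partial b n + 2 ^- n - 2 ^- (k + n).
  elim: k => [|k IH]; first by rewrite add0n addrK.
  rewrite addSn partialS IH b1 ?leq_addl // exprS invfM.
  by move: (2 ^- (k + n) : R) => e; rewrite /=; lra.
have [k hk] : exists k : nat, 2 / 2 ^+ k < partial b n + 2 ^- n - frac.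
  by apply: small_pow; rewrite subr_gt0.
have h1 := low (k + n)%N; rewrite pE in h1.
have h2 : (2 ^- (k + n) : R) <= 2 ^- k by rewrite lef_pV2 ?posrE // ler_eXn2l ?leq_addr // ltr1n.
have h3 : (2 ^- k : R) <= 2 / 2 ^+ k by rewrite ler_peMl ?invr_ge0 ?ler1n // ltW.
lra.
Qed.

(** Existence and uniqueness of the expansion turn membership of a string into
    an equation between numbers. *)
Lemma PfE w : Pf x w <-> bits_value 0 w = digits (size w).
Proof.
split=> [[b hb [n ->]]|hw]; first by rewrite size_mkseq; apply: digits_of_expansion.
have [b hb bE] := expansion_exists; exists b => //; exists (size w).
by apply: bits_value_inj; rewrite ?size_mkseq // bE.
Qed.

End BinaryExpansion.

(** * From a bound on the query size to a reduction *)

Section Weights.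
Local Open Scope ring_scope.
Variables (R : realType) (T : R).
Hypotheses (T_gt0 : 0 < T) (T_le1 : T <= 1).

Lemma weightE m l : 2 ^+ m * weight T l = 2 `^ (m%:R - l%:R / T).
Proof.
rewrite /weight -powR_mulrn ?ler0n // -powRD; last by rewrite pnatr_eq0 implybT.
by rewrite mulNr.
Qed.

(** The contribution of a string of length [l] to [2 ^ m] times the halting sum,
    cut off where it would exceed the unit of the [m]-th digit. *)
Definition capped m l : R := Num.min 1 (2 ^+ m * weight T l).

(** As [min 1 x <= x ^ T] for [0 < T <= 1], and the [T]-th power of
    [2 ^ (m - l / T)] is [2 ^ (T * m - l)]. *)
Lemma capped_dominated m : dominated (2 `^ (T * m%:R)) (capped m).
Proof.
have T0 : 0 < T := T_gt0; have T1 : T <= 1 := T_le1.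
move=> l; apply/andP; split.
  by rewrite /capped le_min ler01 mulr_ge0 ?exprn_ge0 // ltW ?weight_gt0.
have -> : 2 `^ (T * m%:R) / 2 ^+ l = 2 `^ (T * (m%:R - l%:R / T)) :> R.
  rewrite -powR_mulrn ?ler0n // -powRB; last by rewrite pnatr_eq0 implybT.
  by congr (_ `^ _); field; rewrite gt_eqF.
rewrite /capped weightE; set y := m%:R - _.
have two1 : (1 : R) <= 2 by rewrite ler1n.
case: (lerP 0 y) => y0; rewrite ge_min.
  by apply/orP; left; rewrite -[leLHS](powRr0 2); apply: ler_powR => //; rewrite mulr_ge0 // ltW.
apply/orP; right; apply: ler_powR => //.
by rewrite -[leLHS]mul1r ler_wnM2r // ltW.
Qed.

Lemma weight_dominated : dominated 1 (weight T).
Proof.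
move=> l; have := capped_dominated 0 l.
rewrite mulr0 powRr0 /capped expr0 mul1r => /andP[_ h].
rewrite ltW ?weight_gt0 //=; apply: le_trans h; rewrite le_min lexx andbT.
rewrite /weight -[leRHS](powRr0 2); apply: ler_powR; rewrite ?ler1n //.
by rewrite mulNr oppr_le0 divr_ge0 // ltW // T_gt0.
Qed.

Lemma weight_lt m l C : 2 ^+ m * weight T l < 2 `^ C -> m%:R - C < l%:R / T.
Proof.
rewrite weightE => h; rewrite ltrBlDr -ltrBlDl ltNge; apply/negP => h'.
by have := ler_powR (_ : 1 <= 2 :> R) h'; rewrite ler1n leNgt h => /(_ isT).
Qed.

End Weights.

Section IntegerSums.
Variables (st L : nat -> nat -> nat).

(** [2 ^ (m + k + 5)] times the sum of the weights found at stage [k], in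
    integers; the precision grows with [k] because there are [k] errors. *)
Definition int_sum k m : nat :=
  bsum k (fun i => found st k i * L (code_size i) (k + m + 5)).

Lemma found_computable : computable2 st -> computable2 (found st).
Proof. by move=> hst; rewrite /found; comp. Qed.

Lemma int_sum_computable : computable2 st -> computable2 L -> computable2 int_sum.
Proof.
move=> /found_computable hf hL; rewrite /int_sum.
by have hc := code_size_computable; comp.
Qed.

End IntegerSums.

Section Stages.
Local Open Scope ring_scope.
Variables (R : realType) (T : R) (L st : nat -> nat -> nat).
Hypothesis LP : forall l K, (L l K)%:R <= 2 ^+ K * weight T l <= (L l K + 2)%:R.

Lemma int_sumP k m :
  2 ^+ m * stage_sum st k (weight T) - 16^-1 <=
  (int_sum st L k m)%:R / 2 ^+ (k + 5) <= 2 ^+ m * stage_sum st k (weight T).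
Proof.
have := @integer_stage_sum R st k (fun l => L l (k + m + 5))
  (fun l => 2 ^+ m * weight T l).
rewrite /stage_sum -mulr_sumr; apply=> l.
by rewrite mulrA -exprD addnAC; apply: LP.
Qed.

End Stages.

Lemma ceil_inv (R : realType) (T : R) : (0 < T)%R -> 
  exists k : nat, (1 <= T * k%:R)%R.
Proof.
move=> T0; exists (Num.truncn (T^-1)%R).+1.
rewrite mulrC -ler_pdivrMr // div1r ltW //.
exact: truncnS_gt.
Qed.

Lemma floor_nat (R : realType) (x : R) : (0 <= x)%R ->
  exists k : nat, (x = k%:R + frac x)%R.
Proof.
move=> x0; exists (absz (Num.floor x)); rewrite /frac natr_absz ger0_norm ?floor_ge0 //.
by rewrite addrC subrK.
Qed.

Section Reduction.
Local Open Scope ring_scope.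
Variables (R : realType) (T : R) (V W : string -> option string) (f : nat -> nat).
Hypotheses (T_computable : computable_real T) (T_gt0 : 0 < T) (T_le1 : T <= 1).
Hypothesis V_optimal : optimal_prefix_free_machine V.
Hypothesis W_machine : prefix_free_machine W.
Hypothesis f_rec : total_recursive f.

(** The first [m] digits of [Z] reveal a stage at which the missing strings weigh
    less than [2 / 2 ^ m] each.  By the bound, no string of length at most
    [size x + d] is then missing, so the time at which [x] enters [dom W], if it
    does, is among the outputs of [V] found at that stage. *)
Lemma reducible_of_bound (c0 : nat) : (forall n : nat, n%:R / T <= (f n + c0)%:R) ->
  exists c : nat, reducible_in_query_size (fun n => (f n + c)%N) (dom W)
    (Pf (halting_sum V T)).
Proof.
move=> hc0; have T0 : 0 < T := T_gt0.
have [[V_rec V_pf] V_opt] := V_optimal.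
have [stV hstV stVP] := stage_function V_rec.
have [stW hstW stWP] := stage_function W_machine.1.
have [L hL LP] := weight_approx T_gt0 T_computable.
(* [G] maps a string in [dom W] to the time at which it is enumerated. *)
have [G G_rec GP] : exists2 G : string -> option string, partial_recursive G &
    forall x y, G x = Some y <-> exists t, [/\ stW (string_code x) t != 0%N,
      forall z, (z < t)%N -> ~~ (stW (string_code x) z != 0%N) & string_code y = t].
  by apply: (@search_machine (fun i t => stW i t != 0%N) (fun _ t => t)); comp.
have stW_dom x t : stW (string_code x) t != 0%N -> dom W x.
  case E : (stW _ t) => [//|y] _; rewrite /dom /=.
  have -> // : W x = Some (decode y) by apply/stWP; exists t; rewrite decodeK.
have G_dom x : dom W x -> exists2 y, G x = Some y & stW (string_code x) (string_code y) != 0%N.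
  rewrite /dom /=; case E : (W x) => [y|//] _; have /stWP[s hs] := E.
  have ex : exists s, stW (string_code x) s != 0%N by exists s; rewrite hs.
  case: (ex_minnP ex) => t ht tmin.
  exists (decode t); last by rewrite decodeK.
  apply/GP; exists t; split; rewrite ?decodeK // => z zt; apply/negP => /tmin.
  by rewrite leqNgt zt.
have [d hd] : exists d : nat, forall p, dom G p ->
    exists q, [/\ dom V q, V q = G p & (size q <= size p + d)%N].
  apply: V_opt; split=> // p q Gp Gq pq; apply: W_machine.2 pq.
    by move: Gp; rewrite /dom /=; case E : (G p) => [y|//] _; have /GP[t [/stW_dom]] := E.
  by move: Gq; rewrite /dom /=; case E : (G q) => [y|//] _; have /GP[t [/stW_dom]] := E.
have [kap hkap] := ceil_inv T_gt0.
(* [kap * d] is at least [d / T]; the last unit absorbs the error of the stage. *)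
pose c := (c0 + kap * d + 1)%N; exists c.
pose m i := (f (code_size i) + c)%N.
have hf := computable_nat f_rec; have hcs := code_size_computable.
have hm : computable m by rewrite /m; comp.
set Z := halting_sum V T.
have Zg : Z = gsum V (weight T) by [].
have dom1 := weight_dominated T_gt0 T_le1.
have Z0 : 0 <= Z.
  rewrite Zg; apply: le_trans (gsum_ub V_pf dom1 (isT : uniq [::]) _) => //.
  by rewrite big_nil.
have [fl Zfl] := floor_nat Z0.
pose test n k := (2 ^ (k + 5) * (pi2 n + 2 ^ m (pi1 n) * fl) <=
  int_sum stV L k (m (pi1 n)) + 2 ^ (k + 5))%N.
(* The sum bounds every output, hence every enumeration time, found so far. *)
pose tstar k := bsum k (fun i => bsum k (fun s => stV i s)).
pose out n k := (if bex (tstar k).+1 (fun s => stW (pi1 n) s != 0%N) then 1 else 0)%N.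
have his := int_sum_computable hstV hL.
have htest : computable2 test by rewrite /test; comp.
have hout : computable2 out by rewrite /out /tstar; comp.
have [ed edP] := search_scheme htest hout.
have [M MP] := oracle_decision ed (computable_natE hm).
have main x : let mx := m (string_code x) in let z := digits Z mx in
    [/\ Pf Z (bits mx z), (forall i, (i < z)%N -> ~ Pf Z (bits mx i)) &
     rec_eval ed [tuple pair (string_code x) z] (x \in dom W)].
  move=> mx z; have zlt := digits_lt Z mx.
  split; first by apply/PfE; rewrite size_bits bitsK.
    move=> i iz /PfE; rewrite size_bits bitsK; last exact: ltn_trans iz zlt.
    by move=> E; rewrite E ltnn in iz.
  have e0 k : 0 < (2 ^+ k : R) by rewrite exprn_gt0.
  have /andP[z1 z2] := digitsP Z mx; rewrite -/z natrD in z1 z2.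
  have ZE : 2 ^+ mx * Z = (2 ^ mx * fl)%N%:R + 2 ^+ mx * frac Z.
    by rewrite {1}Zfl mulrDr natrM natrX.
  have testE k : test (pair (string_code x) z) k =
      ((z + 2 ^ mx * fl)%N%:R - 1 <= (int_sum stV L k mx)%:R / 2 ^+ (k + 5) :> R).
    rewrite /test pairK1 pairK2 -/mx -(ler_nat R) natrD !natrM natrX.
    by rewrite ler_pdivlMr // mulrBl mul1r lerBlDr mulrC.
  have ex : exists k, test (pair (string_code x) z) k.
    have [k0 hk0] := stage_sum_cvg V_pf stVP dom1 (divr_gt0 ltr01 (e0 mx.+1)).
    exists k0; rewrite testE.
    have /andP[h1 _] := int_sumP stV LP k0 mx; apply: le_trans h1.
    have := hk0 _ (leqnn k0); rewrite -Zg -(ltr_pM2l (e0 mx)) mulrBr.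
    have -> : 2 ^+ mx * (1 / 2 ^+ mx.+1) = 2^-1 :> R.
      by rewrite exprS; field; rewrite gt_eqF.
    rewrite ZE natrD; set S := stage_sum _ _ _ => h.
    lra.
  apply/edP; case: (ex_minnP ex) => k hk kmin.
  exists k; split=> //; first by move=> j jk; apply/negP => /kmin; rewrite leqNgt jk.
  rewrite /out pairK1; case: (pselect (dom W x)) => xW; last first.
    rewrite memNset //; case: ifP => // /hasP[s _ /stW_dom]; by move/xW.
  rewrite mem_set // ifT //; apply/hasP.
  have [y Gx hy] := G_dom x xW.
  exists (string_code y) => //; rewrite mem_iota add0n /= ltnS.
  have [q [qV Vq sq]] : exists q, [/\ dom V q, V q = G x & (size q <= size x + d)%N].
    by apply: hd; rewrite /dom /= Gx.
  have fq : found stV k (string_code q).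
    apply/negPn/negP => nf; have := stage_sum_miss V_pf stVP dom1 qV nf; rewrite -Zg => hq.
    move: hk; rewrite testE => hk.
    have /andP[_ h2] := int_sumP stV LP k mx.
    have hq2 : 2 ^+ mx * stage_sum stV k (weight T) + 2 ^+ mx * weight T (size q) <= 2 ^+ mx * Z.
      by rewrite -mulrDr ler_pM2l.
    have lt2 : 2 ^+ mx * weight T (size q) < 2 `^ 1.
      rewrite powRr1 ?ler0n // ; rewrite natrD in hk.
      set a := 2 ^+ mx * weight _ _ in hq2 *; set S := 2 ^+ mx * stage_sum _ _ _ in hq2 h2.
      lra.
    have := weight_lt lt2; apply/negP; rewrite -leNgt.
    apply: (@le_trans _ _ ((size x)%:R / T + d%:R / T)).
      by rewrite -mulrDl ler_pM2r ?invr_gt0 // -natrD ler_nat.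
    have h1 := hc0 (size x).
    have h3 : d%:R / T <= (kap * d)%N%:R.
      rewrite ler_pdivrMr // natrM mulrAC -[leLHS]mul1r ler_wpM2r //.
      by rewrite mulrC.
    rewrite /mx /m string_code_size /c.
    move: h1 h3; rewrite !natrD; lra.
  move: Vq; rewrite Gx => /stVP[s0 hs0].
  have /andP[qk /hasP[s]] := fq; rewrite mem_iota add0n /= => sk.
  case E : (stV (string_code q) s) => [//|y'] _.
  have Vq' : V q = Some (decode y') by apply/stVP; exists s; rewrite decodeK.
  have Vqy : V q = Some y by apply/stVP; exists s0.
  have -> : string_code y = y' by move: Vq'; rewrite Vqy => -[->]; rewrite decodeK.
  rewrite /tstar /bsum (bigD1 (Ordinal qk)) //= (bigD1 (Ordinal sk)) //= E.
  by lia.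
exists M; split.
  move=> x; have [h1 h2 h3] := main x; have [[t ht] _] := MP _ _ _ _ h1 h2 h3.
  by exists t; rewrite ht; case: (x \in dom W).
move=> x t ht; have [h1 h2 h3] := main x; have [_ hb] := MP _ _ _ _ h1 h2 h3.
by have := hb t ht; rewrite /m string_code_size.
Qed.

End Reduction.

(** * From a reduction to a bound on the query size *)

Lemma otm_run_halted (M : oracle_tm) B x t t' : (t <= t')%N ->
  cfg_state (otm_run M B x t) = otm_accept M \/
  cfg_state (otm_run M B x t) = otm_reject M -> otm_run M B x t' = otm_run M B x t.
Proof.
move=> /subnK <- h; elim: (t' - t)%N => [|k IH] //.
by rewrite addSn /otm_run iterS -!/(otm_run _ _ _ _) IH otm_step_halt.
Qed.

Lemma accept_neq_reject (M : oracle_tm) : otm_accept M != otm_reject M.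
Proof. by have /andP[] := otm_distinct M; rewrite inE negb_or => /andP[]. Qed.

Lemma eventually_ball N (P : nat -> nat -> bool) :
  (forall i, (i < N)%N -> exists t0, forall t, (t0 <= t)%N -> P i t) ->
  exists t0, forall t, (t0 <= t)%N -> ball N (P^~ t).
Proof.
move=> h; suff : forall n, (n <= N)%N -> exists t0, forall t, (t0 <= t)%N -> ball n (P^~ t).
  by apply.
elim=> [|n IH] nN; first by exists 0%N.
have [t0 h0] := IH (ltnW nN); have [t1 h1] := h n nN.
exists (maxn t0 t1) => t; rewrite geq_max => /andP[le0 le1].
have -> : ball n.+1 (P^~ t) = P n t && ball n (P^~ t).
  by rewrite /ball -[n.+1]addn1 iotaD cats1 all_rcons.
by rewrite h1 // h0.
Qed.

Lemma string_code_lt x n : (size x <= n)%N -> (string_code x < (2 ^ n.+1).-1)%N.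
Proof.
move=> xn; have h : (string_code x).+1 = _ := string_codeE x.
rewrite bits_valueE mul1n in h; have := bits_value_lt x.
have : (2 ^ (size x).+1 <= 2 ^ n.+1)%N by rewrite leq_exp2l.
by rewrite !expnS; lia.
Qed.

(** ** Self-delimiting strings *)

(** The length of [s] will be a function of [d], so these strings form a
    prefix-free set. *)
Definition delimit (d : nat) (s : string) : string := nseq d true ++ false :: s.

Lemma size_delimit d s : size (delimit d s) = (d + (size s).+1)%N.
Proof. by rewrite size_cat size_nseq. Qed.

Lemma delimit_code d s : (string_code (delimit d s)).+1 =
  ((2 ^ d.+1 - 1) * 2 ^ (size s).+1 + bits_value 0 s)%N.
Proof.
rewrite string_codeE bits_value_cat.
have -> : bits_value 1 (nseq d true) = (2 ^ d.+1 - 1)%N.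
  elim: d => // d IH.
  have -> : nseq d.+1 true = rcons (nseq d true) true.
    by rewrite -cats1 -[in LHS]addn1 nseqD.
  by rewrite bits_value_rcons IH [in RHS]expnS; have := expn_gt0 2 d.+1; rewrite /=; lia.
by rewrite /= bits_valueE addn0 [(2 ^ (size s).+1)%N]expnS mulnA muln2.
Qed.

Lemma prefix_delimit d d' s s' : prefix (delimit d s) (delimit d' s') -> d = d'.
Proof.
elim: d d' => [|d IH] [|d'] //=.
by move=> /IH ->.
Qed.

Lemma prefix_size (p q : string) : size p = size q -> prefix p q -> p = q.
Proof. by move=> pq; rewrite prefixE pq take_size => /eqP. Qed.

Lemma bit_between (y D : nat) : (y < D + 1)%N -> (D < y + 2)%N -> (y + (D != y))%N = D.
Proof. by case: eqP => [->|]; rewrite ?addn0 //; lia. Qed.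

Section Counting.
Local Open Scope ring_scope.
Variables (R : realType) (T : R) (V : string -> option string).
Hypotheses (T_gt0 : 0 < T) (T_le1 : T <= 1).
Hypothesis V_machine : prefix_free_machine V.
Variables (stV L : nat -> nat -> nat).
Hypothesis stVP : forall x y,
  V x = Some y <-> exists s, stV (string_code x) s = (string_code y).+1.
Hypothesis LP : forall l K, (L l K)%:R <= 2 ^+ K * weight T l <= (L l K + 2)%:R.

(** The integer analogue of [int_sum] for the capped weights; the repeated
    subtraction is a minimum with [2 ^ (k + 5)]. *)
Definition cap_sum k m : nat :=
  bsum k (fun i => found stV k i *
    (2 ^ (k + 5) - (2 ^ (k + 5) - L (code_size i) (k + m + 5))))%N.

Lemma cap_sumP k m :
  stage_sum stV k (capped T m) - 16^-1 <= (cap_sum k m)%:R / 2 ^+ (k + 5) <=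
  stage_sum stV k (capped T m).
Proof.
apply: (@integer_stage_sum R stV k
  (fun l => 2 ^ (k + 5) - (2 ^ (k + 5) - L l (k + m + 5)))%N (capped T m)) => l.
have /andP[] := LP l (k + m + 5).
rewrite addnAC exprD -mulrA /capped -minnE; set w := 2 ^+ m * _; set u := L l _.
have e0 : 0 < (2 ^+ (k + 5) : R) by rewrite exprn_gt0.
have eE : (2 ^ (k + 5))%N%:R = 2 ^+ (k + 5) :> R by rewrite natrX.
rewrite !natrD natr_min eE; move: (2 ^+ (k + 5) : R) e0 {eE} => e e0 h1 h2.
rewrite (minr_pMr _ _ (ltW e0)) mulr1; move: (e * w) h1 h2 => y h1 h2.
by apply/andP; split; case: (lerP e u%:R); case: (lerP e y); lra.
Qed.

Definition count_reached m N k : bool := (N * 2 ^ (k + 5) <= 4 * cap_sum k m)%N.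

(** Let [N] be the integer part of four times the capped sum, minus one.  At the
    first stage reaching [N] the missing capped weights sum to at most [1 / 2].
    So none of them is cut off, and [2 ^ m] times the sum of the weights is known
    with an error of at most [1 / 2 + 1 / 16]; one bit is left to determine its
    integer part.  The bit depends on the stage, which is why the stage has to be
    the first one. *)
Lemma digits_from_count m : exists N k : nat, exists b : bool,
  [/\ N%:R <= 4 * 2 `^ (T * m%:R) :> R, count_reached m N k,
      forall k', (k' < k)%N -> ~~ count_reached m N k' &
      digits (halting_sum V T) m =
        ((int_sum stV L k m %/ 2 ^ (k + 5) + b) %% 2 ^ m)%N].
Proof.
have T0 : 0 < T := T_gt0.
have V_pf := V_machine.2.
have dom1 := weight_dominated T_gt0 T_le1.
have domc := capped_dominated T_gt0 T_le1 m.
set Z := halting_sum V T; have Zg : Z = gsum V (weight T) by [].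
have Z0 : 0 <= Z.
  rewrite Zg; apply: le_trans (gsum_ub V_pf dom1 (isT : uniq [::]) _) => //.
  by rewrite big_nil.
have [fl Zfl] := floor_nat Z0.
pose Phi := gsum V (capped T m).
have Phi0 : 0 <= Phi.
  apply: le_trans (gsum_ub V_pf domc (isT : uniq [::]) _) => //.
  by rewrite big_nil.
have Phi_le : Phi <= 2 `^ (T * m%:R) := gsum_le V_pf domc.
have e0 k : 0 < (2 ^+ k : R) by rewrite exprn_gt0.
pose N := (Num.truncn (4 * Phi)).-1.
have N1 : N%:R <= 4 * Phi.
  apply: (@le_trans _ _ (Num.truncn (4 * Phi))%:R); first by rewrite ler_nat leq_pred.
  by rewrite truncn_le mulr_ge0.
have N2 : 4 * Phi < N%:R + 2.
  apply: (lt_le_trans (truncnS_gt _)); rewrite -natrD ler_nat addn2 !ltnS.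
  by rewrite /N; case: Num.truncn.
have N3 k : count_reached m N k = (N%:R <= 4 * ((cap_sum k m)%:R / 2 ^+ (k + 5)) :> R).
  by rewrite mulrA ler_pdivlMr // /count_reached -(ler_nat R) !natrM natrX.
have ex : exists k, count_reached m N k.
  have pos : (0 : R) < 16^-1 by rewrite invr_gt0 ltr0n.
  have [k0 hk0] := stage_sum_cvg V_pf stVP domc pos.
  case: (posnP N) => [N0|N0]; first by exists 0%N; rewrite /count_reached N0.
  exists k0; rewrite N3; have /andP[h _] := cap_sumP k0 m.
  have h' : Phi - 16^-1 < _ := hk0 _ (leqnn k0).
  have : N%:R + 1 <= 4 * Phi.
    have := truncn_le (4 * Phi); rewrite mulr_ge0 // => ht.
    by apply: le_trans ht; rewrite natr1 ler_nat; move: N0; rewrite /N; case: Num.truncn.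
  by lra.
case: (ex_minnP ex) => k hk kmin.
exists N, k.
have gap : 2 ^+ m * (Z - stage_sum stV k (weight T)) <= 2^-1.
  have hgap : Phi - stage_sum stV k (capped T m) <= 2^-1.
    pose q : R := (cap_sum k m)%:R / 2 ^+ (k + 5).
    have h1 : N%:R <= 4 * q by move: hk; rewrite N3.
    have h2 : q <= stage_sum stV k (capped T m) by have /andP[_] := cap_sumP k m.
    by clearbody q; lra.
  apply: (le_trans _ hgap); rewrite Zg.
  apply: (gsum_gap V_pf stVP dom1 domc (ltW (e0 m))) => p pV pk.
  have := stage_sum_miss V_pf stVP domc pV pk; rewrite -/Phi /capped => h.
  have {}h : Num.min 1 (2 ^+ m * weight T (size p)) <= 2^-1.
    by apply: (le_trans _ hgap); rewrite lerBrDl.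
  move: h; case: (lerP 1 (2 ^+ m * weight T (size p))) => // _ h.
  by have h1 : (1 : R) <= 2^-1 := h; lra.
have /andP[S1 S2] := int_sumP stV LP k m.
have /andP[D1 D2] := digitsP Z m.
have sZ : stage_sum stV k (weight T) <= Z := stage_sum_le V_pf stVP dom1 k.
have sZm : 2 ^+ m * stage_sum stV k (weight T) <= 2 ^+ m * Z by rewrite ler_pM2l.
rewrite mulrBr in gap.
set S := int_sum stV L k m in S1 S2 *; pose y := (S %/ 2 ^ (k + 5))%N.
have y1 : y%:R <= S%:R / 2 ^+ (k + 5) :> R.
  by rewrite ler_pdivlMr // -natrX -natrM ler_nat leq_trunc_div.
have y2 : S%:R / 2 ^+ (k + 5) < (y + 1)%:R :> R.
  rewrite ltr_pdivrMr // -natrX -natrM ltr_nat addn1 -ltn_divLR ?expn_gt0 //.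
pose D := (2 ^ m * fl + digits Z m)%N.
have DZ : 2 ^+ m * Z = (2 ^ m * fl)%N%:R + 2 ^+ m * frac Z.
  by rewrite {1}Zfl mulrDr natrM natrX.
have yD : (y < D + 1)%N.
  rewrite -(ltr_nat R) /D -addnA natrD; lra.
have Dy : (D < y + 2)%N.
  rewrite -(ltr_nat R) (addnA y 1 1) natrD /D natrD; lra.
exists (D != y); split=> //.
- by apply: le_trans N1 _; rewrite ler_pM2l.
- by move=> k' k'k; apply/negP => /kmin; rewrite leqNgt k'k.
- have -> : (y + (D != y) = D)%N := bit_between yD Dy.
  by rewrite /D mulnC modnMDl modn_small // digits_lt.
Qed.

End Counting.

Section Bound.
Local Open Scope ring_scope.
Variables (R : realType) (T : R) (V W : string -> option string) (f : nat -> nat).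
Hypotheses (T_computable : computable_real T) (T_gt0 : 0 < T) (T_le1 : T <= 1).
Hypothesis V_machine : prefix_free_machine V.
Hypothesis W_optimal : optimal_prefix_free_machine W.
Hypothesis f_rec : total_recursive f.
Hypothesis f_mono : {homo f : m n / (m <= n)%N}.

(** The approximation [L n K] vanishes only if [2 ^ (K - n / T) <= 2], and it does
    vanish if [n / T] is at least [K + 1].  So a suitable [n] can be found by
    searching for a zero. *)
Lemma sparse_lengths (L : nat -> nat -> nat) (c : nat) : computable2 L ->
  (forall l K, (L l K)%:R <= 2 ^+ K * weight T l <= (L l K + 2)%:R) ->
  (forall c', exists n : nat, ~ (n%:R / T <= (f n + c')%:R)) ->
  exists2 nd : nat -> nat, computable nd &
    forall d, T * (f (nd d) + c)%N%:R + (2 * d + 10)%N%:R <= (nd d)%:R.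
Proof.
move=> hL LP unb; have T0 : 0 < T := T_gt0.
have [kap hkap] := ceil_inv T_gt0.
have hf := computable_nat f_rec.
pose K d n := (f n + c + kap * (2 * d + 10) + 1)%N.
have htest : computable2 (fun d n => L n (K d n) == 0%N) by rewrite /K; comp.
have ex d : exists n, L n (K d n) == 0%N.
  have [n /negP] := unb (c + kap * (2 * d + 10) + 2)%N.
  rewrite -ltNge => hn; exists n.
  have /andP[h _] := LP n (K d n).
  have h1 : 2 ^+ K d n * weight T n <= 2^-1.
    rewrite weightE -(powR_inv1 (ler0n R 2)); apply: ler_powR; first by rewrite ler1n.
    have -> : (K d n)%:R = (f n + (c + kap * (2 * d + 10) + 2))%N%:R - 1 :> R.
      by rewrite /K !natrD; lra.
    by move: hn; move: (_%:R / _) (_%:R) => u v; lra.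
  have : (L n (K d n))%:R < (1 : R).
    apply: (le_lt_trans h); apply: (le_lt_trans h1).
    by rewrite invf_lt1 ?ltr1n ?ltr0n.
  by rewrite ltrn1 ltnS leqn0.
have [nd hnd ndP] := total_search htest ex.
exists nd => // d; have [/eqP L0 _] := ndP d.
have /andP[_] := LP (nd d) (K d (nd d)); rewrite L0 add0n weightE => h.
have {}h : (K d (nd d))%:R - (nd d)%:R / T <= 1.
  move: h; rewrite -ler_ln ?posrE ?powR_gt0 ?ltr0n // ln_powR.
  by rewrite ger_pMl // ln_gt0 // ltr1n.
have h2 : (f (nd d) + c + kap * (2 * d + 10))%N%:R <= (nd d)%:R / T.
  by move: h; rewrite /K natrD => h; lra.
rewrite ler_pdivlMr // natrD mulrDl in h2; apply: le_trans h2.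
rewrite mulrC lerD2l natrM mulrAC -[leLHS]mul1r ler_wpM2r //.
by rewrite mulrC.
Qed.

(** On the input [delimit d s], where [s] codes the description of the digits of
    [Z] for the length [nd d], the machine [F] simulates the reduction to find
    [dom W] up to that length and outputs a string with a code above those of all
    the values of [W] there.  The input is shorter than [nd d] by [d - 1], so for
    large [d] the output would be a value of [W] on a string of length at most
    [nd d]. *)
Lemma bound_of_reducible (c : nat) :
  reducible_in_query_size (fun n => (f n + c)%N) (dom W) (Pf (halting_sum V T)) ->
  exists c : nat, forall n : nat, n%:R / T <= (f n + c)%:R.
Proof.
move=> [M [Mvia Mbound]]; apply: contrapT => nbound; have T0 : 0 < T := T_gt0.
have unb c' : exists n : nat, ~ (n%:R / T <= (f n + c')%:R).
  by apply: contrapT => h; apply: nbound; exists c' => n; apply: contrapT => h'; apply: h; exists n.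
have [[W_rec W_pf] W_opt] := W_optimal.
have [stV hstV stVP] := stage_function V_machine.1.
have [stW hstW stWP] := stage_function W_rec.
have [L hL LP] := weight_approx T_gt0 T_computable.
have [nd hnd ndP] := sparse_lengths c hL LP unb.
have [run hrun runP] := simulate_run M.
pose m d := (f (nd d) + c)%N.
pose ell d := (nd d - 2 * d)%N.
(* A description [v] holds the number [N] of [digits_from_count] in [v %/ 2] and
   the bit in [odd v]; [S d v k] encodes the digits read off at stage [k]. *)
pose S d v k := (2 ^ m d + (int_sum stV L k (m d) %/ 2 ^ (k + 5) + odd v) %% 2 ^ m d)%N.
pose good d v k tau i := (run i (S d v k) tau != 0%N) &&
  ((run i (S d v k) tau != 1%N) || bex tau (fun s => stW i s != 0%N)).
pose test4 i d v k tau := [&& i.+1 == ((2 ^ d.+1 - 1) * 2 ^ (ell d).+1 + v)%N,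
  (v < 2 ^ ell d)%N, count_reached stV L (m d) (v %/ 2) k,
  ball k (fun k' => ~~ count_reached stV L (m d) (v %/ 2) k') &
  ball (2 ^ (nd d).+1).-1 (good d v k tau)].
pose test i t := test4 i (pi1 t) (pi1 (pi2 t)) (pi1 (pi2 (pi2 t))) (pi2 (pi2 (pi2 t))).
(* A witness [t] consists of [d], [v], the stage [k] and a time [tau] by which
   all the simulated runs have halted and all the accepted strings have been
   enumerated into [dom W]. *)
pose out (i t : nat) := (bsum (2 ^ (nd (pi1 t)).+1).-1
  (fun i' => bsum (pi2 (pi2 (pi2 t))) (fun s => stW i' s))).+1.
have hf := computable_nat f_rec.
have his := int_sum_computable hstV hL.
have hfound := found_computable hstV.
have hcs := code_size_computable.
have htest : computable2 test.
  by rewrite /test /test4 /good /S /ell /m /count_reached /cap_sum; comp.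
have hout : computable2 out by rewrite /out; comp.
have [F F_rec FP] := search_machine htest hout.
have test4P x d v k tau : test4 (string_code x) d v k tau ->
    x = delimit d (bits (ell d) v) /\ (v < 2 ^ ell d)%N.
  case/and3P=> /eqP hx hv _; split=> //; apply: string_code_inj; apply: succn_inj.
  by rewrite hx delimit_code size_bits bitsK.
have F_dom x : dom F x -> exists d s, x = delimit d s /\ size s = ell d.
  rewrite /dom /=; case E : (F x) => [y|//] _; have /FP[t [ht _ _]] := E.
  have [-> _] := test4P _ _ _ _ _ ht.
  by exists (pi1 t), (bits (ell (pi1 t)) (pi1 (pi2 t))); rewrite size_bits.
have [d0 hd0] : exists d0 : nat, forall p, dom F p ->
    exists q, [/\ dom W q, W q = F p & (size q <= size p + d0)%N].
  apply: W_opt; split=> // p q /F_dom[d [s [-> sE]]] /F_dom[d' [s' [-> s'E]]] pq.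
  have dd := prefix_delimit pq; apply: prefix_size pq.
  by rewrite !size_delimit sE s'E dd.
pose d := d0.+1; set n := nd d.
have [N [k [b [N1 hk kmin hb]]]] := @digits_from_count R T V T_gt0 T_le1 V_machine stV L stVP LP (m d).
set Z := halting_sum V T in hb.
have nE : (2 * d + 10 <= n)%N.
  rewrite -(ler_nat R); apply: le_trans (ndP d); rewrite lerDr.
  by rewrite mulr_ge0 // ltW.
pose v := (2 * N + b)%N.
have v2 : (v %/ 2 = N)%N by rewrite /v; case: (b); lia.
have vo : odd v = b by rewrite /v oddD mul2n odd_double oddb.
have vlt : (v < 2 ^ ell d)%N.
  have : (N <= 4 * 2 ^ (n - (2 * d + 10)))%N.
    rewrite -(ler_nat R) natrM natrX; apply: (le_trans N1); rewrite ler_pM2l ?ltr0n //.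
    rewrite -powR_mulrn ?ler0n //; apply: ler_powR; first by rewrite ler1n.
    by rewrite natrB // lerBrDr; apply: ndP.
  have -> : (ell d = n - (2 * d + 10) + 10)%N by rewrite /ell -/n; lia.
  by rewrite expnD /v; have := expn_gt0 2 (n - (2 * d + 10)); case: (b); rewrite /=; lia.
have SE : S d v k = (2 ^ m d + digits Z (m d))%N by rewrite /S vo hb.
have mono (p : string) : (size p <= n)%N -> (f (size p) + c <= m d)%N.
  by move=> pn; rewrite leq_add2r; apply: f_mono.
have runE p tau : (size p <= n)%N -> run (string_code p) (S d v k) tau =
    if cfg_state (otm_run M (Pf Z) p tau) == otm_accept M then 1%N
    else if cfg_state (otm_run M (Pf Z) p tau) == otm_reject M then 2%N else 0%N.
  move=> pn; apply: runP => t ht; have hs := leq_trans (Mbound p t ht) (mono p pn).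
  rewrite SE prefix_oracleP ?digits_lt // -digits_div //.
  by apply/idP/eqP; [rewrite inE => /PfE | move=> h; rewrite inE; apply/PfE].
have run_acc p tau : (size p <= n)%N -> run (string_code p) (S d v k) tau != 0%N ->
    (run (string_code p) (S d v k) tau == 1%N) = (p \in dom W).
  move=> pn; rewrite runE //; have [t ht] := Mvia p; rewrite -/Z in ht.
  have halt_t : cfg_state (otm_run M (Pf Z) p t) = otm_accept M \/
      cfg_state (otm_run M (Pf Z) p t) = otm_reject M.
    by rewrite ht; case: (_ \in _); [left | right].
  have same : cfg_state (otm_run M (Pf Z) p tau) = otm_accept M \/
      cfg_state (otm_run M (Pf Z) p tau) = otm_reject M ->
      cfg_state (otm_run M (Pf Z) p tau) = cfg_state (otm_run M (Pf Z) p t).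
    case: (leqP t tau) => [le|/ltnW le] h; first by rewrite (otm_run_halted le halt_t).
    by rewrite (otm_run_halted le h).
  case: (cfg_state (otm_run M (Pf Z) p tau) =P otm_accept M) => [hacc _|_].
    have := same (or_introl hacc); rewrite hacc ht.
    by case: (_ \in _) => // /eqP; rewrite (negPf (accept_neq_reject M)).
  case: (cfg_state (otm_run M (Pf Z) p tau) =P otm_reject M) => // hrej _; have := same (or_intror hrej); rewrite hrej ht.
  by case: (_ \in _) => // /esym/eqP; rewrite (negPf (accept_neq_reject M)).
have decode_size i : (i < (2 ^ n.+1).-1)%N -> (size (decode i) <= n)%N.
  move=> hi; rewrite size_bits -ltnS -(@ltn_exp2l 2) //.
  by apply: leq_ltn_trans (trunc_logP _ _) _ => //; lia.
have [tau0 htau] : exists t0, forall tau, (t0 <= tau)%N ->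
    ball (2 ^ n.+1).-1 (fun i => good d v k tau i).
  apply: (@eventually_ball _ (fun i tau => good d v k tau i)) => i hi.
  have pn := decode_size i hi; have [t ht] := Mvia (decode i); rewrite -/Z in ht.
  have halt_t : cfg_state (otm_run M (Pf Z) (decode i) t) = otm_accept M \/
      cfg_state (otm_run M (Pf Z) (decode i) t) = otm_reject M.
    by rewrite ht; case: (_ \in _); [left | right].
  have runt tau : (t <= tau)%N -> run i (S d v k) tau = if decode i \in dom W then 1%N else 2%N.
    move=> le; rewrite -{1}(decodeK i) runE // (otm_run_halted le halt_t) ht.
    case: (_ \in _); rewrite ?eqxx // eq_sym.
    by rewrite (negPf (accept_neq_reject M)) ?eqxx.
  case: (boolP (decode i \in dom W)) runt => hW runt; last first.
    by exists t => tau le; rewrite /good runt.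
  move: hW; rewrite inE /dom /=; case E : (W _) => [y|//] _; have /stWP[s hs] := E.
  rewrite decodeK in hs; exists (maxn t s.+1) => tau; rewrite geq_max => /andP[le1 le2].
  rewrite /good runt //=; apply/hasP; exists s; last by rewrite hs.
  by rewrite mem_iota add0n.
pose x := delimit d (bits (ell d) v).
have Fx : dom F x.
  have ex : exists t, test (string_code x) t.
    exists (pair d (pair v (pair k tau0))); rewrite /test !pairK2 !pairK1 /test4.
    rewrite delimit_code size_bits bitsK // eqxx vlt v2 hk htau //= andbT.
    by apply/allP => k'; rewrite mem_iota add0n => /andP[_ /kmin].
  rewrite /dom /=; case: (ex_minnP ex) => t ht tmin.
  have -> // : F x = Some (decode (out (string_code x) t)).
  apply/FP; exists t; split; rewrite ?decodeK //.
  by move=> z zt; apply/negP => /tmin; rewrite leqNgt zt.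
have [q [qW Wq sq]] := hd0 x Fx.
have qn : (size q <= n)%N.
  apply: (leq_trans sq); rewrite size_delimit size_bits /ell -/n.
  by move: nE; rewrite /d; lia.
move: Fx; rewrite /dom /=; case E : (F x) => [y|//] _.
have /FP[t [ht _ yE]] := E; rewrite E in Wq.
move: ht yE; rewrite /test /out; set d' := pi1 t; set v' := pi1 (pi2 t).
set k' := pi1 _; set tau := pi2 (pi2 (pi2 t)) => ht yE.
have [xE vlt'] := test4P _ _ _ _ _ ht.
have dE : d' = d.
  by apply/esym; apply: (@prefix_delimit _ _ (bits (ell d) v) (bits (ell d') v')); rewrite -xE prefix_refl.
rewrite dE in xE vlt' ht yE.
have vE : v' = v.
  have := congr1 (drop d.+1) xE.
  rewrite /x /delimit !drop_cat size_nseq ltnNge leqnSn /= subSnn /= !drop0.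
  by move=> /(congr1 (bits_value 0)); rewrite !bitsK.
rewrite vE in ht; case/and5P: ht => _ _ hk' kmin' hball.
rewrite v2 in hk' kmin'.
have kE : k' = k.
  case: (ltngtP k' k) => // lt; first by have := kmin _ lt; rewrite hk'.
  have /allP/(_ k) := kmin'; rewrite mem_iota add0n lt => /(_ isT).
  by rewrite hk.
rewrite kE in hball.
have iq := string_code_lt qn.
have /allP/(_ (string_code q)) := hball; rewrite mem_iota add0n => /(_ iq) /andP[r0].
have r1 : run (string_code q) (S d v k) tau == 1%N by rewrite run_acc // mem_set.
rewrite r1 /= => /hasP[s]; rewrite mem_iota add0n /= => stau hs.
have hsy : stW (string_code q) s = (string_code y).+1.
  case Es : (stW (string_code q) s) hs => [//|y'] _.
  have Wq' : W q = Some (decode y') by apply/stWP; exists s; rewrite decodeK.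
  by move: Wq'; rewrite Wq => -[->]; rewrite decodeK.
move: yE; rewrite /bsum (bigD1 (Ordinal iq)) //= (bigD1 (Ordinal stau)) //= hsy.
by lia.
Qed.

End Bound.

Local Open Scope ring_scope.

Theorem theorem6p2 (R : realType) (T : R) (V W : string -> option string)
    (f : nat -> nat)
    (T_computable : computable_real T) (T_gt0 : 0 < T) (T_le1 : T <= 1)
    (V_optimal : optimal_prefix_free_machine V)
    (W_optimal : optimal_prefix_free_machine W)
    (f_order : order_function f) :
  (exists c : nat,
     reducible_in_query_size (fun n => (f n + c)%N) (dom W) (Pf (halting_sum V T))) <->
  (exists c : nat, forall n : nat, n%:R / T <= (f n + c)%:R).
Proof.
have [f_rec f_mono _] := f_order.
split=> [[c]|[c hc]].
  exact: (bound_of_reducible T_computable T_gt0 T_le1 V_optimal.1 W_optimal f_rec f_mono).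
exact: (reducible_of_bound T_computable T_gt0 T_le1 V_optimal W_optimal.1 f_rec hc).
Qed.
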